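(* Let $G=(V,E)$ be a hedgegraph on $n$ vertices with hedge weights $w:E\to\mathbb{R}_{\ge0}$, let $p=\sum_{e\in E}\sum_{h\in e}|h|$, and let $\varepsilon>0$. Then there exist hedge weights $w':E\to\mathbb{R}_{\ge0}$ such that (1) $|\mathrm{support}(w')|=O(n\log n/\varepsilon^2)$ and (2) $(1-\varepsilon)d_{(G,w)}(\mathcal{P})\le d_{(G,w')}(\mathcal{P})\le(1+\varepsilon)d_{(G,w)}(\mathcal{P})$ for every partition $\mathcal{P}$ of $V$. Moreover, such a weighting $w'$ can be computed with high probability in polynomial time.
   Context: A hedgegraph $G=(V,E)$ consists of a finite vertex set $V$ and a finite set $E$ of hedges; each hedge is a set of hyperedges (subsets of $V$), the hyperedges within one hedge are pairwise vertex-disjoint, and no hyperedge belongs to two hedges. For a partition $\mathcal{P}$ of $V$ into nonempty parts, $\delta(\mathcal{P})$ is the set of hedges containing a hyperedge intersecting at least two parts of $\mathcal{P}$, and for weights $w$ the partition capacity is $d_{(G,w)}(\mathcal{P})=\sum_{e\in\delta(\mathcal{P})}w(e)$. *)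

(* Defs.v *)
From HB Require Import structures.
From mathcomp Require Import all_boot all_order all_algebra.
From mathcomp Require Import reals exp.
Set Implicit Arguments.
Unset Strict Implicit.
Unset Printing Implicit Defensive.
Import Order.TTheory GRing.Theory Num.Theory.
Local Open Scope ring_scope.

Notation hyperedge V := {set V}.
Notation hedge V := {set (hyperedge V)}.

(* The second field says that the hyperedges inside one hedge are pairwise
   vertex-disjoint, the third that no hyperedge belongs to two hedges. *)
Record hedgegraph (V : finType) := HedgeGraph {
  hedges : {set hedge V};
  hedges_disjoint_hyperedges : {in hedges, forall e : hedge V, trivIset e};
  hedges_no_shared_hyperedge : trivIset hedges
}.

Definition hedgegraph_size (V : finType) (G : hedgegraph V) : nat :=
  (\sum_(e in hedges G) \sum_(h in e) #|h|)%N.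

Definition crosses (V : finType) (P : {set {set V}}) (h : hyperedge V) : bool :=
  (1 < #|[set A in P | A :&: h != set0]|)%N.

Definition delta (V : finType) (G : hedgegraph V) (P : {set {set V}}) :
    {set hedge V} :=
  [set e in hedges G | [exists h in e, crosses P h]].

Section Capacity.
Variables (R : realType) (V : finType) (G : hedgegraph V).
Implicit Types w : hedge V -> R.

Definition capacity w (P : {set {set V}}) : R := \sum_(e in delta G P) w e.

(* Only the values of a weighting on the hedges of G matter. *)
Definition nonneg_weights w : bool := [forall e in hedges G, 0 <= w e].

Definition weight_support w : {set hedge V} := [set e in hedges G | w e != 0].

Definition is_sparsifier (C : R) w (eps : R) w' : bool :=
  [&& nonneg_weights w',
      #|weight_support w'|%:R
        <= C * (#|V|%:R * ln (#|V|%:R : R) / eps ^+ 2) &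
      [forall P : {set {set V}}, partition P [set: V] ==>
        ((1 - eps) * capacity w P <= capacity w' P
           <= (1 + eps) * capacity w P)]].

End Capacity.

(* Randomized real RAM.  The memory consists of arrays of naturals and arrays
   of reals, both indexed by nat; array names are fixed in the program and
   cell indices are computed.  Every step has unit cost.  Naturals can only be
   added and (truncatedly) subtracted, so after t steps they have O(t) more
   bits than the input.  Reals have the field operations and comparisons, but
   there is no floor and no conversion from reals to naturals.  The only
   source of randomness is one fair coin per [Flip] step. *)

Inductive nexp :=
  | NConst of nat
  | NGet of nat & nexp
  | NAdd of nexp & nexp
  | NSub of nexp & nexp.

Inductive rexp :=
  | RConst of nat
  | RGet of nat & nexp
  | RAdd of rexp & rexp
  | RSub of rexp & rexp
  | RMul of rexp & rexp
  | RDiv of rexp & rexp.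

Inductive bexp :=
  | NLe of nexp & nexp
  | RLe of rexp & rexp
  | BNot of bexp
  | BAnd of bexp & bexp.

Inductive cmd :=
  | Skip
  | NSet of nat & nexp & nexp
  | RSet of nat & nexp & rexp
  | Flip of nat & nexp
  | Seq of cmd & cmd
  | If of bexp & cmd & cmd
  | While of bexp & cmd.

Section Machine.
Variable R : realType.

Record state := State {
  nmem : nat -> nat -> nat;
  rmem : nat -> nat -> R;
  coins : seq bool
}.

Definition update (T : Type) (m : nat -> nat -> T) (a i : nat) (x : T) :
    nat -> nat -> T :=
  fun b j => if (b == a) && (j == i) then x else m b j.

Fixpoint neval (s : state) (e : nexp) : nat :=
  match e with
  | NConst k => k
  | NGet a i => nmem s a (neval s i)
  | NAdd e1 e2 => (neval s e1 + neval s e2)%N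
  | NSub e1 e2 => (neval s e1 - neval s e2)%N
  end.

Fixpoint reval (s : state) (e : rexp) : R :=
  match e with
  | RConst k => k%:R
  | RGet a i => rmem s a (neval s i)
  | RAdd e1 e2 => reval s e1 + reval s e2
  | RSub e1 e2 => reval s e1 - reval s e2
  | RMul e1 e2 => reval s e1 * reval s e2
  | RDiv e1 e2 => reval s e1 / reval s e2
  end.

Fixpoint beval (s : state) (e : bexp) : bool :=
  match e with
  | NLe e1 e2 => (neval s e1 <= neval s e2)%N
  | RLe e1 e2 => reval s e1 <= reval s e2
  | BNot e1 => ~~ beval s e1
  | BAnd e1 e2 => beval s e1 && beval s e2
  end.

(* A configuration is the list of commands still to be executed together with
   the current state; the machine has halted when that list is empty. *)
Definition step (cs : seq cmd * state) : seq cmd * state :=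
  let: (k, s) := cs in
  match k with
  | [::] => cs
  | Skip :: k' => (k', s)
  | NSet a i e :: k' =>
      (k', State (update (nmem s) a (neval s i) (neval s e)) (rmem s) (coins s))
  | RSet a i e :: k' =>
      (k', State (nmem s) (update (rmem s) a (neval s i) (reval s e)) (coins s))
  | Flip a i :: k' =>
      (k', State (update (nmem s) a (neval s i) (head false (coins s)))
                 (rmem s) (behead (coins s)))
  | Seq c1 c2 :: k' => ([:: c1, c2 & k'], s)
  | If b c1 c2 :: k' => ((if beval s b then c1 else c2) :: k', s)
  | While b c :: k' => (if beval s b then [:: c, While b c & k'] else k', s)
  end.

Definition run (t : nat) (prog : cmd) (s : state) : seq cmd * state :=
  iter t step ([:: prog], s).

Section InputOutput.
Variables (V : finType) (G : hedgegraph V).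
Implicit Types w : hedge V -> R.

Definition encode_hyperedge (h : hyperedge V) : seq nat :=
  #|h| :: [seq nat_of_ord (enum_rank v) | v <- enum h].

Definition encode_hedge (e : hedge V) : seq nat :=
  #|e| :: flatten [seq encode_hyperedge h | h <- enum e].

Definition encode_hedgegraph : seq nat :=
  [:: #|V|, #|hedges G| &
      flatten [seq encode_hedge e | e <- enum (hedges G)]].

(* Input: the natural array 0 holds the encoding of G, the real array 0 the
   hedge weights in the order of [enum (hedges G)], and cell 0 of the real
   array 1 holds eps; all other cells are 0. *)
Definition init_state w (eps : R) (tape : seq bool) : state :=
  State
    (fun a i => if a == 0%N then nth 0%N encode_hedgegraph i else 0%N)
    (fun a i =>
       if a == 0%N then nth 0 [seq w e | e <- enum (hedges G)] i
       else if (a == 1%N) && (i == 0%N) then eps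
       else 0)
    tape.

(* Output: the real array 2, in the same order as the input weights. *)
Definition output_weights (s : state) : hedge V -> R :=
  fun e => rmem s 2 (index e (enum (hedges G))).

Definition run_succeeds (C : R) (prog : cmd) w (eps : R) (t : nat)
    (tape : seq bool) : bool :=
  let: (k, s) := run t prog (init_state w eps tape) in
  nilp k && is_sparsifier G C w eps (output_weights s).

(* A run of t steps reads at most t coins, so a uniformly random tape of
   length t describes all of its randomness. *)
Definition success_probability (C : R) (prog : cmd) w (eps : R) (t : nat) : R :=
  #|[set tape : t.-tuple bool | run_succeeds C prog w eps t tape]|%:R
    / 2%:R ^+ t.

Definition input_size : nat := (#|V| + #|hedges G| + hedgegraph_size G)%N.

End InputOutput.
End Machine.

(* Main.v *)
Require Import Defs.
From mathcomp Require Import all_boot all_order all_algebra.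
From mathcomp Require Import reals sequences exp.
From mathcomp Require Import zify ring lra.
Set Implicit Arguments.
Unset Strict Implicit.
Unset Printing Implicit Defensive.
Import Order.TTheory GRing.Theory Num.Theory.
Local Open Scope ring_scope.

(* The hedges are halved repeatedly.  With m positive weights left, one takes
   t = m / 4n forests greedily in order of decreasing weight, each forest using
   one edge (a pair of vertices of a common hyperedge) per hedge.  The at most
   t n <= m / 4 hedges used by the forests are kept; the other hedges are paired
   up, and a fair coin decides which member of a pair is deleted and which one
   doubles its weight.

   A hedge outside the forests is spanned, in each of the t forests, by edges of
   at least its own weight, so a partition that it crosses has capacity at least
   t times its weight.  Among the hedges of weight in [W, 2W], the set D of those
   crossing a partition is determined by the crossing edges of weight at least W
   in any single forest together with the parts of their ends.  Hence at most
   n^(4s) sets D come from s crossing edges; as the tail bound for D involves the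
   average of s over the forests, convexity reduces the union bound over D to one
   forest, and the relative error is O(sqrt(n log n / m)) with high probability.
   Since m shrinks geometrically the errors of all levels add up to O(eps) when
   the process stops at m = O(n log n / eps^2).  For #|V| <= 1 or eps >= 1 the
   zero weighting is a sparsifier. *)

(** * Random tapes *)

(** With only fair coins and no conversion from reals to naturals, repeated halving suits the
    machine better than one round of sampling with hedge-dependent probabilities. Pairing, instead
    of independent deletion, makes the number of positive weights drop by the number of pairs on
    every tape: the support bound is deterministic and only the capacities need concentration.

    The obstacle is the union bound. A single tail bound cannot pay for all partitions, so the
    probability allotted to a set D has to decrease with the number of forest edges that determine
    D. Counting needs this number for one fixed forest, while the variance and the capacity only see
    the sum over all forests; this mismatch is what the convexity argument repairs. *)

Section Mean.
Variable R : realType.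
Implicit Types (f g : seq bool -> R).

(** Expectation over a uniform tape, defined coin by coin so that splitting the tape and inducting
    on its length need no reindexing; [mean_card] connects it with the counting of tapes in
    [success_probability]. *)
Fixpoint mean (T : nat) f : R :=
  if T is T'.+1 then
    (mean T' (fun u => f (true :: u)) + mean T' (fun u => f (false :: u))) / 2
  else f [::].

Lemma le_mean T f g :
  (forall u, size u = T -> f u <= g u) -> mean T f <= mean T g.
Proof.
elim: T f g => [|T IH] f g fg /=; first exact: fg.
by rewrite ler_pM2r ?invr_gt0 ?ltr0n // lerD // IH // => u su; apply: fg; rewrite /= su.
Qed.

Lemma eq_mean T f g :
  (forall u, size u = T -> f u = g u) -> mean T f = mean T g.
Proof. by move=> fg; apply/eqP; rewrite eq_le !le_mean // => u /fg ->. Qed.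

Lemma mean_const T (c : R) : mean T (fun=> c) = c.
Proof. by elim: T => //= T ->; field. Qed.

Lemma meanD T f g : mean T (fun u => f u + g u) = mean T f + mean T g.
Proof. by elim: T f g => //= T IH f g; rewrite !IH; field. Qed.

Lemma meanZ T (c : R) f : mean T (fun u => c * f u) = c * mean T f.
Proof. by elim: T f => //= T IH f; rewrite !IH; field. Qed.

Lemma mean_sum T (I : Type) (r : seq I) (P : pred I) (F : I -> seq bool -> R) :
  mean T (fun u => \sum_(i <- r | P i) F i u) =
  \sum_(i <- r | P i) mean T (F i).
Proof.
elim: r => [|i r IH].
  by rewrite big_nil -[RHS](mean_const T); apply: eq_mean => u _; rewrite big_nil.
rewrite big_cons -IH; case: ifP => Pi; [rewrite -meanD|];
  by apply: eq_mean => u _; rewrite big_cons Pi.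
Qed.

Lemma mean_cat S T f :
  mean (S + T) f = mean S (fun u => mean T (fun v => f (u ++ v))).
Proof. by elim: S f => //= S IH f; rewrite !IH. Qed.

Lemma mean_card T (P : pred (seq bool)) :
  #|[set u : T.-tuple bool | P u]|%:R / 2 ^+ T = mean T (fun u => (P u)%:R) :> R.
Proof.
have -> : #|[set u : T.-tuple bool | P u]|%:R =
    \sum_(u : T.-tuple bool) (P u)%:R :> R.
  rewrite -sum1dep_card natr_sum [RHS](bigID (fun u : T.-tuple bool => P u)) /=.
  rewrite [X in _ = _ + X]big1 => [|u /negbTE -> //].
  by rewrite addr0; apply: eq_bigr => u ->.
elim: T P => [|T IH] P /=.
  rewrite expr0 divr1 (bigD1 [tuple]) //= big1 ?addr0 // => u.
  by rewrite tuple0.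
rewrite -!IH (bigID (fun u : T.+1.-tuple bool => thead u)) /=.
have cons_sum (b : bool) :
    \sum_(u : T.+1.-tuple bool | thead u == b) (P u)%:R =
    \sum_(u : T.-tuple bool) (P (b :: u))%:R :> R.
  rewrite (reindex_onto (fun u : T.-tuple bool => [tuple of b :: u])
                        (fun u : T.+1.-tuple bool => [tuple of behead u])) /=.
    apply: eq_bigl => u; rewrite theadE eqxx /=.
    by apply/eqP; apply: val_inj; case: u.
  by move=> u /eqP <-; rewrite -tuple_eta.
rewrite (eq_bigl (fun u : T.+1.-tuple bool => thead u == true)); last first.
  by move=> u; case: (thead u).
rewrite cons_sum (eq_bigl (fun u : T.+1.-tuple bool => thead u == false)); last first.
  by move=> u; case: (thead u).
by rewrite cons_sum exprS; field; rewrite expf_neq0 ?pnatr_eq0.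
Qed.

(** For [0 <= x <= 1/2], inverting [1 + y <= expR y] bounds the two exponentials by [1 + x + 2 x^2]
    and [1 - x + 2 x^2]; beyond [1/2] both exponents are at most [2 x^2]. *)
Lemma expR_addN_le (x : R) : expR x + expR (- x) <= 2 * expR (2 * x ^+ 2).
Proof.
wlog x0 : x / 0 <= x.
  move=> H; case: (leP 0 x) => [x0|/ltW xn]; first exact: H.
  by have := H (- x); rewrite opprK sqrrN oppr_ge0 addrC; apply.
have xx := sqr_ge0 x.
case: (leP x (1/2)) => x2.
  have xxx : 0 <= x ^+ 2 * (1 - 2 * x) by apply: mulr_ge0 => //; lra.
  have xxx' : 0 <= x ^+ 2 * (1 + 2 * x) by apply: mulr_ge0 => //; lra.
  have e1 : expR x <= 1 + x + 2 * x ^+ 2.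
    rewrite -[x in expR x]opprK expRN -[leLHS]mulr1 ler_pdivrMl ?expR_gt0 //.
    apply: (@le_trans _ _ ((1 - x) * (1 + x + 2 * x ^+ 2))); first lra.
    by apply: ler_wpM2r (expR_ge1Dx _); lra.
  have e2 : expR (- x) <= 1 - x + 2 * x ^+ 2.
    rewrite expRN -[leLHS]mulr1 ler_pdivrMl ?expR_gt0 //.
    apply: (@le_trans _ _ ((1 + x) * (1 - x + 2 * x ^+ 2))); first lra.
    by apply: ler_wpM2r (expR_ge1Dx _); lra.
  have := expR_ge1Dx (2 * x ^+ 2); lra.
have x3 : 0 <= x * (x - 1 / 2) by apply: mulr_ge0; lra.
have e1 : expR x <= expR (2 * x ^+ 2) by rewrite ler_expR; lra.
have e2 : expR (- x) <= expR (2 * x ^+ 2) by rewrite ler_expR; lra.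
lra.
Qed.

Definition sign_at (u : seq bool) (k : nat) : R :=
  if nth false u k then 1 else -1.

(* Hoeffding's bound; the constant 2 in the exponent instead of 1/2 comes from a
   proof that only uses [1 + x <= expR x]. *)
Lemma mean_expR_signs (M : nat) (b : nat -> R) :
  mean M (fun u => expR (\sum_(k < M) sign_at u k * b k))
    <= expR (2 * \sum_(k < M) b k ^+ 2).
Proof.
elim: M b => [|M IH] b /=; first by rewrite !big_ord0 mulr0.
have split_sum c : mean M (fun u => expR (\sum_(k < M.+1) sign_at (c :: u) k * b k)) =
    expR ((if c then 1 else -1) * b 0%N) *
    mean M (fun u => expR (\sum_(k < M) sign_at u k * b k.+1)).
  rewrite -meanZ; apply: eq_mean => u _.
  by rewrite big_ord_recl expRD.
rewrite (split_sum true) (split_sum false) -mulrDl mul1r mulN1r big_ord_recl mulrDr expRD.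
have m0 : 0 <= mean M (fun u => expR (\sum_(k < M) sign_at u k * b k.+1)).
  by rewrite -(mean_const M 0); apply: le_mean => u _; exact: expR_ge0.
set m := mean M _ in m0 *; set y := expR (2 * b 0%N ^+ 2).
have xy : expR (b 0%N) + expR (- b 0%N) <= 2 * y by exact: expR_addN_le.
have mz : m <= expR (2 * \sum_(k < M) b k.+1 ^+ 2) by exact: (IH (fun k => b k.+1)).
have x0 : 0 <= expR (b 0%N) + expR (- b 0%N) by rewrite addr_ge0 ?expR_ge0.
have := ler_pM x0 m0 xy mz; rewrite -/y; lra.
Qed.

(** Distinct coins leave at most one term in the sum. *)
Lemma sqr_sum_filter (T : eqType) (ps : seq T) (c : T -> nat) (a : T -> R) k :
  uniq (map c ps) ->
  (\sum_(p <- ps | c p == k) a p) ^+ 2 = \sum_(p <- ps | c p == k) a p ^+ 2.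
Proof.
elim: ps => [|p ps IH] /=; first by rewrite !big_nil expr0n.
move=> /andP[pN /IH {}IH]; rewrite !big_cons; case: eqP => // cp.
rewrite big1_seq ?addr0; last first.
  move=> q /andP[/eqP cq qps]; case/negP: pN.
  by apply/mapP; exists q => //; rewrite cp cq.
rewrite big1_seq ?addr0 //.
move=> q /andP[/eqP cq qps]; case/negP: pN.
by apply/mapP; exists q => //; rewrite cp cq.
Qed.

(** Regrouping by coin turns the sum over pairs into one over coin positions; the coefficient of a
    coin is the term of the only pair that reads it, or 0. *)
Lemma mean_expR_seq (M : nat) (T : eqType) (ps : seq T) (c : T -> nat)
    (a : T -> R) :
  uniq (map c ps) -> (forall p, p \in ps -> (c p < M)%N) ->
  mean M (fun u => expR (\sum_(p <- ps) sign_at u (c p) * a p))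
    <= expR (2 * \sum_(p <- ps) a p ^+ 2).
Proof.
move=> uc cM.
have part (F : nat -> T -> R) : \sum_(p <- ps) F (c p) p =
    \sum_(k < M) \sum_(p <- ps | c p == k) F k p.
  rewrite (exchange_big_dep predT) //= big_seq [RHS]big_seq.
  apply: eq_bigr => p /cM cp.
  rewrite (bigD1 (Ordinal cp)) //= big1 ?addr0 // => k /andP[/eqP ck].
  by rewrite -val_eqE /= ck eqxx.
have := mean_expR_signs M (fun k => \sum_(p <- ps | c p == k) a p).
rewrite (part (fun _ p => a p ^+ 2)).
under eq_bigr => k _ do rewrite sqr_sum_filter //.
apply: le_trans; apply: le_mean => u _; rewrite ler_expR.
rewrite (part (fun k p => sign_at u k * a p)).
by under eq_bigr => k _ do rewrite -mulr_sumr.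
Qed.

End Mean.

(** * Error of one halving step *)

(** Generating function for the union bound: distinct sets D have distinct codes inside a set of
    [n^4] elements, so a sum of [y^|code|] over the sets D is bounded by a sum over subsets. *)
Lemma sum_pow_card (R : comNzRingType) (T : finType) (y : R) :
  \sum_(A : {set T}) y ^+ #|A| = (1 + y) ^+ #|T|.
Proof.
rewrite addrC -[in RHS]prodr_const.
rewrite [RHS](bigA_distr _ _ (fun _ => y) (fun _ => 1)) /=.
by apply: eq_bigr => A _; rewrite -prodr_const big_mkcond.
Qed.

Lemma sum_seq_le_ord (R : realType) (M : nat) (s : seq nat) (h : nat -> R) :
  uniq s -> (forall x, x \in s -> (x < M)%N) -> (forall x, 0 <= h x) ->
  \sum_(x <- s) h x <= \sum_(e < M) h e.
Proof.
move=> us sM h0; rewrite -(big_mkord predT h) /index_iota subn0.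
rewrite (perm_big [seq x <- iota 0 M | x \in s]) /=.
  by rewrite big_filter [leRHS](bigID (mem s)) /= lerDl sumr_ge0.
apply: uniq_perm => //; first by rewrite filter_uniq ?iota_uniq.
move=> x; rewrite mem_filter mem_iota add0n /=.
by case xs: (x \in s) => //=; rewrite sM.
Qed.

Lemma size_uniq_ord (M : nat) (s : seq nat) :
  uniq s -> (forall x, x \in s -> (x < M)%N) ->
  (size s = \sum_(e < M) ((e : nat) \in s))%N.
Proof.
move=> us sM; rewrite -(big_mkord predT (fun e => (e \in s) : nat)) /index_iota subn0.
rewrite -big_mkcond /= sum1_count -size_filter; apply: perm_size.
apply: uniq_perm => //; first by rewrite filter_uniq ?iota_uniq.
move=> x; rewrite mem_filter mem_iota add0n /=.
by case xs: (x \in s) => //=; rewrite sM.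
Qed.

(** Jensen's inequality, from the tangent line of the exponential at the mean: the linear terms
    cancel in the sum. *)
Lemma expR_avg_le (R : realType) (T : Type) (s : seq T) (x : T -> R) :
  (0 < size s)%N ->
  expR ((\sum_(i <- s) x i) / (size s)%:R)
    <= (\sum_(i <- s) expR (x i)) / (size s)%:R.
Proof.
move=> s0; have sp : 0 < (size s)%:R :> R by rewrite ltr0n.
set a := (X in expR X); rewrite ler_pdivlMr // mulrC.
have -> : (size s)%:R * expR a = \sum_(i <- s) expR a * (1 + (x i - a)).
  rewrite -mulr_sumr big_split sumrB /= !big_const_seq !count_predT !iter_addr_0.
  rewrite -[a *+ _]mulr_natl /a; field; exact: lt0r_neq0.
apply: ler_sum => i _; rewrite mulrC -ler_pdivlMr ?expR_gt0 // -expRB.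
exact: expR_ge1Dx.
Qed.

Lemma exp1D_le (R : realType) (y : R) N :
  0 <= y -> N%:R * y <= 1 / 2 -> (1 + y) ^+ N - 1 <= 2 * (N%:R * y).
Proof.
move=> y0; set z := _ * y => z2.
have z0 : 0 <= z by rewrite mulr_ge0.
have : (1 + y) ^+ N <= expR z.
  rewrite expRM_natl lerXn2r ?nnegrE ?expR_ge0 ?expR_ge1Dx //; lra.
have : expR z <= 1 + 2 * z.
  rewrite -[z in expR z]opprK expRN -[leLHS]mulr1 ler_pdivrMl ?expR_gt0 //.
  apply: (@le_trans _ _ ((1 - z) * (1 + 2 * z))).
    have : 0 <= z * (1 - 2 * z) by apply: mulr_ge0 => //; lra.
    lra.
  by apply: ler_wpM2r (expR_ge1Dx _); lra.
lra.
Qed.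

(* [(e, x, y)] joins two vertices [x], [y] of a hyperedge of the hedge [e]. *)
Local Notation link := (nat * nat * nat)%type.

Section Links.
Variables (R : realType) (n' M : nat).
Local Notation n := n'.+1.
Implicit Types (f : {ffun 'I_n -> 'I_n}) (L F : seq link) (wt : nat -> R).

(** A partition is represented by a labelling [f] of the vertices by vertex numbers; [part_label]
    provides one for each partition. *)
Definition splits f (l : link) : bool := f (inord l.1.2) != f (inord l.2).

Definition crossing L f (e : nat) : bool :=
  has (fun l => (l.1.1 == e) && splits f l) L.

Definition link_capacity L wt f : R := \sum_(e < M | crossing L f e) wt e.

(* [a] and [b] are connected by links of weight at least [W], stated dually. *)
Definition joined wt (W : R) F (a b : nat) : Prop :=
  forall g : nat -> nat,
    (forall l, l \in F -> W <= wt l.1.1 -> g l.1.2 = g l.2) -> g a = g b.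

Definition eligible wt (Fs : seq (seq link)) (e : nat) : bool :=
  (0 < wt e) && (e \notin [seq l.1.1 | l <- flatten Fs]).

(** The last clause is the optimality of a maximum-weight spanning forest: the ends of a link left
    out are already connected through links at least as heavy. *)
Definition forest_packing L wt (Fs : seq (seq link)) : Prop :=
  [/\ forall F, F \in Fs -> {subset F <= L},
      uniq [seq l.1.1 | l <- flatten Fs]
    & forall F l, F \in Fs -> l \in L -> eligible wt Fs l.1.1 ->
      joined wt (wt l.1.1) F l.1.2 l.2].

Definition good_pairs wt Fs (ps : seq (nat * nat)) : Prop :=
  uniq (map fst ps ++ map snd ps) /\
  forall e, e \in map fst ps ++ map snd ps -> (e < M)%N /\ eligible wt Fs e.

Lemma good_pairs_mem wt Fs ps p : good_pairs wt Fs ps -> p \in ps ->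
  ((p.1 < M)%N /\ eligible wt Fs p.1) /\ ((p.2 < M)%N /\ eligible wt Fs p.2).
Proof.
by case=> _ psM pps; split; apply: psM;
  rewrite mem_cat ?(map_f fst pps) // (map_f snd pps) orbT.
Qed.

Lemma good_pairs_coins wt Fs ps : good_pairs wt Fs ps ->
  uniq [seq (M.-1 - p.2)%N | p <- ps] /\
  forall p, p \in ps -> (M.-1 - p.2 < M)%N.
Proof.
case; rewrite cat_uniq => /and3P[_ _ u2] psM.
have lt2 p : p \in ps -> (p.2 < M)%N.
  by move=> pps; case: (psM p.2) => //; rewrite mem_cat (map_f snd) ?orbT.
split=> [|p /lt2]; last by lia.
rewrite (map_comp (fun x => M.-1 - x)%N snd) map_inj_in_uniq // => x y.
move=> /mapP[p /lt2 pM ->] /mapP[q /lt2 qM ->] /= E.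
have {}E : (M.-1 - p.2 = M.-1 - q.2)%N := E; have : p.2 = q.2 :> nat by lia.
by [].
Qed.

(* One coin per pair decides which of the two weights is doubled; the loops of
   the program run downwards, hence the position of the coin. *)
Definition resampled wt (ps : seq (nat * nat)) (u : seq bool) (e : nat) : R :=
  wt e * (1 + \sum_(p <- ps) sign_at R u (M.-1 - p.2) *
                ((p.1 == e)%:R - (p.2 == e)%:R)).

(** * Deviation of one weight class *)

Section WeightClass.
Variables (L : seq link) (wt : nat -> R) (Fs : seq (seq link)).
Variables (ps : seq (nat * nat)) (W eta : R) (C : pred nat).
Hypothesis L_ltM : forall l, l \in L -> (l.1.1 < M)%N.
Hypothesis packing : forest_packing L wt Fs.
Hypothesis pairsP : good_pairs wt Fs ps.
Hypotheses (W0 : 0 < W) (eta0 : 0 < eta).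
Hypothesis C_eligible : forall e, C e -> eligible wt Fs e.
Hypothesis C_ge : forall e, C e -> W <= wt e.
Hypothesis C_le : forall e, C e -> wt e <= 2 * W.

Let D f : {set 'I_M} := [set e : 'I_M | C e && crossing L f e].

(** What a forest remembers of [f]: its links of weight at least [W] that [f] splits, with the
    labels of both ends. Four vertex numbers describe such a link, whence the [n^4]. *)
Let code F f : {set 'I_n * 'I_n * 'I_n * 'I_n} :=
  [set c | has (fun l => [&& W <= wt l.1.1, splits f l &
     c == (inord l.1.2, inord l.2, f (inord l.1.2), f (inord l.2))]) F].

(** [q f / t] is the average code size of a forest, the quantity that appears in the exponent of the
    tail bound. *)
Let q f : nat := (\sum_(F <- Fs) #|code F f|)%N.

Lemma joined_class F l :
  F \in Fs -> l \in L -> C l.1.1 -> joined wt W F l.1.2 l.2.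
Proof.
move=> FFs lL Cl g gF; case: packing => _ _ /(_ F l FFs lL (C_eligible Cl)).
by apply=> k kF kl; apply: gF => //; apply: le_trans kl; exact: C_ge.
Qed.

Lemma mem_code F f l : l \in F -> W <= wt l.1.1 -> splits f l ->
  (inord l.1.2, inord l.2, f (inord l.1.2), f (inord l.2)) \in code F f.
Proof.
by move=> lF Wl sl; rewrite inE; apply/hasP; exists l => //; rewrite Wl sl /=.
Qed.

Lemma codeP F f a b c d : (a, b, c, d) \in code F f ->
  [/\ c = f a, d = f b & f a != f b].
Proof.
rewrite inE => /hasP[l _ /and3P[_ sl /eqP[-> -> -> ->]]].
by split.
Qed.

(* Labelings with the same code agree at the ends of all split links, hence
   "[f1 v = f2 v]" is constant along the links of [F]. *)
Lemma code_inj_sub F f1 f2 : F \in Fs -> code F f1 = code F f2 ->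
  D f1 \subset D f2.
Proof.
move=> FFs E12; apply/subsetP => e; rewrite !inE => /andP[Ce].
move=> /hasP[l lL /andP[/eqP le sl]]; rewrite Ce /=.
apply/hasP; exists l => //; rewrite le eqxx /=.
pose A v := f1 (inord v) == f2 (inord v).
(* Recording the label of [f1] where the labelings differ settles that case: equal values at the
   ends of [l] would then mean that [f1] does not split [l]. *)
pose g v := if A v then 0%N else (f1 (inord v) : nat).+1.
have := @joined_class F l FFs lL; rewrite le => /(_ Ce g).
have gF k : k \in F -> W <= wt k.1.1 -> g k.1.2 = g k.2.
  move=> kF Wk; case s1: (splits f1 k).
    have := mem_code kF Wk s1; rewrite E12 => /codeP[e1 e2 _].
    by rewrite /g /A e1 e2 !eqxx.
  case s2: (splits f2 k).
    have := mem_code kF Wk s2; rewrite -E12 => /codeP[_ _].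
    by rewrite -/(splits f1 k) s1.
  by move/negbFE/eqP: s1 => s1; move/negbFE/eqP: s2 => s2; rewrite /g /A s1 s2.
move=> /(_ gF); rewrite /g /A /splits.
case: eqP => [<-|_]; case: eqP => [<-|_] // [/val_inj E].
by rewrite /splits E eqxx in sl.
Qed.

Lemma code_inj F f1 f2 : F \in Fs -> code F f1 = code F f2 -> D f1 = D f2.
Proof.
by move=> FFs E; apply/eqP; rewrite eqEsubset !(code_inj_sub FFs).
Qed.

(** Otherwise [f] would be constant along the heavy links of [F], hence on the ends of every link of
    a hedge of the class, and none of these hedges would cross. *)
Lemma code_gt0 F f : F \in Fs -> D f != set0 -> (0 < #|code F f|)%N.
Proof.
move=> FFs /set0Pn[e]; rewrite inE => /andP[Ce /hasP[l lL /andP[/eqP le sl]]].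
rewrite lt0n cards_eq0; apply/negP => /eqP c0.
have := @joined_class F l FFs lL; rewrite le => /(_ Ce (fun v => f (inord v))).
have gF k : k \in F -> W <= wt k.1.1 ->
    f (inord k.1.2) = f (inord k.2) :> nat.
  move=> kF Wk; apply/eqP; case s: (splits f k); last by move/negbFE: s.
  by have := mem_code kF Wk s; rewrite c0 inE.
by move=> /(_ gF)/val_inj E; rewrite /splits E eqxx in sl.
Qed.

(** The coded links belong to distinct hedges used by forests, whereas [D f] consists of eligible
    hedges: two disjoint families of crossing hedges of weight at least [W]. This charges the
    allowed deviation to the capacity. *)
Lemma q_card_le f :
  (q f + #|D f| <= #|[set e : 'I_M | crossing L f e && (W <= wt e)%R]|)%N.
Proof.
case: packing => FL uFs _.
pose S := [seq l.1.1 | l <- flatten Fs & (W <= wt l.1.1) && splits f l].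
have code_le F : F \in Fs ->
    (#|code F f| <= count (fun l => (W <= wt l.1.1)%R && splits f l) F)%N.
  move=> _; rewrite -size_filter.
  rewrite -(size_map (fun l : link => (inord l.1.2 : 'I_n, inord l.2 : 'I_n, f (inord l.1.2), f (inord l.2)))).
  apply: leq_trans (card_size _); apply/subset_leq_card/subsetP => c.
  rewrite inE => /hasP[l lF /and3P[Wl sl /eqP ->]].
  by apply: map_f; rewrite mem_filter Wl sl.
have qS : (q f <= size S)%N.
  rewrite size_map size_filter count_flatten sumnE big_map.
  by rewrite /q big_seq [leqRHS]big_seq; apply: leq_sum.
have SP e : e \in S -> [/\ (e < M)%N, crossing L f e, W <= wt e & ~~ C e].
  move=> /mapP[l]; rewrite mem_filter => /andP[/andP[Wl sl] lFs] ->.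
  have lL : l \in L by case/flattenP: (lFs) => F FFs; exact: FL.
  split=> //; first exact: L_ltM.
    by apply/hasP; exists l => //; rewrite eqxx.
  by apply/negP => /C_eligible/andP[_ /mapP]; apply; exists l.
have uS : uniq S.
  by apply: subseq_uniq uFs; apply/map_subseq/filter_subseq.
apply: (@leq_trans (size S + #|D f|)); first by rewrite leq_add2r.
rewrite (@size_uniq_ord M _ uS); last by move=> e /SP[].
rewrite -!sum1dep_card !(big_mkcond (fun e : 'I_M => _ && _)) -big_split /=.
apply: leq_sum => e _; case eS: ((e : nat) \in S).
  by case: (SP _ eS) => _ -> -> /negbTE ->.
case: ifP => // /andP[Ce ->] /=; by rewrite C_ge.
Qed.


Let v f (e : nat) : R := if C e && crossing L f e then wt e else 0.

Let X u f : R :=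
  \sum_(p <- ps) sign_at R u (M.-1 - p.2) * (v f p.1 - v f p.2).

Let t := size Fs.
Let mC : nat := (\sum_(e < M) C e)%N.
Let kappa : R := eta ^+ 2 * t%:R / 32.

Hypothesis t_gt0 : (0 < t)%N.
Hypothesis kappa_ge1 : 1 <= kappa.
Hypothesis kappa_big : (n ^ 4)%:R * expR (- kappa) <= 1 / 2 :> R.

Lemma v_ge0 f e : 0 <= v f e.
Proof. by rewrite /v; case: ifP => // /andP[/C_ge + _]; apply: le_trans; exact: ltW. Qed.

(** Both members of a pair may lie in the class, but [(a - b)^2 <= a^2 + b^2] for nonnegative [a]
    and [b], and no hedge occurs twice among the pairs. *)
Lemma sum_sqr_v_le f :
  \sum_(p <- ps) (v f p.1 - v f p.2) ^+ 2 <= 4 * W ^+ 2 * #|D f|%:R.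
Proof.
case: pairsP => u psM.
apply: (@le_trans _ _ (\sum_(e <- map fst ps ++ map snd ps) v f e ^+ 2)).
  rewrite big_cat /= !big_map -big_split /=; apply: ler_sum => p _.
  have := mulr_ge0 (v_ge0 f p.1) (v_ge0 f p.2); lra.
apply: (@le_trans _ _ (\sum_(e < M) v f e ^+ 2)).
  by apply: sum_seq_le_ord => // [x /psM[]//|x]; exact: sqr_ge0.
rewrite -sum1_card natr_sum mulr_sumr [leRHS]big_mkcond; apply: ler_sum => e _.
rewrite inE /v; case: ifP => [/andP[Ce _]|_]; last by rewrite expr0n.
have := C_le Ce; have := C_ge Ce => h1 h2.
have : 0 <= (2 * W - wt e) * (2 * W + wt e) by apply: mulr_ge0; lra.
lra.
Qed.

Lemma X_eq u f g : D f = D g -> X u f = X u g.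
Proof.
move=> E; have vE e : (e < M)%N -> v f e = v g e.
  by move=> eM; move/setP/(_ (Ordinal eM)): E; rewrite !inE /v /= => ->.
rewrite /X !big_seq; apply: eq_bigr => p pps.
by have [[? _] [? _]] := good_pairs_mem pairsP pps; rewrite !vE.
Qed.

(** The deviation [X] depends on [f] only through [D f], while the allowed deviation grows with
    [q f]; a labelling minimizing [q] is thus the worst case for its set, and one representative per
    set is enough. *)
Definition rep (S : {set 'I_M}) : {ffun 'I_n -> 'I_n} :=
  if [pick f | D f == S] is Some f0 then
    [arg min_(g < f0 | D g == S) q g]
  else [ffun=> ord0].

Lemma repP f : D (rep (D f)) = D f /\ (q (rep (D f)) <= q f)%N.
Proof.
rewrite /rep; case: pickP => [f0 Df0|/(_ f)]; last by rewrite eqxx.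
by case: arg_minnP => // g /eqP Dg qmin; split=> //; exact: qmin.
Qed.

(** The budget counts forest hedges too: through [q] it is at least of order [t W] as soon as [D f]
    is nonempty. *)
Definition class_deviates u f : bool :=
  eta * W * (q f + #|D f|)%:R < `|X u f|.

Lemma X_D0 u f : D f = set0 -> X u f = 0.
Proof.
move=> /setP D0.
have v0 e : (e < M)%N -> v f e = 0.
  by move=> eM; move: (D0 (Ordinal eM)); rewrite !inE /v /= => ->.
rewrite /X big_seq big1 // => p pps.
have [[? _] [? _]] := good_pairs_mem pairsP pps.
by rewrite !v0 // subrr mulr0.
Qed.

Let r : R := t%:R / mC%:R.
Let y : R := expR (- (kappa * (1 + r))).
(* The summand [r] makes the failure probability of a class proportional to its
   size [mC], so that it can be summed over all weight classes. *)
Let theta : R := eta / 16 * (1 + r) / W.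

Lemma D_card_le f : (#|D f| <= mC)%N.
Proof.
rewrite -sum1_card /mC big_mkcond; apply: leq_sum => e _.
by rewrite inE; case: (C e); case: (crossing _ _ _).
Qed.

Lemma t_le_q f : D f != set0 -> (t <= q f)%N.
Proof.
move=> D0; rewrite /t -sum1_size /q big_seq [leqRHS]big_seq.
by apply: leq_sum => F FFs; exact: code_gt0.
Qed.

(** With [d = |D f|], the choice of [theta] makes the left side [- eta^2 / 16 * (1 + r) * (q + d / 2
    - r d / 2)]. Since [d <= mC], one has [r d <= t <= q], so half of [q] absorbs the negative term;
    the other half gives the 32 in [kappa]. *)
Lemma class_exponent_le f : D f != set0 ->
  - (theta * (eta * W * (q f + #|D f|)%:R))
     + 2 * (theta ^+ 2 * (4 * W ^+ 2 * #|D f|%:R))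
  <= (\sum_(F <- Fs) - (kappa * (1 + r) * #|code F f|%:R)) / t%:R.
Proof.
move=> Df.
have tp : 0 < t%:R :> R by rewrite ltr0n.
have mp : 0 < mC%:R :> R.
  by rewrite ltr0n; apply: leq_trans (D_card_le f); rewrite lt0n cards_eq0.
rewrite sumrN -mulr_sumr -natr_sum -/(q f) natrD.
have -> : - (kappa * (1 + r) * (q f)%:R) / t%:R = - (eta ^+ 2 / 16 * (1 + r)) * ((q f)%:R / 2).
  by rewrite /kappa; field; exact: lt0r_neq0.
set d : R := #|D f|%:R; set Q : R := (q f)%:R.
have -> : - (theta * (eta * W * (Q + d))) + 2 * (theta ^+ 2 * (4 * W ^+ 2 * d)) =
    - (eta ^+ 2 / 16 * (1 + r)) * (Q + d / 2 - r * d / 2).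
  by rewrite /theta; field; exact: lt0r_neq0.
rewrite !mulNr lerN2 ler_wpM2l //.
  by rewrite mulr_ge0 ?divr_ge0 ?sqr_ge0 // addr_ge0 // divr_ge0.
have rd : r * d <= Q.
  rewrite /r mulrAC ler_pdivrMr //; apply: ler_pM => //.
    by rewrite ler_nat t_le_q.
  by rewrite ler_nat D_card_le.
have : 0 <= d by []. lra.
Qed.

(** By [code_inj] the codes of different sets are different, and they are nonempty: the sum runs
    over some nonempty subsets, and subtracting 1 removes the empty one. *)
Lemma sum_codes_le F : F \in Fs ->
  \sum_(S in [set D f | f in [pred f | D f != set0]])
    y ^+ #|code F (rep S)| <= (1 + y) ^+ (n ^ 4) - 1.
Proof.
move=> FFs.
have y0 : 0 <= y by exact: expR_ge0.
have -> : (n ^ 4 = #|{: 'I_n * 'I_n * 'I_n * 'I_n}|)%N.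
  by rewrite !card_prod card_ord; lia.
rewrite -sum_pow_card [X in _ <= X - _](bigD1 set0) //= cards0 expr0 addrAC subrr add0r.
rewrite -(@big_imset _ _ _ _ _ (fun S => code F (rep S)) _ (fun A => y ^+ #|A|)) /=; last first.
  move=> S1 S2 /imsetP[f1 _ ->] /imsetP[f2 _ ->] /(code_inj FFs).
  by rewrite !(proj1 (repP _)).
rewrite [leRHS](bigID (mem [set code F (rep S) | S in [set D f | f in [pred f | D f != set0]]])) /=.
rewrite [X in _ <= X + _](_ : _ = \sum_(A in [set code F (rep S) | S in [set D f | f in [pred f | D f != set0]]]) y ^+ #|A|).
  by rewrite lerDl sumr_ge0 // => A _; rewrite exprn_ge0.
apply: eq_bigl => A; apply: andb_idl => /imsetP[S /imsetP[f fD ->] ->].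
by rewrite -cards_eq0 -lt0n code_gt0 // (proj1 (repP _)).
Qed.

(** The factor [expR (- kappa * r)] is at most [1 / r], by [1 + x <= expR x] and [kappa >= 1]. *)
Lemma y_le : (0 < mC)%N -> y <= expR (- kappa) * (mC%:R / t%:R).
Proof.
move=> m0; have tp : 0 < t%:R :> R by rewrite ltr0n.
have mp : 0 < mC%:R :> R by rewrite ltr0n.
rewrite /y mulrDr mulr1 opprD expRD ler_wpM2l ?expR_ge0 //.
rewrite expRN -[_ / t%:R]invf_div lef_pV2 ?posrE ?expR_gt0 ?divr_gt0 //.
apply: (@le_trans _ _ (kappa * r)).
  by rewrite -{1}[_ / _]mul1r ler_wpM2r // divr_ge0.
by apply: le_trans (expR_ge1Dx _); rewrite lerDr.
Qed.

Lemma mean_class_deviates_le :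
  mean M (fun u => [exists f, class_deviates u f]%:R)
    <= 4 * (n ^ 4)%:R * expR (- kappa) * (mC%:R / t%:R) :> R.
Proof.
have tp : 0 < t%:R :> R by rewrite ltr0n.
have devD u f : class_deviates u f -> D f != set0.
  apply: contraTneq => D0; rewrite /class_deviates X_D0 // normr0 -leNgt.
  by rewrite !mulr_ge0 // ltW.
case: (posnP mC) => [mC0|mC0].
  rewrite mC0 mul0r mulr0 -[leRHS](mean_const M); apply: le_mean => u _.
  case: existsP => // -[f /devD]; rewrite -cards_eq0 -leqn0.
  by rewrite (leq_trans (D_card_le f)) ?mC0.
have mp : 0 < mC%:R :> R by rewrite ltr0n.
have r0 : 0 <= r by rewrite /r divr_ge0.
have th0 : 0 < theta by rewrite /theta !(divr_gt0, mulr_gt0) //; lra.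
pose DD := [set D f | f in [pred f | D f != set0]].
pose lam S : R := eta * W * (q (rep S) + #|D (rep S)|)%:R.
pose term (c : R) (S : {set 'I_M}) u := expR (- (theta * lam S)) *
  expR (\sum_(p <- ps) sign_at R u (M.-1 - p.2) * (c * (v (rep S) p.1 - v (rep S) p.2))).
(* Exponential Markov inequality: when [f] deviates, one of the two terms at [D f] has a nonnegative
   exponent, depending on the sign of [X u f]. *)
apply: (@le_trans _ _ (mean M (fun u => \sum_(S in DD) (term theta S u + term (- theta) S u)))).
  apply: le_mean => u _.
  have t0 S c : 0 <= term c S u by rewrite mulr_ge0 ?expR_ge0.
  case: existsP => [[f dev]|_]; last by rewrite sumr_ge0 // => S _; rewrite addr_ge0.
  have [Drep qrep] := repP f.
  rewrite (bigD1 (D f)) /=; last by rewrite imset_f // inE (devD _ _ dev).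
  apply: (@le_trans _ _ (term theta (D f) u + term (- theta) (D f) u)); last first.
    by rewrite lerDl sumr_ge0 // => S _; rewrite addr_ge0.
  have termE c : term c (D f) u = expR (c * X u f - theta * lam (D f)).
    rewrite /term addrC expRD (X_eq u (esym Drep)) /X mulr_sumr.
    by under eq_bigr => p _ do rewrite mulrCA.
  have lamX : theta * lam (D f) <= theta * `|X u f|.
    rewrite ler_pM2l //; apply: le_trans (ltW dev).
    by rewrite /lam Drep ler_pM2l ?mulr_gt0 // ler_nat leq_add2r.
  rewrite !termE; case: (ler0P (X u f)) lamX => X0 lamX.
    apply: (@le_trans _ _ (expR (- theta * X u f - theta * lam (D f)))).
      by apply: le_trans (expR_ge1Dx _); lra.
    by rewrite lerDr expR_ge0.
  apply: (@le_trans _ _ (expR (theta * X u f - theta * lam (D f)))).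
    by apply: le_trans (expR_ge1Dx _); lra.
  by rewrite lerDl expR_ge0.
rewrite mean_sum.
(* Jensen replaces the exponential of the average code size by an average of exponentials, so that
   the sets can be counted for each forest separately. *)
apply: (@le_trans _ _ (\sum_(S in DD) 2 * ((\sum_(F <- Fs) y ^+ #|code F (rep S)|) / t%:R))).
  apply: ler_sum => S /imsetP[f]; rewrite inE => Df SE.
  have [Drep _] := repP f; rewrite -SE in Drep.
  have term_le c : c ^+ 2 = theta ^+ 2 -> mean M (term c S) <=
      (\sum_(F <- Fs) y ^+ #|code F (rep S)|) / t%:R.
    move=> c2; rewrite /term meanZ.
    have [u1 u2] := good_pairs_coins pairsP.
    apply: (@le_trans _ _ (expR (- (theta * lam S)) * expR (2 * (theta ^+ 2 * (4 * W ^+ 2 * #|D (rep S)|%:R))))).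
      rewrite ler_wpM2l ?expR_ge0 //; apply: le_trans (mean_expR_seq _ u1 u2) _.
      rewrite ler_expR ler_pM2l // -c2.
      under eq_bigr => p _ do rewrite exprMn.
      by rewrite -mulr_sumr ler_wpM2l ?sqr_ge0 // sum_sqr_v_le.
    rewrite -expRD; have Dr0 : D (rep S) != set0 by rewrite Drep SE.
    apply: (@le_trans _ _ (expR ((\sum_(F <- Fs) - (kappa * (1 + r) * #|code F (rep S)|%:R)) / t%:R))).
      by rewrite ler_expR; exact: class_exponent_le.
    apply: le_trans (expR_avg_le _ t_gt0) _.
    rewrite ler_pM2r ?invr_gt0 //; apply: ler_sum => F _.
    by rewrite -mulNr expRM_natr.
  by rewrite meanD mulr2n mulrDl mul1r lerD // term_le // sqrrN.
rewrite -mulr_sumr -mulr_suml exchange_big /=.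
have yb : (1 + y) ^+ (n ^ 4) - 1 <= 2 * ((n ^ 4)%:R * y).
  apply: exp1D_le; first exact: expR_ge0.
  apply: le_trans kappa_big; rewrite ler_wpM2l // ler_expR lerN2.
  by rewrite -[leLHS]mulr1 ler_wpM2l ?lerDl // (le_trans _ kappa_ge1).
have sb : \sum_(F <- Fs) \sum_(S in DD) y ^+ #|code F (rep S)| <= t%:R * (2 * ((n ^ 4)%:R * y)).
  rewrite /t -sum1_size natr_sum mulr_suml big_seq [leRHS]big_seq.
  by apply: ler_sum => F FFs; rewrite mul1r; apply: le_trans yb; exact: sum_codes_le.
apply: (@le_trans _ _ (2 * (2 * ((n ^ 4)%:R * y)))).
  by rewrite ler_pM2l // ler_pdivrMr // mulrC.
have := ler_wpM2l (ler0n R (n ^ 4)) (y_le mC0).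
lra.
Qed.

End WeightClass.

(** * Dyadic classes and the total deviation *)

Lemma positive_weights_ge wt :
  exists2 b : R, 0 < b & forall e, (e < M)%N -> 0 < wt e -> b <= wt e.
Proof.
elim: M => [|k [b b0 bP]]; first by exists 1.
case: (ltrP 0 (wt k)) => wk; last first.
  exists b => // e; rewrite ltnS leq_eqVlt => /orP[/eqP ->|/bP //].
  by rewrite ltNge wk.
exists (Num.min b (wt k)) => [|e]; first by rewrite lt_min b0.
rewrite ltnS leq_eqVlt => /orP[/eqP ->|ek we]; first by rewrite ge_min lexx orbT.
by rewrite ge_min bP.
Qed.

(** The number of classes depends on the ratio of the weights, not on [n]; no later bound may
    therefore contain it as a factor. *)
Lemma dyadic_classes wt :
  exists (b : R) (cls : nat -> nat), 0 < b /\
    forall e, (e < M)%N -> 0 < wt e ->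
      b * 2 ^+ cls e <= wt e <= b * 2 ^+ (cls e).+1.
Proof.
have [b b0 bP] := positive_weights_ge wt.
exists b, (fun e => trunc_log 2 (Num.truncn (wt e / b))); split=> // e eM we.
have x1 : 1 <= wt e / b by rewrite ler_pdivlMr // mul1r bP.
have /andP[xl xu] := Num.Theory.truncn_itv (le_trans ler01 x1).
set k := Num.truncn _ in xl xu *.
have k0 : (0 < k)%N by rewrite -(ltr_nat R) -(ltrD2r 1) -natr1 in xu *; lra.
have /andP[kl ku] := trunc_log_bounds (isT : (1 < 2)%N) k0.
apply/andP; split; rewrite mulrC.
  rewrite -ler_pdivlMr //; apply: le_trans xl.
  by rewrite -natrX ler_nat.
rewrite -ler_pdivrMr //; apply: le_trans (ltW xu) _.
by rewrite -natrX ler_nat.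
Qed.

(** A crossing hedge is charged by every class whose lower end [W] is at most its weight. This
    geometric sum is the source of the factor 2 in [2 * eta]. *)
Lemma dyadic_sum_le (b x : R) J : 0 < b -> 0 <= x ->
  \sum_(j < J | b * 2 ^+ j <= x) b * 2 ^+ j <= 2 * x.
Proof.
move=> b0 x0; have full k : \sum_(j < k) b * 2 ^+ j = b * 2 ^+ k - b.
  elim: k => [|k IH]; first by rewrite big_ord0 expr0 mulr1 subrr.
  by rewrite big_ord_recr /= IH exprS; ring.
elim: J => [|J IH]; first by rewrite big_ord0 mulr_ge0.
rewrite big_mkcond big_ord_recr /= -big_mkcond /=.
case: ifP => [bJ|_]; last by rewrite addr0.
apply: (@le_trans _ _ (\sum_(j < J) b * 2 ^+ j + b * 2 ^+ J)).
  rewrite lerD2r [leRHS](bigID (fun j : 'I_J => b * 2 ^+ j <= x)) /= lerDl.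
  by rewrite sumr_ge0 // => j _; rewrite mulr_ge0 ?exprn_ge0 // ltW.
by rewrite full; lra.
Qed.

Section Resampling.
Variables (L : seq link) (wt : nat -> R) (Fs : seq (seq link)).
Variables (ps : seq (nat * nat)) (eta : R).
Hypothesis L_ltM : forall l, l \in L -> (l.1.1 < M)%N.
Hypothesis packing : forest_packing L wt Fs.
Hypothesis pairsP : good_pairs wt Fs ps.
Hypothesis wt_ge0 : forall e, (e < M)%N -> 0 <= wt e.
Hypothesis eta0 : 0 < eta.

Lemma capacity_resampled u f :
  link_capacity L (resampled wt ps u) f - link_capacity L wt f =
  \sum_(p <- ps) sign_at R u (M.-1 - p.2) *
    ((if crossing L f p.1 then wt p.1 else 0) -
     (if crossing L f p.2 then wt p.2 else 0)).
Proof.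
pose x (e : nat) := if crossing L f e then wt e else 0.
have pick_x k : (k < M)%N -> x k = \sum_(e < M) x e * (k == e)%:R.
  move=> kM; rewrite (bigD1 (Ordinal kM)) //= eqxx mulr1 big1 ?addr0 // => e.
  by rewrite -val_eqE /= eq_sym => /negbTE ->; rewrite mulr0.
transitivity (\sum_(p <- ps) \sum_(e < M)
    sign_at R u (M.-1 - p.2) * (x e * ((p.1 == e)%:R - (p.2 == e)%:R))).
  rewrite exchange_big /= /link_capacity -sumrB big_mkcond /=.
  apply: eq_bigr => e _; rewrite /x /resampled.
  case: ifP => _; last by rewrite big1 // => p _; rewrite mul0r mulr0.
  rewrite mulrDr mulr1 addrAC subrr add0r mulr_sumr.
  by apply: eq_bigr => p _; rewrite mulrCA.
rewrite !big_seq; apply: eq_bigr => p pps.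
have [[p1 _] [p2 _]] := good_pairs_mem pairsP pps.
rewrite -mulr_sumr -/(x p.1) -/(x p.2) (pick_x _ p1) (pick_x _ p2) -sumrB.
by congr (_ * _); apply: eq_bigr => e _; rewrite mulrBr.
Qed.

Let t := size Fs.
Let kappa : R := eta ^+ 2 * t%:R / 32.
Hypothesis t_gt0 : (0 < t)%N.
Hypothesis kappa_ge1 : 1 <= kappa.
Hypothesis kappa_big : (n ^ 4)%:R * expR (- kappa) <= 1 / 2 :> R.

(** If no class deviates, [q_card_le] bounds the error by [eta] times the sum over [j] of [W j]
    times the number of crossing hedges of weight at least [W j]; exchanging sums leaves a geometric
    sum per crossing hedge. The class sizes in the failure probabilities add up to at most the
    number of positive weights. *)
Lemma mean_resampled_le :
  mean M (fun u => (~~ [forall f,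
      `|link_capacity L (resampled wt ps u) f - link_capacity L wt f|
        <= 2 * eta * link_capacity L wt f])%:R)
    <= 4 * (n ^ 4)%:R * expR (- kappa) *
       ((\sum_(e < M) (0 < wt e)%R)%N%:R / t%:R) :> R.
Proof.
have tp : 0 < t%:R :> R by rewrite ltr0n.
have [b [cls [b0 clsP]]] := dyadic_classes wt.
pose J := (\max_(e < M) cls e).+1.
have clsJ (e : 'I_M) : (cls e < J)%N by rewrite ltnS leq_bigmax.
pose W j : R := b * 2 ^+ j.
have W0 j : 0 < W j by rewrite mulr_gt0 ?exprn_gt0.
pose C j e := [&& (e < M)%N, eligible wt Fs e & cls e == j].
have Cel j e : C j e -> eligible wt Fs e by case/and3P.
have Cge j e : C j e -> W j <= wt e.
  by case/and3P=> eM /andP[we _] /eqP <-; case/andP: (clsP e eM we).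
have Cle j e : C j e -> wt e <= 2 * W j.
  case/and3P=> eM /andP[we _] /eqP <-; case/andP: (clsP e eM we) => _.
  by rewrite /W exprS mulrCA.
pose dev j u f := class_deviates L wt Fs ps (W j) eta (C j) u f.
apply: (@le_trans _ _ (\sum_(j < J) mean M (fun u => [exists f, dev j u f]%:R))).
  rewrite -mean_sum; apply: le_mean => u _.
  have t0 j : 0 <= ([exists f, dev j u f])%:R :> R by [].
  case: (boolP [exists j : 'I_J, [exists f, dev j u f]]) => [/existsP[j dj]|nodev].
    apply: (@le_trans _ _ 1); first by case: (~~ _).
    by rewrite (bigD1 j) //= dj lerDl sumr_ge0.
  apply: (@le_trans _ _ 0); last by rewrite sumr_ge0.
  case: forallP => // notall; case: notall => f.
  rewrite capacity_resampled.
  set D := fun j => [set e : 'I_M | C j e && crossing L f e].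
  pose v j (e : nat) : R := if C j e && crossing L f e then wt e else 0.
  have vE e : (e < M)%N -> eligible wt Fs e ->
      (if crossing L f e then wt e else 0) = \sum_(j < J) v j e.
    move=> eM el; rewrite (bigD1 (Ordinal (clsJ (Ordinal eM)))) //= /v /C eM el eqxx /=.
    rewrite big1 ?addr0 // => j; rewrite -val_eqE /= eq_sym => /negbTE ->.
    by [].
  have -> : \sum_(p <- ps) sign_at R u (M.-1 - p.2) *
      ((if crossing L f p.1 then wt p.1 else 0) -
       (if crossing L f p.2 then wt p.2 else 0)) =
      \sum_(j < J) \sum_(p <- ps) sign_at R u (M.-1 - p.2) * (v j p.1 - v j p.2).
    rewrite exchange_big big_seq [RHS]big_seq; apply: eq_bigr => p pps.
    have [[p1 e1] [p2 e2]] := good_pairs_mem pairsP pps.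
    by rewrite -mulr_sumr sumrB !vE.
  apply: le_trans (ler_norm_sum _ _ _) _.
  apply: (@le_trans _ _ (\sum_(j < J) eta * (W j * (\sum_(e < M) (crossing L f e && (W j <= wt e)%R))%N%:R))).
    apply: ler_sum => j _; rewrite leNgt; apply/negP => big.
    case/existsP: nodev; exists j; apply/existsP; exists f.
    rewrite /dev /class_deviates; apply: le_lt_trans big.
    rewrite -mulrA ler_wpM2l ?(ltW eta0) // ler_wpM2l ?(ltW (W0 j)) // ler_nat.
    apply: leq_trans (q_card_le L_ltM packing (Cel j) (Cge j) f) _.
    by rewrite -sum1dep_card big_mkcond.
  rewrite -mulr_sumr -mulrA mulrCA ler_pM2l //.
  apply: (@le_trans _ _ (\sum_(e < M | crossing L f e) \sum_(j < J | W j <= wt e) W j)).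
    under eq_bigr => j _ do rewrite natr_sum mulr_sumr.
    rewrite exchange_big [leRHS]big_mkcond /=; apply: ler_sum => e _.
    case: ifP => _; last by rewrite big1 // => j _; rewrite mulr0.
    rewrite [leRHS]big_mkcond; apply: ler_sum => j _ /=.
    by case: ifP => _; rewrite ?mulr1 ?mulr0.
  rewrite /link_capacity mulr_sumr; apply: ler_sum => e _.
  by apply: dyadic_sum_le => //; exact: wt_ge0.
apply: (@le_trans _ _ (\sum_(j < J) 4 * (n ^ 4)%:R * expR (- kappa) * ((\sum_(e < M) C j e)%N%:R / t%:R))).
  apply: ler_sum => j _.
  exact: (mean_class_deviates_le packing pairsP (W0 j) eta0 (Cel j) (Cge j) (Cle j)).
rewrite -mulr_sumr ler_wpM2l ?mulr_ge0 ?expR_ge0 // -mulr_suml ler_pM2r ?invr_gt0 //.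
rewrite -natr_sum ler_nat exchange_big /=; apply: leq_sum => e _.
case: (boolP (eligible wt Fs e)) => [el|nel]; last first.
  by rewrite big1 // => j _; rewrite /C (negbTE nel) andbF.
case/andP: (el) => -> _; rewrite (bigD1 (Ordinal (clsJ e))) //= big1 ?addn0.
  by rewrite leq_b1.
by move=> j; rewrite -val_eqE /= eq_sym /C => /negbTE ->; rewrite !andbF.
Qed.

End Resampling.
End Links.

(** * Structured programs *)

(* [PFor a e p] runs [p] with cell 0 of the natural array [a] equal to
   [N-1, ..., 0], where [N] is the value of [e] on entry. *)
Inductive prog :=
  | PSkip
  | PN of nat & nexp & nexp
  | PR of nat & nexp & rexp
  | PFlip of nat & nexp
  | PSeq of prog & prog
  | PIf of bexp & prog & prog
  | PFor of nat & nexp & prog.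

Fixpoint compile (p : prog) : cmd :=
  match p with
  | PSkip => Skip
  | PN a i e => NSet a i e
  | PR a i e => RSet a i e
  | PFlip a i => Flip a i
  | PSeq p q => Seq (compile p) (compile q)
  | PIf b p q => If b (compile p) (compile q)
  | PFor a e p =>
      Seq (NSet a (NConst 0) e)
        (While (NLe (NConst 1) (NGet a (NConst 0)))
           (Seq (NSet a (NConst 0) (NSub (NGet a (NConst 0)) (NConst 1)))
              (compile p)))
  end.

Fixpoint writesN (p : prog) (a : nat) : bool :=
  match p with
  | PN b _ _ | PFlip b _ => b == a
  | PSeq p q | PIf _ p q => writesN p a || writesN q a
  | PFor b _ p => (b == a) || writesN p a
  | _ => false
  end.

Fixpoint writesR (p : prog) (a : nat) : bool :=
  match p with
  | PR b _ _ => b == a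
  | PSeq p q | PIf _ p q => writesR p a || writesR q a
  | PFor _ _ p => writesR p a
  | _ => false
  end.

Fixpoint flips (p : prog) : bool :=
  match p with
  | PFlip _ _ => true
  | PSeq p q | PIf _ p q => flips p || flips q
  | PFor _ _ p => flips p
  | _ => false
  end.

(** Loop bounds of this form are at most a fixed polynomial in the largest cell of array 0, which
    the programs never write; the running time can then be read off the syntax. *)
Fixpoint input_bound (e : nexp) : bool :=
  match e with
  | NConst _ => true
  | NGet a _ => a == 0%N
  | NAdd e1 e2 => input_bound e1 && input_bound e2
  | NSub _ _ => false
  end.

Fixpoint well_formed (p : prog) : bool :=
  match p with
  | PSeq p q | PIf _ p q => well_formed p && well_formed q
  | PFor a e p => [&& ~~ writesN p a, input_bound e & well_formed p]
  | _ => true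
  end.

Fixpoint bound_poly (e : nexp) : {poly nat} :=
  match e with
  | NConst k => k%:P
  | NGet _ _ => 'X
  | NAdd e1 e2 => bound_poly e1 + bound_poly e2
  | NSub e1 _ => bound_poly e1
  end.

(** A loop costs 3 steps once (sequencing, initialization, final test) and 3 per iteration (test,
    sequencing, decrement) besides its body. *)
Fixpoint cost_poly (p : prog) : {poly nat} :=
  match p with
  | PSeq p q | PIf _ p q => 1%:P + cost_poly p + cost_poly q
  | PFor _ e p => 3%:P + bound_poly e * (3%:P + cost_poly p)
  | _ => 1%:P
  end.

Lemma hornerD_nat (p q : {poly nat}) x : (p + q).[x] = (p.[x] + q.[x])%N.
Proof. exact: hornerD. Qed.

Lemma hornerM_nat (p q : {poly nat}) x : (p * q).[x] = (p.[x] * q.[x])%N.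
Proof. exact: hornerM. Qed.

Section Semantics.
Variable R : realType.
Implicit Types s : state R.

Definition set_nat a i x s : state R :=
  State (update (nmem s) a i x) (rmem s) (coins s).

Definition set_coins c s : state R := State (nmem s) (rmem s) c.

Fixpoint loop (a : nat) (F : state R -> state R) (k : nat) s : state R :=
  if k is k'.+1 then loop a F k' (F (set_nat a 0 k' s)) else s.

Fixpoint sem (p : prog) s : state R :=
  match p with
  | PSkip => s
  | PN a i e => set_nat a (neval s i) (neval s e) s
  | PR a i e =>
      State (nmem s) (update (rmem s) a (neval s i) (reval s e)) (coins s)
  | PFlip a i =>
      State (update (nmem s) a (neval s i) (head false (coins s)))
            (rmem s) (behead (coins s))
  | PSeq p q => sem q (sem p s)
  | PIf b p q => if beval s b then sem p s else sem q s
  | PFor a e p => loop a (sem p) (neval s e) (set_nat a 0 (neval s e) s)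
  end.

Lemma sem_nmem p a i s : ~~ writesN p a -> nmem (sem p s) a i = nmem s a i.
Proof.
elim: p s => //= [b j e|b j|p IHp q IHq|b p IHp q IHq|b e p IHp] s.
- by rewrite /update eq_sym => /negbTE ->.
- by rewrite /update eq_sym => /negbTE ->.
- by rewrite negb_or => /andP[/IHp Hp /IHq Hq]; rewrite Hq Hp.
- by rewrite negb_or => /andP[/IHp Hp /IHq Hq]; case: ifP.
rewrite negb_or => /andP[ba /IHp {}IHp].
have upd k s' : nmem (set_nat b 0 k s') a i = nmem s' a i.
  by rewrite /= /update eq_sym (negbTE ba).
rewrite -[RHS](upd (neval s e)); move: (set_nat b 0 (neval s e) s).
elim: (neval s e) => //= k IH s'.
by rewrite IH IHp upd.
Qed.

Lemma sem_rmem p a i s : ~~ writesR p a -> rmem (sem p s) a i = rmem s a i.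
Proof.
elim: p s => //= [b j e|p IHp q IHq|b p IHp q IHq|b e p IHp] s.
- by rewrite /update eq_sym => /negbTE ->.
- by rewrite negb_or => /andP[/IHp Hp /IHq Hq]; rewrite Hq Hp.
- by rewrite negb_or => /andP[/IHp Hp /IHq Hq]; case: ifP.
move=> /IHp {}IHp; rewrite -[RHS]/(rmem (set_nat b 0 (neval s e) s) a i).
move: (set_nat b 0 (neval s e) s).
by elim: (neval s e) => //= k IH s'; rewrite IH IHp.
Qed.

Lemma neval_set_coins c s e : neval (set_coins c s) e = neval s e.
Proof. by elim: e => //= [a e ->|e1 -> e2 ->|e1 -> e2 ->]. Qed.

Lemma reval_set_coins c s e : reval (set_coins c s) e = reval s e.
Proof.
by elim: e => //= [a e|e1 -> e2 ->|e1 -> e2 ->|e1 -> e2 ->|e1 -> e2 ->];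
  rewrite ?neval_set_coins.
Qed.

Lemma beval_set_coins c s e : beval (set_coins c s) e = beval s e.
Proof.
by elim: e => //= [e1 e2|e1 e2|e ->|e1 -> e2 ->];
  rewrite ?neval_set_coins ?reval_set_coins.
Qed.

(** This lets the states reached before sampling be computed once, independently of the tape. *)
Lemma sem_set_coins p c s : ~~ flips p ->
  sem p (set_coins c s) = set_coins c (sem p s).
Proof.
elim: p s => //= [a i e|a i e|p IHp q IHq|b p IHp q IHq|a e p IHp] s.
- by rewrite !neval_set_coins.
- by rewrite !neval_set_coins reval_set_coins.
- by rewrite negb_or => /andP[/IHp Hp /IHq Hq]; rewrite Hp Hq.
- rewrite negb_or beval_set_coins => /andP[/IHp Hp /IHq Hq].
  by case: ifP.
move=> /IHp {}IHp; rewrite neval_set_coins.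
rewrite -[set_nat a 0 _ (set_coins c s)]/(set_coins c (set_nat a 0 (neval s e) s)).
move: (set_nat a 0 (neval s e) s); elim: (neval s e) => //= k IH s'.
by rewrite -[set_nat a 0 _ (set_coins c s')]/(set_coins c (set_nat a 0 k s')) IHp IH.
Qed.

Lemma sem_coins p s : ~~ flips p -> coins (sem p s) = coins s.
Proof.
move=> pf; have -> : s = set_coins (coins s) s by case: s.
by rewrite sem_set_coins.
Qed.

(** A frame condition between arbitrary states, not only for [sem p s]: the intermediate states of a
    loop satisfy it as well. *)
Definition agree p s s' : Prop :=
  [/\ forall a i, ~~ writesN p a -> nmem s' a i = nmem s a i,
      forall a i, ~~ writesR p a -> rmem s' a i = rmem s a i
    & ~~ flips p -> coins s' = coins s].

Lemma agree_sem p s : agree p s (sem p s).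
Proof.
by split=> *; [rewrite sem_nmem|rewrite sem_rmem|rewrite sem_coins].
Qed.

(** Loop rule with an invariant indexed by the remaining iterations. The [agree] hypothesis spares
    each invariant the list of arrays that the body leaves alone. *)
Lemma sem_for (I : nat -> state R -> Prop) a e p s :
  I (neval s e) (set_nat a 0 (neval s e) s) ->
  (forall k s', (k < neval s e)%N -> agree (PFor a e p) s s' ->
     nmem s' a 0 = k.+1 -> I k.+1 s' -> I k (sem p (set_nat a 0 k s'))) ->
  ~~ writesN p a ->
  I 0%N (sem (PFor a e p) s).
Proof.
move=> I0 IS wp /=.
have : agree (PFor a e p) s (set_nat a 0 (neval s e) s).
  by split=> //= b i; rewrite negb_or /update eq_sym => /andP[/negbTE ->].
move: I0; have : nmem (set_nat a 0 (neval s e) s) a 0 = neval s e.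
  by rewrite /= /update !eqxx.
move: (leqnn (neval s e)) (set_nat a 0 (neval s e) s).
elim: {-2}(neval s e) => //= k IH ks s' s'a Is' As'.
apply: IH; first exact: ltnW.
- by rewrite sem_nmem //= /update !eqxx.
- exact: IS.
case: As' => A1 A2 A3; split=> [b i wb|b i wb|fp].
- rewrite sem_nmem; last by move: wb => /=; rewrite negb_or => /andP[].
  by rewrite -A1 //= /update eq_sym; move: wb; rewrite /= negb_or => /andP[/negbTE ->].
- by rewrite sem_rmem //= A2.
- by rewrite sem_coins //= A3.
Qed.

Lemma neval_le_bound e N s :
  input_bound e -> (forall i, nmem s 0 i <= N)%N -> (neval s e <= (bound_poly e).[N])%N.
Proof.
move=> + sN; elim: e => //= [k _|a i _ /eqP ->|e1 IH1 e2 IH2 /andP[/IH1 h1 /IH2 h2]].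
- by rewrite hornerC.
- by rewrite hornerX.
by rewrite hornerD; exact: leq_add.
Qed.

Lemma compile_correct p N s : well_formed p -> ~~ writesN p 0 ->
  (forall i, nmem s 0 i <= N)%N ->
  exists2 k, (k <= (cost_poly p).[N])%N &
    forall rest, iter k (@step R) (compile p :: rest, s) = (rest, sem p s).
Proof.
elim: p s => //= [||||p IHp q IHq|b p IHp q IHq|a e p IHp] s;
  try by (move=> *; exists 1%N => //; rewrite hornerC).
- move=> /andP[wp wq]; rewrite negb_or => /andP[np nq] sN.
  have [k kc kp] := IHp s wp np sN.
  have [|l lc lp] := IHq (sem p s) wq nq; first by move=> i; rewrite sem_nmem.
  exists (l + k + 1)%N => [|rest].
    by rewrite !hornerD_nat hornerC; lia.
  by rewrite addn1 iterSr iterD /= kp lp.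
- move=> /andP[wp wq]; rewrite negb_or => /andP[np nq] sN.
  have [k kc kp] := IHp s wp np sN; have [l lc lp] := IHq s wq nq sN.
  exists (if beval s b then k.+1 else l.+1) => [|rest].
    by rewrite !hornerD_nat hornerC; case: ifP => _; lia.
  by case: ifP => bs; rewrite iterSr /= bs.
move=> /and3P[wa be wp]; rewrite negb_or => /andP[a0 np] sN.
pose c := (cost_poly p).[N].
set w := While _ _.
have loopP k s' : nmem s' a 0 = k -> (forall i, nmem s' 0 i <= N)%N ->
    exists2 l, (l <= 1 + k * (3 + c))%N &
    forall rest, iter l (@step R) (w :: rest, s') = (rest, loop a (sem p) k s').
  elim: k s' => [|k IH] s' s'a s'N.
    by exists 1%N => // rest; rewrite /= s'a.
  have s0N i : (nmem (set_nat a 0 k s') 0 i <= N)%N.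
    by rewrite /= /update eq_sym (negbTE a0) /= ?sN ?s'N.
  have [l lc lp] := IHp (set_nat a 0 k s') wp np s0N.
  have [||m mc mp] := IH (sem p (set_nat a 0 k s')).
  - by rewrite sem_nmem //= /update !eqxx.
  - by move=> i; rewrite sem_nmem.
  exists (m + l + 3)%N => [|rest]; first by rewrite mulSn -/c in lc *; lia.
  have step3 : iter 3 (@step R) (w :: rest, s') =
      (compile p :: w :: rest, set_nat a 0 k s').
    by rewrite /w /= s'a /= s'a subn1.
  by rewrite iterD step3 iterD lp mp.
have [||l lc lp] := loopP (neval s e) (set_nat a 0 (neval s e) s).
- by rewrite /= /update !eqxx.
- by move=> i; rewrite /= /update eq_sym (negbTE a0) /= ?sN ?s'N.
exists (l + 2)%N => [|rest]; last by rewrite iterD /= lp.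
rewrite hornerD_nat hornerM_nat hornerD_nat !hornerC -/c.
have be' := neval_le_bound be sN.
have : (neval s e * (3 + c) <= (bound_poly e).[N] * (3 + c))%N by rewrite leq_mul2r be' orbT.
by lia.
Qed.

Lemma sem_seq p q s : sem (PSeq p q) s = sem q (sem p s).
Proof. by []. Qed.

Lemma sem_if b p q s :
  sem (PIf b p q) s = if beval s b then sem p s else sem q s.
Proof. by []. Qed.

Lemma sem_setN a i e s : sem (PN a i e) s = set_nat a (neval s i) (neval s e) s.
Proof. by []. Qed.

Lemma sem_setR a i e s : sem (PR a i e) s =
  State (nmem s) (update (rmem s) a (neval s i) (reval s e)) (coins s).
Proof. by []. Qed.

Lemma sem_flip a i s : sem (PFlip a i) s =
  State (update (nmem s) a (neval s i) (head false (coins s)))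
        (rmem s) (behead (coins s)).
Proof. by []. Qed.

Lemma sem_skip s : sem PSkip s = s.
Proof. by []. Qed.

Lemma sem_forE a e p s : sem (PFor a e p) s =
  loop a (sem p) (neval s e) (set_nat a 0 (neval s e) s).
Proof. by []. Qed.

Definition semE := (sem_seq, sem_if, sem_setN, sem_setR, sem_flip, sem_skip).

End Semantics.

Arguments sem {R} p s : simpl never.

(** * Greedy forests *)

(* Names of the natural arrays; array 0 is the input and the arrays from 20 on
   are loop counters. *)
Local Notation var a := (NGet a (NConst 0)).
Local Notation var_n := (NGet 0 (NConst 0)).
Local Notation var_M := (NGet 0 (NConst 1)).
Local Notation lk_hedge := 1%N.
Local Notation lk_src := 2%N.
Local Notation lk_dst := 3%N.
Local Notation in_pos := 4%N.
Local Notation lk_end := 5%N.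
Local Notation cur_hedge := 6%N.
Local Notation cur_src := 7%N.
Local Notation two_pow := 8%N.
Local Notation num_pos := 9%N.
Local Notation num_trees := 10%N.
Local Notation acc := 11%N.
Local Notation mark := 12%N.
Local Notation label := 13%N.
Local Notation best := 14%N.
Local Notation lk_pos := 15%N.
Local Notation src_label := 16%N.
Local Notation dst_label := 17%N.
Local Notation coin := 18%N.
Local Notation pending := 19%N.

(* Names of the real arrays. *)
Local Notation wt_in := 0%N.
Local Notation eps_in := 1%N.
Local Notation weight := 2%N.
Local Notation real_n := 3%N.
Local Notation real_log := 4%N.
Local Notation threshold := 5%N.
Local Notation real_pos := 6%N.

Local Notation "a ::= e" := (PN a (NConst 0) e) (at level 60).
Local Notation "p ;; q" := (PSeq p q) (at level 65, right associativity).
Local Notation NEq e1 e2 := (BAnd (NLe e1 e2) (NLe e2 e1)).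
Local Notation NSucc e := (NAdd e (NConst 1)).
Local Notation NPred e := (NSub e (NConst 1)).
Local Notation RPos e := (BNot (RLe e (RConst 0))).

(* Marks: 0 is unvisited, 1 is visited for the current forest, 2 is used by some
   forest. *)
Definition relabel : prog :=
  PFor 25 var_n (PIf (NEq (NGet label (var 25)) (var dst_label))
                     (PN label (var 25) (var src_label)) PSkip).

(** Both labels are saved first because [relabel] overwrites the cells they come from. *)
Definition join_link : prog :=
  (PN mark (NPred (var best)) (NConst 2) ;;
   src_label ::= NGet label (NGet lk_src (var lk_pos)) ;;
   dst_label ::= NGet label (NGet lk_dst (var lk_pos))) ;;
  relabel.

Definition scan_link : prog :=
  PIf (BAnd (NEq (NGet lk_hedge (var lk_pos)) (NPred (var best)))
      (BAnd (NEq (NGet mark (NPred (var best))) (NConst 1))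
            (BNot (NEq (NGet label (NGet lk_src (var lk_pos)))
                       (NGet label (NGet lk_dst (var lk_pos)))))))
    join_link PSkip ;;
  lk_pos ::= NSucc (var lk_pos).

(** Naturals cannot be multiplied, so [M n] positions are visited by nested loops; this covers the
    links by [size_links]. Cells past the last link hold zeros, whose ends coincide and are never
    joined. *)
Definition scan : prog :=
  lk_pos ::= NConst 0 ;; PFor 23 var_M (PFor 24 var_n scan_link).

(* [best] is 0 or one more than a heaviest unvisited hedge. *)
Definition select : prog :=
  best ::= NConst 0 ;;
  PFor 22 var_M
    (PIf (BAnd (NLe (NGet mark (var 22)) (NConst 0))
         (BAnd (RPos (RGet weight (var 22)))
               (BNot (BAnd (NLe (NConst 1) (var best))
                           (RLe (RGet weight (var 22))
                                (RGet weight (NPred (var best))))))))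
       (best ::= NSucc (var 22)) PSkip).

Definition grow : prog :=
  PFor 21 var_M
    (select ;;
     PIf (NLe (NConst 1) (var best))
       (PN mark (NPred (var best)) (NConst 1) ;; scan) PSkip).

Definition tree : prog :=
  PFor 26 var_n (PN label (var 26) (var 26)) ;;
  PFor 27 var_M (PIf (NLe (NGet mark (var 27)) (NConst 1))
                     (PN mark (var 27) (NConst 0)) PSkip) ;;
  grow.

(** The iteration count must come from the input, so the loop runs [M] times and only the iterations
    with a counter below [num_trees] build a forest. *)
Definition pack : prog :=
  PFor 28 var_M (PIf (NLe (NSucc (var 28)) (var num_trees)) tree PSkip).

Section Forests.
Variables (R : realType) (n M : nat) (L : seq link).
Implicit Types s : state R.

Definition links_loaded s : Prop :=
  [/\ nmem s 0 0 = n, nmem s 0 1 = M &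
      forall k, nth (0, 0, 0)%N L k =
        (nmem s lk_hedge k, nmem s lk_src k, nmem s lk_dst k)].

Lemma links_loaded_agree p s s' :
  ~~ [|| writesN p 0, writesN p lk_hedge, writesN p lk_src | writesN p lk_dst] ->
  agree p s s' -> links_loaded s -> links_loaded s'.
Proof.
rewrite !negb_or => /and4P[w0 w1 w2 w3] [AN _ _] [sn sM sL].
by split=> [||k]; rewrite !AN.
Qed.

Lemma relabelP s v : (v < nmem s 0 0)%N ->
  nmem (sem relabel s) label v =
    if nmem s label v == nmem s dst_label 0 then nmem s src_label 0
    else nmem s label v.
Proof.
pose I (k : nat) s' := forall v, (v < nmem s 0 0)%N -> nmem s' label v =
  if (k <= v)%N && (nmem s label v == nmem s dst_label 0)
  then nmem s src_label 0 else nmem s label v.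
move=> vn; suff /(_ v vn) : I 0%N (sem relabel s) by [].
apply: sem_for => // [u un|k s' /= kn [AN _ _] s'k Is' u un].
  by rewrite /= leqNgt un.
rewrite !semE /= /update /= -eqn_leq !(AN dst_label) //.
have := Is' k kn; rewrite ltnn /= => ->; have := Is' u un.
case: (ltngtP k u) => [ku|uk|ku] /= E.
- by case: ifP => _ /=; rewrite ?/update /= ?(gtn_eqF ku) E.
- by case: ifP => _ /=; rewrite ?/update /= ?(ltn_eqF uk) E.
- by rewrite -ku; case: ifP => _ /=; rewrite ?/update /= ?eqxx ?(AN src_label) // Is' // ltnn.
Qed.

Hypothesis n_gt0 : (0 < n)%N.
Hypothesis L_ltM : forall l, l \in L -> (l.1.1 < M)%N.
Hypothesis L_ltn : forall l, l \in L -> (l.1.2 < n)%N /\ (l.2 < n)%N.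
Hypothesis L_size : (size L <= M * n)%N.

(** Taking a link of [b] turns its mark from 1 to 2, which blocks its later links; a hedge thus
    causes at most one merge, and in the second case the labels are those after that merge. *)
Definition scanned s (x : nat) s' : Prop :=
  let b := (nmem s best 0).-1 in
  [/\ nmem s' lk_pos 0 = x,
      forall e, e != b -> nmem s' mark e = nmem s mark e &
      [/\ nmem s' mark b = 1%N,
          forall v, (v < n)%N -> nmem s' label v = nmem s label v &
          forall k l, (k < x)%N -> nth (0, 0, 0)%N L k = l -> l.1.1 = b ->
            nmem s label l.1.2 = nmem s label l.2] \/
      nmem s' mark b = 2%N /\
      exists2 l, l \in L & [/\ l.1.1 = b, nmem s label l.1.2 != nmem s label l.2 &
        forall v, (v < n)%N -> nmem s' label v =
          if nmem s label v == nmem s label l.2 then nmem s label l.1.2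
          else nmem s label v]].

Lemma scan_linkP s x s' : links_loaded s' -> nmem s' best 0 = nmem s best 0 ->
  scanned s x s' -> scanned s x.+1 (sem scan_link s').
Proof.
move=> [s'n s'M s'L] s'b [s'x s'e H].
set b := (nmem s best 0).-1 in s'e H *.
have [h [a [c E]]] : exists h a c, nth (0, 0, 0)%N L x = (h, a, c).
  by case: nth => [[h a] c]; exists h, a, c.
have [an cn] : (a < n)%N /\ (c < n)%N.
  have := @L_ltn (nth (0, 0, 0)%N L x); case: (ltnP x (size L)) => xL.
    by rewrite mem_nth // E => /(_ isT).
  by move: E; rewrite nth_default // => -[_ <- <-].
have [hE aE cE] : [/\ h = nmem s' lk_hedge x, a = nmem s' lk_src x & c = nmem s' lk_dst x].
  by have := s'L x; rewrite E => -[].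
rewrite /scan_link sem_seq sem_if [beval _ _]/= -!eqn_leq s'x s'b subn1 -hE -aE -cE -/b.
case: ifP => [/and3P[/eqP hb /eqP mb lab]|cond].
  case: H => [[_ sl slx]|[]]; last by rewrite mb.
  rewrite !sl // in lab.
  set s1 := sem join_link s'.
  have labE v : (v < n)%N -> nmem s1 label v =
      if nmem s label v == nmem s label c then nmem s label a else nmem s label v.
    move=> vn; rewrite /s1 /join_link sem_seq.
    rewrite relabelP; last by rewrite /= /update /= s'n.
    by rewrite /= /update /= s'x -aE -cE !sl.
  have markE e : nmem s1 mark e = if e == b then 2%N else nmem s' mark e.
    by rewrite /s1 /join_link sem_seq sem_nmem //= /update /= s'b subn1.
  have posE : nmem s1 lk_pos 0 = x.
    by rewrite /s1 /join_link sem_seq sem_nmem //= /update /=.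
  split.
  - by rewrite /= /update /= posE addn1.
  - move=> e eb; rewrite /= /update /= markE (negbTE eb); exact: s'e.
  right; split; first by rewrite /= /update /= markE eqxx.
  have xL : (x < size L)%N.
    rewrite ltnNge; apply/negP => Lx; move: E lab; rewrite nth_default // => -[_ <- <-].
    by rewrite eqxx.
  exists (h, a, c); first by rewrite -E mem_nth.
  split=> // v vn; exact: labE.
split.
- by rewrite /= /update /= s'x addn1.
- by move=> e eb; rewrite /= /update /=; exact: s'e.
case: H => [[mb sl slx]|[mb H]]; last by right.
left; split=> // k l; rewrite ltnS leq_eqVlt => /orP[/eqP ->|]; last exact: slx.
rewrite E => <- /= hb; apply/eqP; apply/negPn; apply/negP => lab.
by move/negP: cond; apply; rewrite hb mb !sl // !eqxx.
Qed.

Lemma scanP s : links_loaded s -> nmem s mark (nmem s best 0).-1 = 1%N ->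
  scanned s (M * n) (sem scan s).
Proof.
move=> Ls sb; rewrite /scan sem_seq; set s0 := sem _ s.
have Ls0 : links_loaded s0 by exact: links_loaded_agree (agree_sem _ _) Ls.
have [s0n s0M _] := Ls0.
have -> : (M * n = (M - 0) * n)%N by rewrite subn0.
apply: (@sem_for _ (fun k s' => scanned s ((M - k) * n) s')) => //.
  rewrite (s0M : neval s0 var_M = M) subnn mul0n.
  by split=> //; left; split.
move=> k s1; rewrite (s0M : neval s0 var_M = M) => kM A1 _ H1.
have Ls1 : links_loaded s1 by apply: links_loaded_agree A1 Ls0.
have [s1n _ _] := Ls1.
have b1 : nmem s1 best 0 = nmem s best 0 by case: A1 => -> //.
have -> : ((M - k) * n = (M - k.+1) * n + (n - 0))%N.
  by rewrite subn0 -mulSnr; congr (_ * _)%N; lia.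
apply: (@sem_for _ (fun j s' => scanned s ((M - k.+1) * n + (n - j)) s')) => //.
  by rewrite (s1n : neval (set_nat 23 0 k s1) var_n = n) subnn addn0.
move=> j s2; rewrite (s1n : neval (set_nat 23 0 k s1) var_n = n) => jn A2 _ H2.
have Ls2 : links_loaded s2 by apply: links_loaded_agree A2 _.
have b2 : nmem s2 best 0 = nmem s best 0 by case: A2 => -> //.
have -> : ((M - k.+1) * n + (n - j) = ((M - k.+1) * n + (n - j.+1)).+1)%N by lia.
exact: (@scan_linkP s _ (set_nat 24 0 j s2)).
Qed.

Definition unmarked s (e : nat) : bool :=
  (nmem s mark e == 0%N) && (0 < rmem s weight e).

Lemma selectP s : links_loaded s ->
  nmem (sem select s) best 0 = 0%N /\ (forall e, (e < M)%N -> ~~ unmarked s e) \/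
  exists b, [/\ (b < M)%N, nmem (sem select s) best 0 = b.+1, unmarked s b &
    forall e, (e < M)%N -> unmarked s e -> rmem s weight e <= rmem s weight b].
Proof.
move=> Ls.
pose I k s' := nmem s' best 0 = 0%N /\
    (forall e, (k <= e)%N -> (e < M)%N -> ~~ unmarked s e) \/
  exists b, [/\ (b < M)%N, nmem s' best 0 = b.+1, unmarked s b &
    forall e, (k <= e)%N -> (e < M)%N -> unmarked s e ->
      rmem s weight e <= rmem s weight b].
suff : I 0%N (sem select s).
  case=> [[b0 H]|[b [bM bE ub bmax]]]; [left|right; exists b]; split=> // e eM;
  [exact: H|exact: bmax].
rewrite /select sem_seq; set s0 := sem _ s.
have Ls0 : links_loaded s0 by exact: links_loaded_agree (agree_sem _ _) Ls.
have [s0n s0M _] := Ls0.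
apply: sem_for => //.
  rewrite (s0M : neval s0 var_M = M).
  by left; split=> // e Me eM; move: Me; rewrite leqNgt eM.
move=> k s'; rewrite (s0M : neval s0 var_M = M) => kM [AN AR _] s'k Is'.
have mE : nmem s' mark k = nmem s mark k by rewrite AN.
have wE e : rmem s' weight e = rmem s weight e by rewrite AR.
rewrite !semE [beval _ _]/= /update /= !subn1 mE !wE leqn0.
case: ifP => [/and3P[mk wk]|cond].
  rewrite -ltNge in wk; have uk : unmarked s k by rewrite /unmarked mk wk.
  case: Is' => [[-> H] _|[b [bM bE ub bmax]]].
    right; exists k; split=> //=; first by rewrite /update /= addn1.
    move=> e; rewrite leq_eqVlt => /orP[/eqP ->|ke] eM // ue.
    by move: ue; rewrite (negbTE (H e ke eM)).
  rewrite bE /= -ltNge => bk; right; exists k; split=> //=; first by rewrite /update /= addn1.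
  move=> e; rewrite leq_eqVlt => /orP[/eqP ->|ke] eM // ue.
  by apply: le_trans (ltW bk); exact: bmax.
case: Is' => [[b0 H]|[b [bM bE ub bmax]]]; [left|right; exists b]; split=> // e;
    rewrite leq_eqVlt => /orP[/eqP <-|ke] eM //; try exact: H; try exact: bmax.
  apply/negP => /andP[mk wk]; move/negP: cond; apply.
  by rewrite mk b0 -ltNge wk.
move=> /andP[mk wk]; rewrite leNgt; apply/negP => bk.
by move/negP: cond; apply; rewrite mk bE /= -!ltNge wk bk.
Qed.

Definition packed (w : nat -> R) (Fs : seq (seq link)) s : Prop :=
  [/\ forall F, F \in Fs -> {subset F <= L} /\ (size F <= n)%N,
      uniq [seq l.1.1 | l <- flatten Fs],
      forall e, (e < M)%N -> (nmem s mark e <= 2)%N /\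
        (nmem s mark e == 2%N) = (e \in [seq l.1.1 | l <- flatten Fs]),
      forall l, l \in flatten Fs -> 0 < w l.1.1
    & forall F l, F \in Fs -> l \in L -> 0 < w l.1.1 ->
        nmem s mark l.1.1 != 2%N -> joined w (w l.1.1) F l.1.2 l.2].

(** The number of components of the current forest. Each added link lowers it, which bounds the size
    of a forest without a notion of acyclicity. *)
Definition num_labels s : nat :=
  size (undup [seq nmem s label v | v <- iota 0 n]).

(** Invariant of Kruskal's algorithm. Equal labels mean connectivity through [F] without a weight
    bound; for a hedge being visited this becomes [joined], because every link of [F] is at least as
    heavy as any unvisited hedge. *)
Record growing (w : nat -> R) Fs F s : Prop := Growing {
  _ : forall F', F' \in Fs -> {subset F' <= L} /\ (size F' <= n)%N;
  _ : {subset F <= L} /\ (size F + num_labels s <= n)%N;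
  _ : uniq [seq l.1.1 | l <- F ++ flatten Fs];
  _ : forall e, (e < M)%N -> (nmem s mark e <= 2)%N /\
        (nmem s mark e == 2%N) = (e \in [seq l.1.1 | l <- F ++ flatten Fs]);
  _ : forall l, l \in F ++ flatten Fs -> 0 < w l.1.1;
  _ : forall F' l, F' \in Fs -> l \in L -> 0 < w l.1.1 ->
        nmem s mark l.1.1 != 2%N -> joined w (w l.1.1) F' l.1.2 l.2;
  _ : forall u v, (u < n)%N -> (v < n)%N -> nmem s label u = nmem s label v ->
        forall g : nat -> nat, (forall l, l \in F -> g l.1.2 = g l.2) -> g u = g v;
  _ : forall l e, l \in F -> (e < M)%N -> unmarked s e -> w e <= w l.1.1;
  _ : forall l, l \in L -> nmem s mark l.1.1 = 1%N ->
        joined w (w l.1.1) F l.1.2 l.2 }.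

Definition num_unmarked s : nat := #|[set e : 'I_M | unmarked s e]|.

Lemma grow_step w Fs F s k : links_loaded s ->
  (forall e, rmem s weight e = w e) ->
  growing w Fs F s -> (num_unmarked s <= k.+1)%N ->
  let s' := sem (select ;; PIf (NLe (NConst 1) (var best))
       (PN mark (NPred (var best)) (NConst 1) ;; scan) PSkip) s in
  exists2 F', growing w Fs F' s' & (num_unmarked s' <= k)%N.
Proof.
move=> Ls sw G; have := G; case=> FsL [FL Fn] uF mF pF jFs lF maxF jF Ns s'.
rewrite {}/s' sem_seq; set s1 := sem select s.
have A1 : agree select s s1 by exact: agree_sem.
have Ls1 : links_loaded s1 by exact: links_loaded_agree A1 Ls.
case: A1 => AN AR _.
have m1 e : nmem s1 mark e = nmem s mark e by rewrite AN.
have l1 e : nmem s1 label e = nmem s label e by rewrite AN.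
have w1 e : rmem s1 weight e = w e by rewrite AR.
have u1 e : unmarked s1 e = unmarked s e by rewrite /unmarked m1 w1 sw.
rewrite sem_if [beval _ _]/=; case: (selectP Ls) => [[b0 nu]|[b [bM bE ub bmax]]].
  rewrite -/s1 in b0; rewrite b0 /= sem_skip; exists F.
    split=> //.
    - split=> //; rewrite /num_labels; under eq_map => v do rewrite l1.
      exact: Fn.
    - by move=> e /mF; rewrite m1.
    - by move=> F' l; rewrite m1; exact: jFs.
    - by move=> u v; rewrite !l1; exact: lF.
    - by move=> l e; rewrite u1; exact: maxF.
    - by move=> l; rewrite m1; exact: jF.
  rewrite /num_unmarked eq_card0 // => e; rewrite !inE u1.
  by apply/negbTE/nu.
rewrite -/s1 in bE; rewrite bE /= sem_seq; set s2 := sem _ s1.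
have Ls2 : links_loaded s2 by exact: links_loaded_agree (agree_sem _ _) Ls1.
have m2 e : nmem s2 mark e = if e == b then 1%N else nmem s mark e.
  by rewrite /s2 sem_setN /= /update /= bE subn1 m1.
have l2 e : nmem s2 label e = nmem s label e.
  by rewrite /s2 sem_setN /= /update /= l1.
have b2 : (nmem s2 best 0).-1 = b by rewrite /s2 sem_setN /= /update /= bE.
have w2 e : rmem s2 weight e = w e by rewrite /s2 sem_setN /= w1.
clearbody s2; have [] := scanP Ls2; first by rewrite b2 m2 eqxx.
set s3 := sem scan s2; rewrite b2 => _ m3 H.
have {}m3 e : e != b -> nmem s3 mark e = nmem s mark e.
  by move=> eb; rewrite m3 // m2 (negbTE eb).
have w3 e : rmem s3 weight e = w e.
  by rewrite /s3 sem_rmem.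
have /andP[/eqP mb wb] := ub; rewrite sw in wb.
have mb3 : (nmem s3 mark b == 1%N) || (nmem s3 mark b == 2%N).
  by case: H => [[-> _ _]|[-> _]].
have u3 e : unmarked s3 e = (e != b) && unmarked s e.
  rewrite /unmarked w3 sw; case: (eqVneq e b) => [->|eb]; last by rewrite m3.
  by case/orP: mb3 => /eqP ->.
have N3 : (num_unmarked s3 <= k)%N.
  rewrite -ltnS; apply: leq_trans Ns; apply: proper_card.
  apply/properP; split.
    by apply/subsetP => e; rewrite !inE u3 => /andP[].
  by exists (Ordinal bM); rewrite !inE ?u3 /= ?ub ?eqxx.
have bN : b \notin [seq l.1.1 | l <- F ++ flatten Fs].
  by have [_ <-] := mF b bM; rewrite mb.
have jFs3 F' l : F' \in Fs -> l \in L -> 0 < w l.1.1 ->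
    nmem s3 mark l.1.1 != 2%N -> joined w (w l.1.1) F' l.1.2 l.2.
  move=> F'Fs lL wl; case: (eqVneq l.1.1 b) => [lb _|lb]; last first.
    by rewrite m3 //; exact: jFs.
  by apply: jFs => //; rewrite lb mb.
case: H => [[mb1 l3 spanned]|[mb2 [[[h a] c] lL [/= hb lab l3]]]].
  exists F => //; split=> //.
  - split=> //; rewrite /num_labels (_ : map _ _ = [seq nmem s label v | v <- iota 0 n]) //.
    by apply/eq_in_map => v; rewrite mem_iota => vn; rewrite l3 ?l2.
  - move=> e eM; case: (eqVneq e b) => [->|eb]; last by rewrite m3 //; exact: mF.
    by rewrite mb1 (negbTE bN).
  - by move=> u v un vn; rewrite !l3 // !l2; exact: lF.
  - by move=> l e lF' eM; rewrite u3 => /andP[_]; exact: maxF.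
  move=> l lL; case: (eqVneq l.1.1 b) => [lb _|lb]; last by rewrite m3 //; exact: jF.
  have [la lc] := L_ltn lL.
  have lk : (index l L < M * n)%N by apply: leq_trans L_size; rewrite index_mem.
  have := spanned (index l L) l lk (nth_index _ lL) lb; rewrite !l2 => lab g gF.
  apply: lF => // x xF; apply: gF => //; rewrite lb; exact: maxF.
have [/= an cn] := L_ltn lL.
exists ((h, a, c) :: F) => //.
have l3' v : (v < n)%N -> nmem s3 label v =
    if nmem s label v == nmem s label c then nmem s label a else nmem s label v.
  by move=> vn; rewrite l3 // !l2.
rewrite !l2 in lab.
split=> //.
- split=> [l|]; first by rewrite inE => /orP[/eqP -> //|]; exact: FL.
  rewrite /= addSn -addnS; apply: leq_trans Fn; rewrite leq_add2l.
  (* The merge removes the label of [c] and creates none, so that label together with the new ones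
     still fits among the old labels. *)
  rewrite /num_labels; apply: (@uniq_leq_size _ (nmem s label c :: undup _)).
    rewrite cons_uniq undup_uniq mem_undup andbT; apply/mapP => -[v].
    rewrite mem_iota /= add0n => vn; rewrite l3' //; case: eqP => [_ E|ne /esym //].
    by rewrite E eqxx in lab.
  move=> x; rewrite inE !mem_undup => /orP[/eqP ->|/mapP[v]].
    by apply: map_f; rewrite mem_iota.
  rewrite mem_iota /= add0n => vn ->; rewrite l3' //.
  by case: ifP => _; apply: map_f; rewrite mem_iota.
- by rewrite /= hb bN.
- move=> e eM; rewrite /= inE hb; case: (eqVneq e b) => [->|eb] /=.
    by rewrite mb2.
  by rewrite m3 //; exact: mF.
- by move=> l; rewrite /= inE => /orP[/eqP -> /=|]; [rewrite hb|exact: pF].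
- move=> u v un vn; rewrite !l3' // => E g gF.
  have gFF x : x \in F -> g x.1.2 = g x.2 by move=> xF; apply: gF; rewrite inE xF orbT.
  have gac : g a = g c by apply: (gF (h, a, c)); rewrite mem_head.
  move: E; case: eqP => [uc|_]; case: eqP => [vc|_] E.
  - by apply: lF => //; rewrite uc vc.
  - by rewrite (lF u c un cn uc g gFF) -gac; exact: lF.
  - by rewrite (lF v c vn cn vc g gFF) -gac; exact: lF.
  - exact: lF.
- move=> l e; rewrite inE u3 => /orP[/eqP -> /=|lF'] eM /andP[_ ue]; last exact: maxF.
  by rewrite hb -!sw; exact: bmax.
move=> l lL'; case: (eqVneq l.1.1 b) => [->|lb]; first by rewrite mb2.
rewrite m3 // => ml g gF; apply: (jF l lL' ml) => x xF.
by apply: gF; rewrite inE xF orbT.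
Qed.

Lemma growP w Fs F s : links_loaded s -> (forall e, rmem s weight e = w e) ->
  growing w Fs F s ->
  exists2 F', growing w Fs F' (sem grow s) &
    forall e, (e < M)%N -> ~~ unmarked (sem grow s) e.
Proof.
move=> Ls sw G; have [sn sM _] := Ls.
suff [F' G' N0] : exists2 F', growing w Fs F' (sem grow s) &
    (num_unmarked (sem grow s) <= 0)%N.
  exists F' => // e eM; move: N0; rewrite leqn0 cards_eq0 => /eqP/setP.
  by move=> /(_ (Ordinal eM)); rewrite !inE /= => ->.
apply: (@sem_for _ (fun k s' => exists2 F', growing w Fs F' s' & (num_unmarked s' <= k)%N)) => //.
  exists F; first by case: G.
  by rewrite (sM : neval s var_M = M) (leq_trans (max_card _)) // card_ord.
move=> k s' kM A' _ [F' G' N'].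
have Ls' : links_loaded s' by apply: links_loaded_agree A' Ls.
have w' e : rmem s' weight e = w e by case: A' => _ -> //.
apply: (@grow_step w Fs F' (set_nat 21 0 k s')) => //.
by case: G'.
Qed.

Lemma treeP w Fs s : links_loaded s -> (forall e, rmem s weight e = w e) ->
  packed w Fs s -> exists F, packed w (F :: Fs) (sem tree s).
Proof.
move=> Ls sw P; rewrite /tree sem_seq; set s1 := sem _ s.
have A1 : agree (PFor 26 var_n (PN label (var 26) (var 26))) s s1 by exact: agree_sem.
have Ls1 : links_loaded s1 by exact: links_loaded_agree A1 Ls.
have [sn sM _] := Ls.
have l1 v : (v < n)%N -> nmem s1 label v = v.
  move=> vn; suff /(_ v isT vn) : forall v, (0 <= v)%N -> (v < n)%N -> nmem s1 label v = v by [].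
  apply: (@sem_for _ (fun k s' => forall v, (k <= v)%N -> (v < n)%N -> nmem s' label v = v)) => //.
    by rewrite (sn : neval s var_n = n) => u nu un; move: nu; rewrite leqNgt un.
  move=> k s' kn _ s'k IH u; rewrite sem_setN /= /update /= leq_eqVlt => /orP[/eqP ->|ku] un.
    by rewrite eqxx.
  by rewrite gtn_eqF //; exact: IH.
have {}A1 : [/\ forall e, nmem s1 mark e = nmem s mark e & forall e, rmem s1 weight e = w e].
  by case: A1 => AN AR _; split=> e; [rewrite AN|rewrite AR].
case: A1 => m1 w1; clearbody s1; rewrite sem_seq; set s2 := sem _ s1.
have A2 : agree (PFor 27 var_M (PIf (NLe (NGet mark (var 27)) (NConst 1))
    (PN mark (var 27) (NConst 0)) PSkip)) s1 s2 by exact: agree_sem.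
have Ls2 : links_loaded s2 by exact: links_loaded_agree A2 Ls1.
have m2 e : (e < M)%N -> nmem s2 mark e = if (nmem s mark e <= 1)%N then 0%N else nmem s mark e.
  move=> eM; suff : forall e, (e < M)%N -> nmem s2 mark e =
      if (0 <= e)%N && (nmem s mark e <= 1)%N then 0%N else nmem s mark e.
    by move/(_ e eM).
  have [_ s1M _] := Ls1.
  apply: (@sem_for _ (fun k s' => forall e, (e < M)%N -> nmem s' mark e =
      if (k <= e)%N && (nmem s mark e <= 1)%N then 0%N else nmem s mark e)) => //.
    by rewrite (s1M : neval s1 var_M = M) => u uM; rewrite leqNgt uM /=; exact: m1.
  move=> k s'; rewrite (s1M : neval s1 var_M = M) => kM _ s'k IH u uM.
  rewrite !semE /= /update /=.
  have := IH k kM; rewrite ltnn /= => ->; have := IH u uM.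
  case: (ltngtP k u) => [ku|uk|<-] /= E.
  - by case: ifP => _ /=; rewrite ?/update /= ?(gtn_eqF ku) E.
  - by case: ifP => _ /=; rewrite ?/update /= ?(ltn_eqF uk) E.
  - by case: ifP => _ /=; rewrite ?/update /= ?eqxx // E.
have {A2}[l2 w2] : (forall v, nmem s2 label v = nmem s1 label v) /\
    forall e, rmem s2 weight e = w e.
  by case: A2 => AN AR _; split=> e; [rewrite AN|rewrite AR].
clearbody s2; case: P => FsL uFs mFs pFs jFs.
have m2E e : (e < M)%N -> (nmem s2 mark e == 2%N) = (nmem s mark e == 2%N).
  by move=> eM; rewrite m2 //; case: (nmem s mark e) => [|[|k]].
have [||F [FsL' [FL Fn] uF mF pF jFs' lF maxF jF] nu] := @growP w Fs [::] s2 Ls2.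
- by [].
- split=> //.
  + split=> //; rewrite add0n /num_labels.
    by apply: leq_trans (size_undup _) _; rewrite size_map size_iota.
  + move=> e eM; rewrite m2E //; split; last by case: (mFs e eM).
    by rewrite m2 //; case: ifP => // _; case: (mFs e eM).
  + by move=> F' l F'Fs lL wl; rewrite m2E ?L_ltM //; exact: jFs.
  + by move=> u v un vn; rewrite !l2 !l1 // => ->.
  + move=> l lL; rewrite m2 ?L_ltM //; case: ifP => // /negbT.
    by rewrite -ltnNge => /[swap] ->.
exists F; split=> //.
- move=> F'; rewrite inE => /orP[/eqP ->|]; last exact: FsL'.
  by split=> //; apply: leq_trans Fn; exact: leq_addr.
move=> F' l; rewrite inE => /orP[/eqP -> {F'}|]; last exact: jFs'.
move=> lL wl m; apply: jF => //.
have lM := L_ltM lL; have := nu _ lM; rewrite /unmarked.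
rewrite (_ : rmem _ weight _ = w l.1.1); last by rewrite sem_rmem.
rewrite wl andbT; case: (mF _ lM) => + _; move: m.
by case: (nmem _ mark _) => [|[|[|]]].
Qed.

Lemma packP w s : links_loaded s -> (forall e, rmem s weight e = w e) ->
  (nmem s num_trees 0 <= M)%N -> packed w [::] s ->
  exists2 Fs, size Fs = nmem s num_trees 0 & packed w Fs (sem pack s).
Proof.
move=> Ls sw tM P; have [_ sM _] := Ls.
suff [Fs sFs PFs] : exists2 Fs, size Fs = (nmem s num_trees 0 - 0)%N & packed w Fs (sem pack s).
  by exists Fs => //; rewrite sFs subn0.
apply: (@sem_for _ (fun k s' => exists2 Fs, size Fs = (nmem s num_trees 0 - k)%N & packed w Fs s')) => //.
  by exists [::] => //; apply/esym/eqP; rewrite subn_eq0 (sM : neval s var_M = M).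
move=> k s' kM A' _ [Fs sFs PFs].
have Ls' : links_loaded s' by apply: links_loaded_agree A' Ls.
have [AN AR _] := A'.
rewrite sem_if [beval _ _]/= /update /= (AN num_trees) // addn1.
case: ifP => kt.
  have [|||F PF] := @treeP w Fs (set_nat 28 0 k s').
  - by [].
  - by move=> e; rewrite -sw -(AR weight).
  - by case: PFs.
  by exists (F :: Fs) => //=; rewrite sFs; lia.
by exists Fs; [rewrite sFs; lia|case: PFs].
Qed.

Lemma packed_forest_packing w Fs s : packed w Fs s ->
  forest_packing L w Fs /\
  forall e, (e < M)%N -> eligible w Fs e = (0 < w e) && (nmem s mark e != 2%N).
Proof.
case=> FsL uFs mFs pFs jFs.
have el e : (e < M)%N -> eligible w Fs e = (0 < w e) && (nmem s mark e != 2%N).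
  by move=> eM; rewrite /eligible; case: (mFs e eM) => _ ->.
split=> //; split=> //; first by move=> F /FsL[].
move=> F l FFs lL; rewrite el ?L_ltM // => /andP[wl ml].
exact: jFs.
Qed.

Lemma packed_size w Fs s : packed w Fs s ->
  (\sum_(e < M) ((0 < w e)%R && (nmem s mark e == 2%N)) <= n * size Fs)%N.
Proof.
case=> FsL uFs mFs pFs jFs.
apply: (@leq_trans (\sum_(e < M) ((e : nat) \in [seq l.1.1 | l <- flatten Fs]))).
  apply: leq_sum => e _; case: (mFs e (ltn_ord e)) => _ ->.
  by case: (_ \in _); rewrite ?andbF ?leq_b1.
rewrite -size_uniq_ord //; last first.
  by move=> x /mapP[l /flattenP[F FFs lF] ->]; apply: L_ltM; case: (FsL F FFs) => sub _; exact: sub.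
rewrite size_map size_flatten sumnE big_map mulnC -sum1_size big_distrl /=.
rewrite big_seq [leqRHS]big_seq; apply: leq_sum => F FFs.
by rewrite mul1n; case: (FsL F FFs).
Qed.

End Forests.

(** * One level *)

(* The second component is 0 or one more than the hedge waiting for a partner. *)
Fixpoint pair_up (el : pred nat) (M d : nat) : seq (nat * nat) * nat :=
  if d is d'.+1 then
    let: (ps, q) := pair_up el M d' in
    let e := (M - d)%N in
    if el e then if q is j.+1 then ((j, e) :: ps, 0%N) else (ps, e.+1)
    else (ps, q)
  else ([::], 0%N).

Definition members (ps : seq (nat * nat)) : seq nat := map fst ps ++ map snd ps.

Lemma mem_members_cons p ps e :
  (e \in members (p :: ps)) = [|| e == p.1, e == p.2 | e \in members ps].
Proof.
rewrite /members /= inE !mem_cat inE.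
by case: (e == p.1); case: (e == p.2); rewrite ?orbT.
Qed.


Section PairUp.
Variables (el : pred nat) (M : nat).

Lemma pair_upP d : (d <= M)%N ->
  let: (ps, q) := pair_up el M d in
  let rest := if q is j.+1 then [:: j] else [::] in
  [/\ uniq (rest ++ members ps),
      forall e, e \in rest ++ members ps -> [/\ (M - d <= e)%N, (e < M)%N & el e]
    & (2 * size ps + size rest = \sum_(M - d <= e < M) el e)%N].
Proof.
elim: d => [|d IH] dM /=.
  by rewrite subn0 big_geq.
have {IH} := IH (ltnW dM); case: (pair_up el M d) => [ps q] [u mem sz].
have lt1 : (M - d.+1 < M)%N by lia.
have big : (\sum_(M - d.+1 <= e < M) el e =
    el (M - d.+1)%N + \sum_(M - d <= e < M) el e)%N.
  by rewrite big_ltn // (_ : (M - d.+1).+1 = (M - d)%N) //; lia.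
have new e : e \in (if q is j.+1 then [:: j] else [::]) ++ members ps ->
    (e == (M - d.+1)%N) = false.
  by move=> /mem[Me _ _]; apply/negbTE; rewrite neq_ltn; apply/orP; right; lia.
have weak e : e \in (if q is j.+1 then [:: j] else [::]) ++ members ps ->
    [/\ (M - d.+1 <= e)%N, (e < M)%N & el e].
  by move=> /mem[Me eM ele]; split=> //; apply: leq_trans Me; lia.
case ele: (el (M - d.+1)%N); last by split=> //; rewrite big ele.
case: q u mem sz new weak => [|j] /= u mem sz new weak.
  split.
  - by rewrite /= u andbT; apply/negP => /new; rewrite eqxx.
  - by move=> e; rewrite inE => /orP[/eqP ->|/weak].
  - by rewrite big ele -sz addn0 addnC.
have jmem : (j == (M - d.+1)%N) = false by apply: new; rewrite mem_head.
move: u => /andP[jN u].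
have eN : (M - d.+1)%N \notin members ps.
  by apply/negP => eps; have := new (M - d.+1)%N; rewrite inE eps orbT eqxx => /(_ isT).
split.
- rewrite /members /= mem_cat inE jmem /= -mem_cat jN /=.
  by rewrite -cat1s uniq_catCA /= eN.
- move=> e; rewrite mem_members_cons /= => /or3P[/eqP ->|/eqP ->|ee].
  + by apply: weak; rewrite mem_head.
  + by split.
  + by apply: weak; rewrite inE ee orbT.
- by rewrite big ele -sz /=; lia.
Qed.

End PairUp.

Section Resampled.
Variables (R : realType) (M : nat) (w : nat -> R) (u : seq bool).
Implicit Types (ps : seq (nat * nat)).

Lemma resampled_nil e : resampled M w [::] u e = w e.
Proof. by rewrite /resampled big_nil addr0 mulr1. Qed.

Lemma resampled_notin ps e : e \notin members ps -> resampled M w ps u e = w e.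
Proof.
rewrite mem_cat negb_or => /andP[e1 e2]; rewrite /resampled big1_seq.
  by rewrite addr0 mulr1.
move=> p /andP[_ pps]; have -> : (p.1 == e) = false.
  by apply/negbTE; apply: contraNneq e1 => <-; exact: map_f.
have -> : (p.2 == e) = false.
  by apply/negbTE; apply: contraNneq e2 => <-; exact: map_f.
by rewrite subrr mulr0.
Qed.

Lemma resampled_cons p ps e : resampled M w (p :: ps) u e =
  resampled M w ps u e +
  w e * (sign_at R u (M.-1 - p.2) * ((p.1 == e)%:R - (p.2 == e)%:R)).
Proof. by rewrite /resampled big_cons; ring. Qed.

Lemma uniq_members_cons p ps : uniq (members (p :: ps)) ->
  [/\ p.1 != p.2, p.1 \notin members ps, p.2 \notin members ps
    & uniq (members ps)].
Proof.
rewrite /members /= mem_cat inE !negb_or => /andP[/and3P[h1 h2 h3]].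
rewrite -cat1s uniq_catCA /= => /andP[h4 h5]; split=> //.
by rewrite mem_cat negb_or h1.
Qed.

Lemma resampled_pair p ps : uniq (members (p :: ps)) ->
  resampled M w (p :: ps) u p.1 = w p.1 * (1 + sign_at R u (M.-1 - p.2)) /\
  resampled M w (p :: ps) u p.2 = w p.2 * (1 - sign_at R u (M.-1 - p.2)).
Proof.
case/uniq_members_cons => p12 p1 p2 _; rewrite !resampled_cons !resampled_notin //.
by rewrite !eqxx [p.2 == p.1]eq_sym (negbTE p12) /=; split; ring.
Qed.

Lemma resampled_off p ps e : e != p.1 -> e != p.2 ->
  resampled M w (p :: ps) u e = resampled M w ps u e.
Proof.
move=> e1 e2; rewrite resampled_cons ![_ == e]eq_sym (negbTE e1) (negbTE e2).
by rewrite subrr !mulr0 addr0.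
Qed.

Lemma resampled_ge0 ps e : uniq (members ps) -> 0 <= w e ->
  0 <= resampled M w ps u e.
Proof.
move=> + we; elim: ps => [|p ps IH] ups; first by rewrite resampled_nil.
have [_ _ _ /IH {}IH] := uniq_members_cons ups.
have [h1 h2] := resampled_pair ups.
case: (eqVneq e p.1) => [ep|e1].
  rewrite ep h1 mulr_ge0 -?ep // /sign_at; case: nth; lra.
case: (eqVneq e p.2) => [ep|e2]; last by rewrite resampled_off.
by rewrite ep h2 mulr_ge0 -?ep // /sign_at; case: nth; lra.
Qed.

(** Whatever the coins, exactly one member of each pair loses its weight. *)
Lemma card_resampled ps : uniq (members ps) ->
  (forall e, e \in members ps -> (e < M)%N /\ 0 < w e) ->
  (\sum_(e < M) (0 < resampled M w ps u e)%R + size ps =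
   \sum_(e < M) (0 < w e)%R)%N.
Proof.
elim: ps => [|p ps IH] ups psM.
  by rewrite addn0; apply: eq_bigr => e _; rewrite resampled_nil.
have [p12 p1 p2 ups'] := uniq_members_cons ups.
have [|p1M w1] := psM p.1; first by rewrite mem_members_cons eqxx.
have [|p2M w2] := psM p.2; first by rewrite mem_members_cons eqxx orbT.
rewrite -IH //; last first.
  by move=> e eps; apply: psM; rewrite mem_members_cons eps !orbT.
have split2 (F : nat -> nat) : (\sum_(e < M) F e =
    F p.1 + (F p.2 + \sum_(e < M | (e != Ordinal p1M) && (e != Ordinal p2M)) F e))%N.
  rewrite (bigD1 (Ordinal p1M)) //= (bigD1 (Ordinal p2M)) //=.
  by rewrite -val_eqE /= eq_sym.
rewrite (split2 (fun e => (0 < resampled M w (p :: ps) u e)%R : nat)).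
rewrite (split2 (fun e => (0 < resampled M w ps u e)%R : nat)).
have -> : (\sum_(e < M | (e != Ordinal p1M) && (e != Ordinal p2M))
      (0 < resampled M w (p :: ps) u e)%R =
    \sum_(e < M | (e != Ordinal p1M) && (e != Ordinal p2M))
      (0 < resampled M w ps u e)%R)%N.
  by apply: eq_bigr => e; rewrite -!val_eqE /= => /andP[e1 e2]; rewrite resampled_off.
have [-> ->] := resampled_pair ups; rewrite !resampled_notin // w1 w2 /=.
rewrite /sign_at; case: nth; rewrite subrr mulr0 ltxx ?opprK mulr_gt0 ?addr_gt0 //=; lia.
Qed.

End Resampled.

(** The count is kept twice for want of a conversion: the real copy is compared with the threshold,
    the natural one determines the number of forests. *)
Definition count_pos : prog :=
  num_pos ::= NConst 0 ;; PR real_pos (NConst 0) (RConst 0) ;;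
  PFor 29 var_M
    (PIf (RPos (RGet weight (var 29)))
       (num_pos ::= NSucc (var num_pos) ;;
        PR real_pos (NConst 0) (RAdd (RGet real_pos (NConst 0)) (RConst 1)))
       PSkip).

(** Division by [4 n] through repeated addition. *)
Definition count_trees : prog :=
  num_trees ::= NConst 0 ;; acc ::= NConst 0 ;;
  PFor 30 var_M
    (PIf (NLe (NAdd (var acc) (NAdd (NAdd var_n var_n) (NAdd var_n var_n)))
              (var num_pos))
       (acc ::= NAdd (var acc) (NAdd (NAdd var_n var_n) (NAdd var_n var_n)) ;;
        num_trees ::= NSucc (var num_trees)) PSkip).

(** Once the threshold is reached all marks stay 2, so that the sampling which follows finds no
    hedge to pair and leaves the weights unchanged. *)
Definition prepare : prog :=
  count_pos ;;
  PFor 31 var_M (PN mark (var 31) (NConst 2)) ;;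
  PIf (BNot (RLe (RMul (RMul (RGet real_pos (NConst 0)) (RGet eps_in (NConst 0)))
                       (RGet eps_in (NConst 0)))
                 (RGet threshold (NConst 0))))
    (PFor 31 var_M (PN mark (var 31) (NConst 0)) ;; count_trees ;; pack) PSkip.

Definition sample_hedge : prog :=
  PIf (BAnd (RPos (RGet weight (var 33)))
            (BNot (NLe (NConst 2) (NGet mark (var 33)))))
    (PIf (NLe (var pending) (NConst 0))
       (pending ::= NSucc (var 33))
       (PIf (NLe (NConst 1) (var coin))
          (PR weight (NPred (var pending))
              (RAdd (RGet weight (NPred (var pending)))
                    (RGet weight (NPred (var pending)))) ;;
           PR weight (var 33) (RConst 0))
          (PR weight (var 33)
              (RAdd (RGet weight (var 33)) (RGet weight (var 33))) ;;
           PR weight (NPred (var pending)) (RConst 0)) ;;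
        pending ::= NConst 0))
    PSkip.

(** One coin is flipped per hedge, paired or not, so that every level reads exactly [M] coins and
    the tape splits into rows. *)
Definition sample : prog :=
  pending ::= NConst 0 ;;
  PFor 33 var_M (PFlip coin (NConst 0) ;; sample_hedge).

Definition level : prog := prepare ;; sample.

Section Level.
Variables (R : realType) (n M : nat) (L : seq link).
Hypothesis n_gt0 : (0 < n)%N.
Hypothesis L_ltM : forall l, l \in L -> (l.1.1 < M)%N.
Hypothesis L_ltn : forall l, l \in L -> (l.1.2 < n)%N /\ (l.2 < n)%N.
Hypothesis L_size : (size L <= M * n)%N.
Implicit Types s : state R.

Definition positives s : nat := (\sum_(e < M) (0 < rmem s weight e)%R)%N.

Lemma positives_le s : (positives s <= M)%N.
Proof. by rewrite -[leqRHS]card_ord -sum1_card leq_sum // => e _; exact: leq_b1. Qed.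

Lemma count_posP s : links_loaded n M L s ->
  nmem (sem count_pos s) num_pos 0 = positives s /\
  rmem (sem count_pos s) real_pos 0 = (positives s)%:R.
Proof.
move=> Ls; rewrite /count_pos !sem_seq; set s0 := sem _ (sem _ s).
have [_ s0M _] : links_loaded n M L s0.
  by apply: links_loaded_agree (agree_sem _ _) _ => //; exact: links_loaded_agree (agree_sem _ _) Ls.
pose F e : nat := (0 < rmem s weight e)%R.
have -> : positives s = (\sum_(0 <= e < M) F e)%N by rewrite big_mkord.
apply: (@sem_for _ (fun k s' => nmem s' num_pos 0 = (\sum_(k <= e < M) F e)%N /\
  rmem s' real_pos 0 = (\sum_(k <= e < M) F e)%N%:R)) => //.
  by rewrite (s0M : neval s0 var_M = M) big_geq.
move=> k s'; rewrite (s0M : neval s0 var_M = M) => kM [AN AR _] s'k [IN IR].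
rewrite big_ltn // {1 3}/F !semE [beval _ _]/= /update /= (AR weight) //.
rewrite -[rmem s0 weight k]/(rmem s weight k) -ltNge.
case: ifP => _ /=; rewrite /update /= ?IN ?IR //.
by rewrite addnC natrD addrC.
Qed.

Lemma count_treesP s : links_loaded n M L s -> (nmem s num_pos 0 <= M)%N ->
  nmem (sem count_trees s) num_trees 0 = (nmem s num_pos 0 %/ (4 * n))%N.
Proof.
move=> Ls mM; rewrite /count_trees !sem_seq; set s0 := sem _ (sem _ s).
have [s0n s0M _] : links_loaded n M L s0.
  by apply: links_loaded_agree (agree_sem _ _) _ => //; exact: links_loaded_agree (agree_sem _ _) Ls.
set m := nmem s num_pos 0.
have mM' : (m %/ (4 * n) <= M - 0)%N by rewrite subn0 (leq_trans (leq_div _ _)).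
pose I k s' := nmem s' acc 0 = (4 * n * minn (m %/ (4 * n)) (M - k))%N /\
   nmem s' num_trees 0 = minn (m %/ (4 * n)) (M - k).
rewrite -[RHS](minn_idPl mM'); set p := PFor _ _ _.
suff : I 0%N (sem p s0) by case.
apply: sem_for => //.
  by rewrite /I (s0M : neval s0 var_M = M) subnn minn0 muln0.
move=> k s'; rewrite (s0M : neval s0 var_M = M) => kM [AN AR _] s'k [IA IT].
rewrite /I !semE [beval _ _]/= /update /= !(AN 0%N) // s0n (AN num_pos) // -/m IA.
rewrite -[nmem s0 num_pos 0]/m.
set x := minn _ _.
have -> : (4 * n * x + (n + n + (n + n)) <= m)%N = (x < m %/ (4 * n))%N.
  by rewrite leq_divRL ?muln_gt0 //; congr (_ <= _)%N; lia.
have -> : minn (m %/ (4 * n)) (M - k) = if (x < m %/ (4 * n))%N then x.+1 else x.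
  by rewrite /x; case: ifP; lia.
case: ifP => xm /=; rewrite /update /= ?(AN 0%N) // ?s0n ?IA ?IT -/x // addn1.
by split=> //; rewrite mulnS; lia.
Qed.

Lemma fill_markP (c : nat) s e : nmem s 0 1 = M -> (e < M)%N ->
  nmem (sem (PFor 31 var_M (PN mark (var 31) (NConst c))) s) mark e = c.
Proof.
move=> sM; suff : forall e, (0 <= e)%N -> (e < M)%N ->
    nmem (sem (PFor 31 var_M (PN mark (var 31) (NConst c))) s) mark e = c by apply.
apply: (@sem_for _ (fun k s' => forall e, (k <= e)%N -> (e < M)%N -> nmem s' mark e = c)) => //.
  by rewrite (sM : neval s var_M = M) => u Mu; rewrite ltnNge Mu.
move=> k s' _ _ s'k IH u; rewrite sem_setN /= /update /= leq_eqVlt.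
case/orP => [/eqP ->|ku] uM; first by rewrite eqxx.
by rewrite gtn_eqF //; exact: IH.
Qed.

Definition active s : bool :=
  rmem s threshold 0 < (positives s)%:R * rmem s eps_in 0 * rmem s eps_in 0.

Lemma prepareP s : links_loaded n M L s ->
  if active s then
    exists2 Fs, size Fs = (positives s %/ (4 * n))%N &
      packed n M L (rmem s weight) Fs (sem prepare s)
  else forall e, (e < M)%N -> nmem (sem prepare s) mark e = 2%N.
Proof.
move=> Ls; rewrite /prepare !sem_seq; set s1 := sem count_pos s.
have [c1 r1] := count_posP Ls; rewrite -/s1 in c1 r1.
have A1 : agree count_pos s s1 by exact: agree_sem.
have Ls1 : links_loaded n M L s1 by exact: links_loaded_agree A1 Ls.
set p2 := PFor 31 _ (PN mark _ (NConst 2)); set s2 := sem p2 s1.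
have A2 : agree p2 s1 s2 by exact: agree_sem.
have Ls2 : links_loaded n M L s2 by exact: links_loaded_agree A2 Ls1.
have m2 e : (e < M)%N -> nmem s2 mark e = 2%N.
  by move=> eM; apply: (@fill_markP 2 s1) => //; case: Ls1.
case: A1 => _ AR1 _; case: A2 => AN2 AR2 _.
have r2 : rmem s2 real_pos 0 = (positives s)%:R by rewrite AR2.
have e2 : rmem s2 eps_in 0 = rmem s eps_in 0 by rewrite AR2 // AR1.
have t2 : rmem s2 threshold 0 = rmem s threshold 0 by rewrite AR2 // AR1.
have w2 e : rmem s2 weight e = rmem s weight e by rewrite AR2 // AR1.
have c2 : nmem s2 num_pos 0 = positives s by rewrite AN2.
clearbody s2; rewrite sem_if [beval _ _]/= r2 e2 t2 -ltNge -/(active s).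
case: (active s); last exact: m2.
rewrite 2!sem_seq.
set p3 := PFor 31 _ (PN mark _ (NConst 0)); set s3 := sem p3 s2.
have A3 : agree p3 s2 s3 by exact: agree_sem.
have Ls3 : links_loaded n M L s3 by exact: links_loaded_agree A3 Ls2.
have m3 e : (e < M)%N -> nmem s3 mark e = 0%N.
  by move=> eM; apply: (@fill_markP 0 s2) => //; case: Ls2.
have w3 e : rmem s3 weight e = rmem s weight e by case: A3 => _ -> //.
have c3 : nmem s3 num_pos 0 = positives s by case: A3 => -> //.
clearbody s3; set s4 := sem count_trees s3.
have A4 : agree count_trees s3 s4 by exact: agree_sem.
have Ls4 : links_loaded n M L s4 by exact: links_loaded_agree A4 Ls3.
have posM := positives_le s.
have t4 : nmem s4 num_trees 0 = (positives s %/ (4 * n))%N.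
  by rewrite -c3; apply: count_treesP => //; rewrite c3.
have m4 e : (e < M)%N -> nmem s4 mark e = 0%N by move=> eM; case: A4 => -> // _ _; exact: m3.
have w4 e : rmem s4 weight e = rmem s weight e by case: A4 => _ -> //.
clearbody s4.
have [||Fs sFs PFs] := @packP R n M L n_gt0 L_ltM L_ltn L_size (rmem s weight) s4 Ls4 w4.
- by rewrite t4 (leq_trans (leq_div _ _)).
- by split=> // e eM; rewrite m4.
by exists Fs; first by rewrite sFs t4.
Qed.

Definition unpacked s (e : nat) : bool :=
  (0 < rmem s weight e) && (nmem s mark e < 2)%N.

Lemma sampleP s row rest : nmem s 0 1 = M -> size row = M ->
  coins s = row ++ rest ->
  coins (sem sample s) = rest /\
  forall e, rmem (sem sample s) weight e =
    resampled M (rmem s weight) (pair_up (unpacked s) M M).1 row e.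
Proof.
move=> sM rowM sc; pose w := rmem s weight; set el := unpacked s.
pose I k s' := [/\ coins s' = drop (M - k) (row ++ rest),
  nmem s' pending 0 = (pair_up el M (M - k)).2 &
  forall e, rmem s' weight e = resampled M w (pair_up el M (M - k)).1 row e].
suff : I 0%N (sem sample s).
  by rewrite /I subn0 drop_size_cat // => -[].
rewrite /sample sem_seq; set s0 := sem _ s.
have s0M : nmem s0 0 1 = M by rewrite -sM.
apply: sem_for => //.
  rewrite (s0M : neval s0 var_M = M) /I subnn drop0; split=> //= e.
  by rewrite resampled_nil.
move=> k s'; rewrite (s0M : neval s0 var_M = M) => kM [AN _ _] s'k [Ic Ip Iw].
have mk : nmem s' mark k = nmem s mark k by rewrite AN.
have dM : (M - k.+1 <= M)%N by exact: leq_subr.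
have Mk : (M - k = (M - k.+1).+1)%N by lia.
have Mk' : (M - (M - k.+1).+1 = k)%N by lia.
have := pair_upP el dM; move: Ip Iw; rewrite /I Mk /= Mk'.
have ck : head false (coins s') = nth false row (M.-1 - k).
  rewrite Ic -nth0 nth_drop addn0 nth_cat rowM; have -> : (M - k.+1 < M)%N by lia.
  by congr nth; lia.
have Ic' : behead (coins s') = drop (M - k.+1).+1 (row ++ rest).
  by rewrite Ic -drop1 drop_drop add1n.
case: (pair_up _ _ _) => [ps q] /= Ip Iw [ups mem sz].
have kN : k \notin (if q is j.+1 then [:: j] else [::]) ++ members ps.
  by apply/negP => /mem[]; lia.
have kps : k \notin members ps by apply: contraNN kN => h; rewrite mem_cat h orbT.
have wk : rmem s' weight k = w k by rewrite Iw resampled_notin.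
rewrite /sample_hedge !semE [beval _ _]/= /update /= wk mk -!ltNge -ltnNge -/w.
rewrite -/(unpacked s k) -/el; case: ifP => elk; last by split.
rewrite /update /= Ip leqn0 ck.
case: q ups mem sz kN Ip => [|j] ups mem sz kN Ip /=.
  by split=> //=; rewrite /update /= ?addn1.
have jk : (j == k) = false.
  by apply/negbTE; apply: contraNneq kN => ->; rewrite mem_head.
have jps : j \notin members ps by move: ups => /= /andP[].
have wj : rmem s' weight j = w j by rewrite Iw resampled_notin.
have uc : uniq (members ((j, k) :: ps)).
  rewrite /members /= mem_cat inE jk /= -mem_cat jps /=.
  by rewrite -cat1s uniq_catCA /= kps; move: ups => /= /andP[].
have [rj rk] := resampled_pair M w row uc; rewrite /= in rj rk.
split.
- by case: (nth _ _ _).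
- by case: (nth _ _ _).
move=> e; have [->|ej] := eqVneq e j.
  rewrite rj /sign_at subn1; case: (nth _ _ _); rewrite /= ?eqxx ?jk ?wj /=; ring.
have [->|ek] := eqVneq e k.
  rewrite rk /sign_at subn1; case: (nth _ _ _); rewrite /= ?eqxx ?[k == j]eq_sym ?jk /=; ring.
rewrite resampled_off // -Iw subn1; case: (nth _ _ _);
  by rewrite /= (negbTE ej) (negbTE ek).
Qed.

(** The pairs are determined before any coin is read, hence one [ps] serves all rows; the
    concentration bound requires this. The final 1 is for a hedge left without a partner. *)
Lemma levelP s : links_loaded n M L s ->
  exists ps,
    (forall row rest, size row = M ->
       coins (sem level (set_coins (row ++ rest) s)) = rest /\
       forall e, rmem (sem level (set_coins (row ++ rest) s)) weight e =
         resampled M (rmem s weight) ps row e) /\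
    if active s then
      exists Fs, [/\ forest_packing L (rmem s weight) Fs,
        good_pairs M (rmem s weight) Fs ps,
        size Fs = (positives s %/ (4 * n))%N &
        (positives s <= n * size Fs + 2 * size ps + 1)%N]
    else ps = [::].
Proof.
move=> Ls; set s1 := sem prepare s.
have A1 : agree prepare s s1 by exact: agree_sem.
have [_ s1M _] : links_loaded n M L s1 by exact: links_loaded_agree A1 Ls.
have w1 e : rmem s1 weight e = rmem s weight e by case: A1 => _ -> //.
have := pair_upP (unpacked s1) (leqnn M).
set pu := pair_up _ _ _; move=> puP; exists pu.1; split=> [row rest rowM|].
  have -> : sem level (set_coins (row ++ rest) s) =
      sem sample (set_coins (row ++ rest) s1).
    by rewrite /level sem_seq sem_set_coins.
  have [-> wE] := @sampleP (set_coins (row ++ rest) s1) row rest s1M rowM erefl.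
  by split=> // e; rewrite wE /resampled -[rmem (set_coins _ _) _ _]/(rmem s1 weight e) w1.
have := prepareP Ls; rewrite -/s1; case: (active s); last first.
  move=> m2; move: puP; case: pu => [ps q] [_ _ sz] /=.
  move: sz; rewrite subnn big_mkord big1 => [|e _]; first by case: ps.
  by rewrite /unpacked m2 // ltnn andbF.
case=> Fs sFs PFs; exists Fs.
have [FP el] := packed_forest_packing L_ltM PFs.
have szP := packed_size L_ltM PFs.
move: puP; case: pu => [ps q] /=; set rest := (if q is j.+1 then [:: j] else [::]).
move=> [u mem sz]; split=> //.
  split; first by move: u; rewrite cat_uniq => /and3P[].
  move=> e eps; have [|_ eM] := mem e; first by rewrite mem_cat eps orbT.
  rewrite /unpacked w1 => /andP[we me]; split=> //; rewrite el // we /=.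
  by rewrite neq_ltn me.
have : (size rest <= 1)%N by rewrite /rest; case: (q).
have : (positives s <= \sum_(e < M) ((0 < rmem s weight e)%R && (nmem s1 mark e == 2)) +
   \sum_(M - M <= e < M) unpacked s1 e)%N.
  rewrite subnn big_mkord -big_split /=; apply: leq_sum => e _.
  case: PFs => _ _ /(_ e (ltn_ord e))[me _] _ _; rewrite /unpacked w1.
  by move: me; case: (0 < _) => //; case: (nmem s1 mark e) => [|[|[|]]].
by rewrite -sz; lia.
Qed.

End Level.

(** * All levels *)

Lemma loop_set_coins (R : realType) (a b : nat) (i : nexp) (p : prog) (k : nat)
    (s : state R) (c v : seq bool) : ~~ flips p -> size c = k ->
  loop a (sem (PFlip b i ;; p)) k (set_coins (c ++ v) s) =
  set_coins v (loop a (sem (PFlip b i ;; p)) k (set_coins c s)).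
Proof.
move=> pf; elim: k c s => [|k IH] [|x c] s //= [ck].
pose s1 : state R := State (update (nmem (set_nat a 0 k s)) b
  (neval (set_nat a 0 k s) i) x) (rmem s) [::].
have stepE d : sem (PFlip b i ;; p) (set_nat a 0 k (set_coins (x :: d) s)) =
    set_coins d (sem p s1).
  rewrite -sem_set_coins // sem_seq; congr (sem p _).
  rewrite sem_flip /s1 -[set_nat a 0 k (set_coins _ s)]/(set_coins (x :: d) (set_nat a 0 k s)).
  by rewrite neval_set_coins.
by rewrite !stepE IH.
Qed.

Lemma level_set_coins (R : realType) (M : nat) (s : state R) (row v : seq bool) :
  nmem s 0 1 = M -> size row = M ->
  sem level (set_coins (row ++ v) s) = set_coins v (sem level (set_coins row s)).
Proof.
move=> sM rowM; rewrite /level !(sem_seq prepare).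
rewrite !(sem_set_coins _ _ (isT : ~~ flips prepare)).
set s1 := sem prepare s.
have s1M : nmem s1 0 1 = M by rewrite /s1 sem_nmem.
rewrite /sample !(sem_seq (pending ::= NConst 0)).
rewrite !(sem_set_coins _ _ (isT : ~~ flips (pending ::= NConst 0))).
set s2 := sem _ s1; have s2M : size row = nmem s2 0 1 by rewrite rowM -s1M.
exact: (@loop_set_coins R 33 coin (NConst 0) sample_hedge (nmem s2 0 1)
  (set_nat 33 0 (nmem s2 0 1) s2) row v isT s2M).
Qed.

(** At most [5 m / 8 + 1 / 2] weights survive; [16/25] exceeds [5/8] enough to absorb the [1/2], and
    being the square of [4/5] it keeps the constants around [thr] integral. *)
Lemma shrink_bound (n m m' p b : nat) : (1 < n)%N -> (m' + p = m)%N ->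
  (m <= b + 2 * p + 1)%N -> (4 * b <= m)%N -> (100 * n <= m)%N ->
  (25 * m' <= 16 * m)%N.
Proof. lia. Qed.

Lemma shrink_pow (m m' x y : nat) : (25 * m' <= 16 * m)%N ->
  (m * (16 * x) <= 25 * y)%N -> (m' * x <= y)%N.
Proof. by move=> /leq_mul/(_ (leqnn x)); lia. Qed.

Section Levels.
Variables (R : realType) (n' M : nat) (L : seq link) (A l : nat) (eps : R).
Local Notation n := n'.+1.
Variable cap0 : {ffun 'I_n -> 'I_n} -> R.
Implicit Types s : state R.

Hypothesis n_gt1 : (1 < n)%N.
Hypothesis L_ltM : forall k, k \in L -> (k.1.1 < M)%N.
Hypothesis L_ltn : forall k, k \in L -> (k.1.2 < n)%N /\ (k.2 < n)%N.
Hypothesis L_size : (size L <= M * n)%N.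
Hypothesis A_ge5 : (5 <= A)%N.
Hypothesis n_le_exp : (n <= 2 ^ l)%N.
Hypotheses (eps_gt0 : 0 < eps) (eps_lt1 : eps < 1).
Hypothesis cap0_ge0 : forall f, 0 <= cap0 f.

(** In units of [A^2 n l] the constants close up: [d^2 m <= 256^2] and a level error with
    [a^2 m <= 32^2] give [(d + 2 a)^2 m <= 5/4 * 256^2 + 20 * 32^2 = 320^2], and shrinking [m] by
    [16/25] returns to [256^2]. As an active level has [m eps^2] above [thr], the new error
    [d + 2 a] is at most [eps]. *)
Definition thr : R := (320 * A%:R) ^+ 2 * (n%:R * l%:R).

(* A level adds at most [2 a] to the relative error [d], where [a ^+ 2] times the
   number of positive weights is bounded; the latter shrinks by 16/25 per level,
   so the errors form a geometric series dominated by the last one. *)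
Definition accurate s : Prop :=
  exists d : R, [/\ 0 <= d, d <= eps,
    d ^+ 2 * (positives M s)%:R <= (256 * A%:R) ^+ 2 * (n%:R * l%:R) &
    forall f, (1 - d) * cap0 f <= link_capacity M L (rmem s weight) f
                <= (1 + d) * cap0 f].

(** Here [r] is the number of levels still to run. At [r = 0] an active state would have at most one
    positive weight, which is impossible since [eps < 1] and [thr >= 1]; so the final state is below
    the threshold. *)
Record invariant (r : nat) s : Prop := Invariant {
  inv_links : links_loaded n M L s;
  inv_thr : rmem s threshold 0 = thr;
  inv_eps : rmem s eps_in 0 = eps;
  inv_ge0 : forall e, (e < M)%N -> 0 <= rmem s weight e;
  inv_acc : accurate s;
  inv_pos : active M s -> (positives M s * 16 ^ r <= 25 ^ r)%N }.

(** This is [4 n^4 * expR (- kappa) * (m / t)] estimated with [kappa = A l] and [m <= 8 n t]. *)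
Definition failure : R := 32 * n%:R ^+ 5 / n%:R ^+ A.

Lemma expRN_log_le : expR (- (A%:R * l%:R)) <= (n%:R ^+ A)^-1 :> R.
Proof.
rewrite expRN lef_pV2 ?posrE ?expR_gt0 ?exprn_gt0 ?ltr0n //.
rewrite expRM_natl lerXn2r ?nnegrE ?expR_ge0 //.
apply: (@le_trans _ _ (2 ^+ l)); first by rewrite -natrX ler_nat.
rewrite -[l%:R]mulr1 expRM_natl lerXn2r ?nnegrE ?expR_ge0 //.
by have := expR_ge1Dx (1 : R); lra.
Qed.

Lemma l_gt0 : (0 < l)%N.
Proof. by rewrite lt0n; apply/eqP => l0; move: n_le_exp; rewrite l0; lia. Qed.

Lemma thr_ge : 100 * n%:R <= thr.
Proof.
have A1 : 1 <= A%:R :> R by rewrite ler1n (leq_trans _ A_ge5).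
have l1 : 1 <= l%:R :> R by rewrite ler1n l_gt0.
apply: ler_pM => //; last by rewrite ler_peMr.
by have := mulr_ge0 (le_trans ler01 A1) (le_trans ler01 A1); nra.
Qed.

Section Active.
Variable s : state R.
Hypothesis s_thr : thr < (positives M s)%:R * eps * eps.
Local Notation m := (positives M s).
Let t := (m %/ (4 * n))%N.
(** The solution of [eta^2 t / 32 = A l], which makes [expR (- kappa)] at most [n^-A]. *)
Let eta : R := Num.sqrt (32 * (A%:R * l%:R) / t%:R).

Lemma thr_lt_pos : thr < m%:R.
Proof.
apply: lt_le_trans s_thr _; rewrite -mulrA ler_piMr //.
by rewrite mulr_ile1 ?ltW.
Qed.

Lemma pos_ge : (100 * n <= m)%N.
Proof.
by rewrite -(ler_nat R) natrM ltW // (le_lt_trans thr_ge) // thr_lt_pos.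
Qed.

Lemma trees_gt0 : (0 < t)%N.
Proof. by rewrite divn_gt0 //; have := pos_ge; lia. Qed.

Lemma pos_le_trees : (m <= 8 * n * t)%N.
Proof.
have := divn_eq m (4 * n); have : (m %% (4 * n) < 4 * n)%N by rewrite ltn_mod; lia.
rewrite -/t; have := trees_gt0; nia.
Qed.

Lemma eta_gt0 : 0 < eta.
Proof.
rewrite sqrtr_gt0 divr_gt0 ?ltr0n ?trees_gt0 // mulr_gt0 //.
by rewrite mulr_gt0 ?ltr0n ?l_gt0 //; lia.
Qed.

Lemma eta2_trees : eta ^+ 2 * t%:R = 32 * (A%:R * l%:R).
Proof.
have t0 : t%:R != 0 :> R by rewrite pnatr_eq0 -lt0n trees_gt0.
rewrite sqr_sqrtr ?divfK // divr_ge0 //.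
by rewrite mulr_ge0 // mulr_ge0.
Qed.

Lemma eta2_pos_le : (2 * eta) ^+ 2 * m%:R <= (32 * A%:R) ^+ 2 * (n%:R * l%:R).
Proof.
apply: (@le_trans _ _ ((2 * eta) ^+ 2 * (8 * n%:R * t%:R))).
  by rewrite ler_wpM2l ?sqr_ge0 // -!natrM ler_nat pos_le_trees.
rewrite exprMn (_ : _ * _ = 32 * n%:R * (eta ^+ 2 * t%:R)); last by ring.
rewrite eta2_trees.
have A1 : A%:R <= A%:R ^+ 2 :> R by rewrite ler_eXnr // ler1n; lia.
have nl : 0 <= n%:R * l%:R :> R by rewrite mulr_ge0.
have := ler_wpM2r nl A1; nra.
Qed.

End Active.

(** The bad rows are defined from weights and pairs that are fixed before the row is read; an
    inactive level is exact and has none. *)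
Lemma level_step r s row0 : invariant r.+1 s ->
  exists bad : seq bool -> bool, mean M (fun row => (bad row)%:R) <= failure /\
    forall row, size row = M -> ~~ bad row ->
      invariant r (sem level (set_coins (row ++ row0) s)).
Proof.
case=> Ls sthr seps w0 [d [d0 deps dm dacc]] pos.
have fail0 : 0 <= failure by rewrite divr_ge0 ?mulr_ge0 ?exprn_ge0.
have [ps [psE psA]] := levelP (ltnW n_gt1) L_ltM L_ltn L_size Ls.
have frame row : [/\ links_loaded n M L (sem level (set_coins (row ++ row0) s)),
    rmem (sem level (set_coins (row ++ row0) s)) threshold 0 = thr &
    rmem (sem level (set_coins (row ++ row0) s)) eps_in 0 = eps].
  have A1 := agree_sem level (set_coins (row ++ row0) s).
  split; first by apply: links_loaded_agree A1 _.
    by case: A1 => _ -> //.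
  by case: A1 => _ -> //.
case: (boolP (active M s)) psA => [act|inact] psA; last first.
  exists (fun=> false); split=> [|row rowM _]; first by rewrite mean_const.
  have [s'L s'thr s'eps] := frame row; have [_] := psE row row0 rowM.
  set s' := sem level _ => wE; rewrite psA in wE.
  have {}wE e : rmem s' weight e = rmem s weight e by rewrite wE resampled_nil.
  have posE : positives M s' = positives M s.
    by apply: eq_bigr => e _; rewrite wE.
  split=> //.
  - by move=> e eM; rewrite wE; exact: w0.
  - exists d; split=> // [|f]; first by rewrite posE.
    by rewrite /link_capacity; under eq_bigr => e _ do rewrite wE; exact: dacc.
  by rewrite /active posE s'thr s'eps -sthr -seps -/(active M s) (negbTE inact).
move: (act); rewrite /active sthr seps => s_thr.
case: psA => Fs [FP PP sFs posle].
set m := positives M s in pos dm s_thr sFs posle *.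
have t0 : (0 < size Fs)%N by rewrite sFs; exact: trees_gt0 s_thr.
pose eta : R := Num.sqrt (32 * (A%:R * l%:R) / (m %/ (4 * n))%N%:R).
have eta0 : 0 < eta by exact: eta_gt0.
have kappaE : eta ^+ 2 * (size Fs)%:R / 32 = A%:R * l%:R.
  by rewrite sFs eta2_trees // mulrC mulKf ?pnatr_eq0.
have A1 : 1 <= A%:R :> R by rewrite ler1n (leq_trans _ A_ge5).
have l1 : 1 <= l%:R :> R by rewrite ler1n l_gt0.
have np : 0 < n%:R :> R by rewrite ltr0n.
(* [A >= 5] leaves a factor [1 / n], and [n >= 2]. *)
have kap : (n ^ 4)%:R * expR (- (A%:R * l%:R)) <= 1 / 2 :> R.
  apply: (@le_trans _ _ (n%:R ^+ 4 * (n%:R ^+ 5)^-1)).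
    rewrite natrX ler_wpM2l ?exprn_ge0 //; apply: le_trans expRN_log_le _.
    by rewrite lef_pV2 ?posrE ?exprn_gt0 // ler_weXn2l // ler1n.
  have cancel5 (N : R) : 0 < N -> N ^+ 4 * (N ^+ 5)^-1 = N^-1.
    by move=> N0; field; exact: lt0r_neq0.
  rewrite cancel5 // div1r.
  by rewrite lef_pV2 ?posrE // ler_nat.
exists (fun row => ~~ [forall f : {ffun 'I_n -> 'I_n},
    `|link_capacity M L (resampled M (rmem s weight) ps row) f -
    link_capacity M L (rmem s weight) f| <= 2 * eta * link_capacity M L (rmem s weight) f]).
split.
  have := mean_resampled_le (n' := n') L_ltM FP PP w0 eta0 t0.
  rewrite kappaE => /(_ _ kap) /le_trans; apply.
    by have := ler_pM ler01 ler01 A1 l1; rewrite mulr1.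
  rewrite -/(positives M s) -/m sFs /failure.
  apply: (@le_trans _ _ (4 * n%:R ^+ 4 * (n%:R ^+ A)^-1 * (8 * n%:R))); last first.
    by rewrite exprS le_eqVlt; apply/orP; left; apply/eqP; ring.
  apply: ler_pM.
  - by rewrite !mulr_ge0 ?expR_ge0.
  - by rewrite divr_ge0.
  - by rewrite natrX ler_wpM2l ?mulr_ge0 ?exprn_ge0 // expRN_log_le.
  rewrite ler_pdivrMr ?ltr0n ?trees_gt0 // -!natrM ler_nat.
  exact: pos_le_trees.
move=> row rowM; rewrite negbK => /forallP good.
have [s'L s'thr s'eps] := frame row; have [_] := psE row row0 rowM.
set s' := sem level _ => wE.
have [ups psM] := PP.
have card : (positives M s' + size ps = m)%N.
  rewrite /m {2}/positives -(@card_resampled R M (rmem s weight) row ps ups); last first.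
    by move=> e /psM[eM /andP[we _]].
  by congr (_ + _)%N; apply: eq_bigr => e _; rewrite wE.
have m'le : (25 * positives M s' <= 16 * m)%N.
  apply: shrink_bound n_gt1 card posle _ (pos_ge s_thr).
  by rewrite sFs mulnA mulnC leq_trunc_div.
pose a : R := 2 * eta.
have a0 : 0 <= a by rewrite mulr_ge0 ?ltW.
have am : a ^+ 2 * m%:R <= (32 * A%:R) ^+ 2 * (n%:R * l%:R) by exact: eta2_pos_le.
have {}good (f : {ffun 'I_n -> 'I_n}) : `|link_capacity M L (resampled M (rmem s weight) ps row) f -
    link_capacity M L (rmem s weight) f| <= a * link_capacity M L (rmem s weight) f.
  exact: good.
clearbody a.
have mp : 0 < m%:R :> R by apply: le_lt_trans (thr_lt_pos s_thr); rewrite /thr !mulr_ge0.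
(* The difference of the two sides is [(d / 2 - 4 a)^2]; the factor [5/4] stays below the gain
   [25/16] of a level. *)
have dan : (d + 2 * a) ^+ 2 <= 5 / 4 * d ^+ 2 + 20 * a ^+ 2.
  by have := sqr_ge0 (d / 2 - 4 * a); lra.
have dam : (d + 2 * a) ^+ 2 * m%:R <= thr.
  have := ler_wpM2r (ltW mp) dan; rewrite /thr; lra.
have da0 : 0 <= d + 2 * a by rewrite addr_ge0 // mulr_ge0.
have da_eps : d + 2 * a <= eps.
  rewrite -ler_sqr ?nnegrE ?(ltW eps_gt0) //.
  rewrite -(ler_pM2r mp); apply: le_trans dam (ltW _).
  by apply: lt_le_trans s_thr _; rewrite -mulrA mulrC expr2.
split=> //.
- by move=> e eM; rewrite wE resampled_ge0 // w0.
- exists (d + 2 * a); split=> //.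
    have m'R : 25 * (positives M s')%:R <= 16 * m%:R :> R by rewrite -!natrM ler_nat.
    have := ler_wpM2l (sqr_ge0 (d + 2 * a)) m'R.
    by move: dam; rewrite /thr; lra.
  move=> f; have := good f; rewrite ler_norml.
  have -> : link_capacity M L (rmem s' weight) f =
      link_capacity M L (resampled M (rmem s weight) ps row) f.
    by apply: eq_bigr => e _; rewrite wE.
  have /andP[dl du] := dacc f; have c0 := cap0_ge0 f.
  set c := link_capacity M L (rmem s weight) f in dl du *.
  set c' := link_capacity _ _ _ _ => /andP[lo hi].
  (* Relative errors compose as [(1 + a) (1 + d) <= 1 + d + 2 a] since [d <= 1]; for the lower
     bound, [a <= 1] allows multiplying by [1 - a]. *)
  have a1 : a <= 1 by apply: le_trans (le_trans da_eps (ltW eps_lt1)); lra.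
  have ac0 : 0 <= a * cap0 f by rewrite mulr_ge0.
  have dac0 : 0 <= a * cap0 f * d by rewrite mulr_ge0.
  have h1 : 0 <= (1 - a) * (c - (1 - d) * cap0 f) by rewrite mulr_ge0 // subr_ge0.
  have h2 : 0 <= (1 + a) * ((1 + d) * cap0 f - c) by apply: mulr_ge0; [rewrite addr_ge0|rewrite subr_ge0].
  have h3 : 0 <= a * cap0 f * (1 - d) by rewrite mulr_ge0 // subr_ge0 (le_trans deps (ltW eps_lt1)).
  by apply/andP; split; lra.
move=> _; apply: shrink_pow m'le _; have := pos act; by rewrite !expnS.
Qed.

Lemma failure_ge0 : 0 <= failure.
Proof. by rewrite divr_ge0 ?mulr_ge0 ?exprn_ge0. Qed.

(** Union bound over the levels, conditioning on the first row each time; the [T] further coins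
    allow for a tape longer than what the levels read. *)
Lemma mean_levels_le (accepts : pred (state R)) :
  (forall s, invariant 0 s -> accepts s) ->
  forall r T s, invariant r s ->
  mean (r * M + T) (fun u =>
      (~~ accepts (loop 34 (sem level) r (set_coins u s)))%:R)
    <= r%:R * failure.
Proof.
move=> accP; elim=> [|r IH] T s inv.
  rewrite mul0r -[leRHS](mean_const (0 * M + T)); apply: le_mean => u _ /=.
  by rewrite accP //; case: inv.
rewrite mulSn -addnA mean_cat -natr1 mulrDl mul1r addrC.
pose s1 := set_nat 34 0 r s.
have inv1 : invariant r.+1 s1 by case: inv.
have s1M : nmem s1 0 1 = M by case: inv1 => -[].
have [bad [mbad badP]] := level_step [::] inv1.
apply: (@le_trans _ _ (mean M (fun row => (bad row)%:R + r%:R * failure))).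
  apply: le_mean => row rowM.
  have fail0 : 0 <= r%:R * failure by rewrite mulr_ge0 ?failure_ge0.
  case: (boolP (bad row)) => [_|good].
    rewrite -[leLHS]addr0 lerD // -[leRHS](mean_const (r * M + T)).
    by apply: le_mean => v _; case: (~~ _).
  rewrite add0r; have := badP row rowM good; rewrite cats0 => inv2.
  apply: le_trans (IH T _ inv2); apply: le_mean => v _ /=.
  rewrite -[set_nat 34 0 r (set_coins _ s)]/(set_coins (row ++ v) s1).
  by rewrite (level_set_coins v s1M rowM).
by rewrite meanD mean_const lerD2r.
Qed.

End Levels.

(** * Reading the input *)

(* [in_pos] points at the last cell of the input that has been read. *)
Definition parse_vertex : prog :=
  in_pos ::= NSucc (var in_pos) ;;
  PN lk_hedge (var lk_end) (var cur_hedge) ;;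
  PN lk_src (var lk_end) (var cur_src) ;;
  PN lk_dst (var lk_end) (NGet 0 (var in_pos)) ;;
  lk_end ::= NSucc (var lk_end).

Definition parse_hyperedge : prog :=
  in_pos ::= NSucc (var in_pos) ;;
  cur_src ::= NGet 0 (NSucc (var in_pos)) ;;
  PFor 37 (NGet 0 (var in_pos)) parse_vertex.

Definition parse_hedge : prog :=
  in_pos ::= NSucc (var in_pos) ;;
  PFor 36 (NGet 0 (var in_pos)) parse_hyperedge ;;
  cur_hedge ::= NSucc (var cur_hedge).

Definition parse : prog := in_pos ::= NConst 1 ;; PFor 35 var_M parse_hedge.

Definition encode_sets (d : seq (seq nat)) : seq nat :=
  size d :: flatten [seq size h :: h | h <- d].

(** Each hyperedge becomes a star at its first vertex: a partition crosses it iff some link of the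
    star is split. The loop at the centre is never split and keeps the number of links equal to the
    number of vertices. *)
Definition hedge_links (e : nat) (d : seq (seq nat)) : seq link :=
  flatten [seq [seq (e, head 0 h, v)%N | v <- h] | h <- d].

Fixpoint all_links (e : nat) (ds : seq (seq (seq nat))) : seq link :=
  if ds is d :: ds' then hedge_links e d ++ all_links e.+1 ds' else [::].

Section Parse.
Variables (R : realType) (enc : seq nat).
Implicit Types s : state R.

Definition parsing s (p : nat) (L : seq link) (e : nat) : Prop :=
  [/\ forall i, nmem s 0 i = nth 0%N enc i,
      nmem s in_pos 0 = p, nmem s lk_end 0 = size L, nmem s cur_hedge 0 = e &
      forall k, nth (0, 0, 0)%N L k =
        (nmem s lk_hedge k, nmem s lk_src k, nmem s lk_dst k)].

Lemma parse_vertexP s p L e v post : parsing s p L e ->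
  drop p.+1 enc = v :: post ->
  parsing (sem parse_vertex s) p.+1 (rcons L (e, nmem s cur_src 0, v)) e /\
  nmem (sem parse_vertex s) cur_src 0 = nmem s cur_src 0.
Proof.
move=> [s0 sp sL se sl] dE; rewrite /parse_vertex !semE.
split; last by rewrite /= /update.
split.
- by move=> i; rewrite /= /update /= s0.
- by rewrite /= /update /= sp addn1.
- by rewrite /= /update /= sL addn1 size_rcons.
- by rewrite /= /update /=.
move=> k; rewrite nth_rcons /= /update /= sL sp addn1 s0 se.
have -> : nth 0%N enc p.+1 = v.
  by rewrite -[p.+1]addn0 -nth_drop dE.
case: (ltngtP k (size L)) => kL /=; [exact: sl|by rewrite -sl nth_default // ltnW|by []].
Qed.

Lemma parse_verticesP vs s p L e post : parsing s p L e ->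
  drop p.+1 enc = vs ++ post ->
  parsing (loop 37 (sem parse_vertex) (size vs) s) (p + size vs)
    (L ++ [seq (e, nmem s cur_src 0, v) | v <- vs]) e.
Proof.
elim: vs s p L => [|v vs IH] s p L P dE /=; first by rewrite addn0 cats0.
have [P1 E1] := @parse_vertexP (set_nat 37 0 (size vs) s) _ _ _ _ _ P dE.
have := IH _ _ _ P1; rewrite E1 addSnnS -cat_rcons; apply.
by rewrite -[p.+2]add1n -drop_drop dE /= drop0.
Qed.

Lemma parse_hyperedgeP h s p L e post : parsing s p L e ->
  drop p.+1 enc = (size h :: h) ++ post ->
  parsing (sem parse_hyperedge s) (p + size (size h :: h))
    (L ++ [seq (e, head 0%N h, v) | v <- h]) e.
Proof.
move=> [s0 sp sL se sl] dE; rewrite /parse_hyperedge !sem_seq.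
set s1 := sem (_ ::= _) s; set s2 := sem (_ ::= _) s1.
have sz : nth 0%N enc p.+1 = size h by rewrite -[p.+1]addn0 -nth_drop dE.
have d2 : drop p.+2 enc = h ++ post by rewrite -[p.+2]add1n -drop_drop dE /= drop0.
have P2 : parsing s2 p.+1 L e.
  rewrite /s2 /s1 !sem_setN; split => //.
  by rewrite /= /update /= sp addn1.
have src : nmem s2 cur_src 0 = nth 0%N enc p.+2.
  by rewrite /s2 /s1 !sem_setN /= /update /= sp !addn1 s0.
have bnd : neval s2 (NGet 0 (var in_pos)) = size h.
  by case: P2 => e0 e1 _ _ _; rewrite -[LHS]/(nmem s2 0 (nmem s2 in_pos 0)) e1 e0.
rewrite sem_forE bnd; have := @parse_verticesP h (set_nat 37 0 (size h) s2) _ _ _ _ P2 d2.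
rewrite addSnnS -[nmem (set_nat _ _ _ _) _ _]/(nmem s2 cur_src 0) src.
(* For an empty hyperedge the cell read as the centre is unrelated to it, but no link is
   produced. *)
suff -> : [seq (e, nth 0%N enc p.+2, v) | v <- h] = [seq (e, head 0%N h, v) | v <- h] by [].
by case: h {sz bnd dE} d2 => // x h d2; rewrite -[p.+2]addn0 -nth_drop d2.
Qed.

Lemma parse_hyperedgesP d s p L e post : parsing s p L e ->
  drop p.+1 enc = flatten [seq size h :: h | h <- d] ++ post ->
  parsing (loop 36 (sem parse_hyperedge) (size d) s)
    (p + size (flatten [seq size h :: h | h <- d])) (L ++ hedge_links e d) e.
Proof.
elim: d s p L => [|h d IH] s p L P dE; first by rewrite addn0 cats0.
rewrite [flatten _]/= -cat_cons -catA in dE.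
have P1 := @parse_hyperedgeP h (set_nat 36 0 (size d) s) _ _ _ _ P dE.
have := IH _ _ _ P1; rewrite -catA -addnA -size_cat /=; apply.
have -> : ((p + (size h).+1).+1 = (size h).+1 + p.+1)%N by lia.
by rewrite -drop_drop dE drop_size_cat.
Qed.

Lemma parse_hedgeP d s p L e post : parsing s p L e ->
  drop p.+1 enc = encode_sets d ++ post ->
  parsing (sem parse_hedge s) (p + size (encode_sets d))
    (L ++ hedge_links e d) e.+1.
Proof.
move=> [s0 sp sL se sl] dE; rewrite /parse_hedge !sem_seq.
set s1 := sem (_ ::= _) s.
have P1 : parsing s1 p.+1 L e.
  rewrite /s1 !sem_setN; split => //.
  by rewrite /= /update /= sp addn1.
have sz : nth 0%N enc p.+1 = size d by rewrite -[p.+1]addn0 -nth_drop dE.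
have bnd : neval s1 (NGet 0 (var in_pos)) = size d.
  by case: P1 => e0 e1 _ _ _; rewrite -[LHS]/(nmem s1 0 (nmem s1 in_pos 0)) e1 e0.
have d1 : drop p.+2 enc = flatten [seq size h :: h | h <- d] ++ post.
  by rewrite -[p.+2]add1n -drop_drop dE /= drop0.
rewrite sem_forE bnd.
have := @parse_hyperedgesP d (set_nat 36 0 (size d) s1) _ _ _ _ P1 d1.
rewrite addSnnS; set s2 := loop _ _ _ _ => -[t0 tp tL te tl].
rewrite sem_setN; split=> //.
by rewrite /= /update /= te addn1.
Qed.

Lemma parse_hedgesP ds s p L e : parsing s p L e ->
  drop p.+1 enc = flatten [seq encode_sets d | d <- ds] ->
  exists p', parsing (loop 35 (sem parse_hedge) (size ds) s) p'
    (L ++ all_links e ds) (e + size ds).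
Proof.
elim: ds s p L e => [|d ds IH] s p L e P dE.
  by exists p; rewrite cats0 addn0.
have P1 := @parse_hedgeP d (set_nat 35 0 (size ds) s) _ _ _ _ P dE.
have [|p' P'] := IH _ _ _ _ P1; last first.
  by exists p'; move: P'; rewrite -catA addSnnS.
have -> : ((p + size (encode_sets d)).+1 = size (encode_sets d) + p.+1)%N by lia.
by rewrite -drop_drop dE drop_size_cat.
Qed.

End Parse.

Lemma parseP (R : realType) (s : state R) n ds :
  let enc := [:: n, size ds & flatten [seq encode_sets d | d <- ds]] in
  (forall i, nmem s 0 i = nth 0%N enc i) ->
  (forall a i, a != 0%N -> nmem s a i = 0%N) ->
  links_loaded n (size ds) (all_links 0 ds) (sem parse s).
Proof.
move=> enc s0 sz; rewrite /parse sem_seq; set s1 := sem _ s.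
have P1 : parsing enc (set_nat 35 0 (size ds) s1) 1 [::] 0.
  rewrite /s1 sem_setN; split; rewrite /= /update /= ?sz // => k.
  by rewrite nth_nil /= !sz.
have bnd : neval s1 var_M = size ds by rewrite -[LHS]/(nmem s 0 1) s0.
have [|p' [q0 _ _ _ ql]] := parse_hedgesP P1 (ds := ds); first by rewrite /= drop0.
rewrite sem_forE bnd; split; [by rewrite q0|by rewrite q0|exact: ql].
Qed.

(** The ceiling of the binary logarithm, by doubling; [n] rounds suffice since [n < 2^n]. The
    exponent is counted as a real because it enters the threshold. *)
Definition log_n : prog :=
  two_pow ::= NConst 1 ;; PR real_log (NConst 0) (RConst 0) ;;
  PFor 38 var_n
    (PIf (NLe (NSucc (var two_pow)) var_n)
       (two_pow ::= NAdd (var two_pow) (var two_pow) ;;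
        PR real_log (NConst 0) (RAdd (RGet real_log (NConst 0)) (RConst 1)))
       PSkip).

Definition real_size : prog :=
  PR real_n (NConst 0) (RConst 0) ;;
  PFor 39 var_n
    (PR real_n (NConst 0) (RAdd (RGet real_n (NConst 0)) (RConst 1))).

Definition set_threshold (A : nat) : prog :=
  PR threshold (NConst 0)
    (RMul (RMul (RMul (RConst 320) (RConst A)) (RMul (RConst 320) (RConst A)))
          (RMul (RGet real_n (NConst 0)) (RGet real_log (NConst 0)))).

Definition copy_weights : prog :=
  PFor 40 var_M (PR weight (var 40) (RGet wt_in (var 40))).

Definition initialize (A : nat) : prog :=
  parse ;; log_n ;; real_size ;; set_threshold A.

Definition sparsify (A : nat) : prog :=
  initialize A ;;
  PIf (BAnd (NLe (NConst 2) var_n)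
            (BNot (RLe (RConst 1) (RGet eps_in (NConst 0)))))
    (copy_weights ;; PFor 34 (NAdd (NAdd var_n var_n) (NConst 2)) level)
    PSkip.

Section Initialize.
Variable R : realType.
Implicit Types s : state R.

Lemma log_nP s : (0 < nmem s 0 0)%N ->
  exists l, [/\ rmem (sem log_n s) real_log 0 = l%:R,
    (nmem s 0 0 <= 2 ^ l)%N & (2 ^ l < 2 * nmem s 0 0)%N].
Proof.
set n := nmem s 0 0 => n0.
pose I k s' := exists l, [/\ nmem s' two_pow 0 = (2 ^ l)%N,
  rmem s' real_log 0 = l%:R :> R, (n <= 2 ^ l)%N \/ (n - k <= l)%N & (2 ^ l < 2 * n)%N].
suff [l [_ rl H1 H2]] : I 0%N (sem log_n s).
  exists l; split=> //; case: H1 => //; rewrite subn0 => nl.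
  by apply: leq_trans nl (ltnW _); apply: ltn_expl.
rewrite /log_n !sem_seq; set s0 := sem _ (sem _ s).
have s0n : nmem s0 0 0 = n by [].
apply: sem_for => //.
  rewrite (s0n : neval s0 var_n = n); exists 0%N; split=> //; last by lia.
  by right; rewrite subnn.
move=> k s'; rewrite (s0n : neval s0 var_n = n) => kn [AN _ _] s'k [l [tl rl H1 H2]].
rewrite !semE [beval _ _]/= /update /= (AN 0%N) // s0n tl addn1.
case: ifP => ln.
  exists l.+1; split.
  - by rewrite /= /update /= tl addnn -mul2n expnS.
  - by rewrite /= /update /= rl natr1.
  - by right; case: H1; lia.
  - by rewrite expnS; lia.
exists l; split=> //; left; lia.
Qed.

Lemma real_sizeP s : rmem (sem real_size s) real_n 0 = (nmem s 0 0)%:R.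
Proof.
rewrite /real_size sem_seq; set s0 := sem _ s; set n := nmem s 0 0.
have s0n : nmem s0 0 0 = n by [].
rewrite -[n in RHS]subn0.
apply: (@sem_for _ (fun k s' => rmem s' real_n 0 = (n - k)%:R)) => //.
  by rewrite (s0n : neval s0 var_n = n) subnn.
move=> k s'; rewrite (s0n : neval s0 var_n = n) => kn _ s'k IH.
by rewrite sem_setR /= /update /= IH natr1; congr _%:R; lia.
Qed.

Lemma copy_weightsP s e : (e < nmem s 0 1)%N ->
  rmem (sem copy_weights s) weight e = rmem s wt_in e.
Proof.
set M := nmem s 0 1 => eM.
suff : forall e, (0 <= e)%N -> (e < M)%N ->
    rmem (sem copy_weights s) weight e = rmem s wt_in e by apply.
apply: (@sem_for _ (fun k s' => forall e, (k <= e)%N -> (e < M)%N ->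
    rmem s' weight e = rmem s wt_in e)) => //.
  by move=> u Mu; rewrite ltnNge Mu.
move=> k s' _ [_ AR _] s'k IH u; rewrite sem_setR /= /update /= leq_eqVlt.
case/orP => [/eqP ->|ku] uM; first by rewrite eqxx AR.
by rewrite gtn_eqF //; exact: IH.
Qed.

End Initialize.

(** * Encoded hedgegraphs *)

Lemma all_linksP k ds e x v : (e, x, v) \in all_links k ds ->
  [/\ (k <= e)%N, (e < k + size ds)%N &
    exists2 h, h \in nth [::] ds (e - k) & v \in h /\ x = head 0%N h].
Proof.
elim: ds k => //= d ds IH k; rewrite mem_cat => /orP[|/IH[ke es [h hd hv]]].
  move=> /flattenP[s /mapP[h hd ->] /mapP[v' vh [-> -> ->]]].
  by rewrite leqnn subnn /=; split=> //; [lia|exists h].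
split; [by lia|by lia|]; exists h => //.
by move: hd; rewrite -[(e - k)%N]prednK ?subn_gt0 //= -subnS.
Qed.

Lemma mem_all_links k (ds : seq (seq (seq nat))) i h v : (i < size ds)%N ->
  h \in nth [::] ds i -> v \in h -> ((k + i)%N, head 0%N h, v) \in all_links k ds.
Proof.
elim: ds k i => //= d ds IH k [|i] /= ids hd vh; rewrite mem_cat.
  rewrite addn0; apply/orP; left; apply/flattenP.
  by exists [seq (k, head 0%N h, u) | u <- h]; apply: map_f.
by rewrite -addSnnS IH ?orbT.
Qed.

Lemma size_all_links k ds n : (forall d, d \in ds -> (sumn (map size d) <= n)%N) ->
  (size (all_links k ds) <= size ds * n)%N.
Proof.
elim: ds k => //= d ds IH k dsn; rewrite size_cat mulSn leq_add //.
  apply: leq_trans (dsn d (mem_head _ _)).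
  rewrite size_flatten /shape -map_comp.
  by rewrite (eq_map (g := size)) // => h /=; rewrite size_map.
by apply: IH => d' d'ds; apply: dsn; rewrite inE d'ds orbT.
Qed.

Section Encoding.
Variables (V : finType) (G : hedgegraph V).
Implicit Types (e : hedge V) (P : {set {set V}}).

Definition vertex_ranks (h : hyperedge V) : seq nat :=
  [seq nat_of_ord (enum_rank v) | v <- enum h].

Definition hedge_sets e : seq (seq nat) := [seq vertex_ranks h | h <- enum e].

Lemma encode_hedgeE e : encode_hedge e = encode_sets (hedge_sets e).
Proof.
rewrite /encode_hedge /encode_sets /hedge_sets size_map -cardE -map_comp.
congr (_ :: flatten _); apply: eq_map => h /=.
by rewrite /encode_hyperedge /vertex_ranks size_map -cardE.
Qed.

Definition links : seq link :=
  all_links 0 [seq hedge_sets e | e <- enum (hedges G)].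

Lemma encode_hedgegraphE : encode_hedgegraph G =
  [:: #|V|, size [seq hedge_sets e | e <- enum (hedges G)] &
    flatten [seq encode_sets d | d <- [seq hedge_sets e | e <- enum (hedges G)]]].
Proof.
rewrite /encode_hedgegraph size_map -cardE -map_comp.
by congr [:: _, _ & flatten _]; apply: eq_map => e /=; exact: encode_hedgeE.
Qed.

Lemma hedge_card_le e : e \in hedges G -> (\sum_(h in e) #|h| <= #|V|)%N.
Proof.
move=> eG; have := hedges_disjoint_hyperedges eG; rewrite /trivIset => /eqP ->.
exact: max_card.
Qed.

(** Hedges are disjoint sets of subsets of [V], and at most one of them is empty. The bound makes a
    number of levels linear in [n] sufficient, whatever the number of hedges. *)
Lemma card_hedges_le : (#|hedges G| <= (2 ^ #|V|).+1)%N.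
Proof.
have := hedges_no_shared_hyperedge G; rewrite /trivIset => /eqP S.
have : (\sum_(e in hedges G) #|e| <= 2 ^ #|V|)%N.
  rewrite S; apply: leq_trans (max_card _) _.
  by rewrite -cardsT -powersetT card_powerset cardsT.
have : (\sum_(e in hedges G) (e == set0) <= 1)%N.
  rewrite -big_mkcondr /= sum1_card -(card1 (set0 : hedge V)).
  by apply/subset_leq_card/subsetP => e; rewrite !inE => /andP[].
have : (#|hedges G| <= \sum_(e in hedges G) (#|e| + (e == set0)))%N.
  rewrite -sum1_card; apply: leq_sum => e _.
  by rewrite -cards_eq0; case: #|e|.
rewrite big_split /=; lia.
Qed.

Lemma hedge_size_le e : (#|e| <= (\sum_(h in e) #|h|).+1)%N.
Proof.
have : (\sum_(h in e) (h == set0) <= 1)%N.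
  rewrite -big_mkcondr /= sum1_card -(card1 (set0 : hyperedge V)).
  by apply/subset_leq_card/subsetP => h; rewrite !inE => /andP[].
have : (#|e| <= \sum_(h in e) (#|h| + (h == set0)))%N.
  rewrite -sum1_card; apply: leq_sum => h _.
  by rewrite -cards_eq0; case: #|h|.
rewrite big_split /=; lia.
Qed.

Lemma encoding_le i : (nth 0%N (encode_hedgegraph G) i <= input_size G)%N.
Proof.
have H x : x \in encode_hedgegraph G -> (x <= input_size G)%N.
  have VN : (#|V| <= input_size G)%N by rewrite /input_size; lia.
  rewrite !inE => /or3P[/eqP -> //|/eqP ->|]; first by rewrite /input_size; lia.
  move=> /flattenP[s /mapP[e]]; rewrite mem_enum => eG -> {s}.
  rewrite inE => /orP[/eqP ->|].
    apply: leq_trans (hedge_size_le e) _.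
    have : (0 < #|hedges G|)%N by apply/card_gt0P; exists e.
    have : (\sum_(h in e) #|h| <= hedgegraph_size G)%N.
      by rewrite /hedgegraph_size (bigD1 e) //= leq_addr.
    rewrite /input_size; lia.
  move=> /flattenP[s /mapP[h _ ->] {s}]; rewrite inE => /orP[/eqP ->|/mapP[v _ ->]].
    by apply: leq_trans (max_card _) _.
  by apply: leq_trans (ltnW (ltn_ord _)) _.
case: (ltnP i (size (encode_hedgegraph G))) => iN; first by apply: H; exact: mem_nth.
by rewrite nth_default.
Qed.

Local Notation M := #|hedges G|.

Lemma links_ltM l : l \in links -> (l.1.1 < M)%N.
Proof.
by case: l => [[e x] v] /all_linksP[_]; rewrite size_map -cardE.
Qed.

Lemma links_ltn l : l \in links -> (l.1.2 < #|V|)%N /\ (l.2 < #|V|)%N.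
Proof.
case: l => [[e x] v] /all_linksP[_]; rewrite size_map subn0 => eM [h].
rewrite (nth_map set0) // => /mapP[s _ ->] [vs ->] /=.
rewrite /vertex_ranks in vs *.
split; last by case/mapP: vs => u _ ->; exact: ltn_ord.
by case: (enum s) vs => //= u us _; exact: ltn_ord.
Qed.

Lemma size_links : (size links <= M * #|V|)%N.
Proof.
apply: leq_trans (size_all_links _ _) _.
  move=> d /mapP[e]; rewrite mem_enum => eG ->.
  apply: leq_trans (hedge_card_le eG).
  rewrite -map_comp sumnE big_map -[leqRHS]big_enum /=.
  by under eq_bigr => h _ do rewrite size_map -cardE.
by rewrite size_map -cardE.
Qed.

(** * Partitions as labelings *)

Section Labels.
Variables (n' : nat) (v0 : V).
Hypothesis cardV : #|V| = n'.+1.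

Definition vertex (i : nat) : V := nth v0 (enum V) i.

(** Labels have to be vertices, so a part is named by one of its members; the choice depends on the
    part only, not on [u]. *)
Definition representative P (u : V) : V := odflt u [pick z in pblock P u].

Definition part_label P : {ffun 'I_n'.+1 -> 'I_n'.+1} :=
  [ffun i : 'I_n'.+1 => inord (enum_rank (representative P (vertex i)))].

Lemma representative_eq P x y : partition P [set: V] ->
  (representative P x == representative P y) = (pblock P x == pblock P y).
Proof.
case/and3P => /eqP cov tI _.
have repP u : pblock P (representative P u) = pblock P u.
  rewrite /representative; case: pickP => [z zu|//]; exact: same_pblock.
apply/eqP/eqP => [E|E]; first by rewrite -repP E repP.
rewrite /representative E; case: pickP => [//|/(_ y)].
by rewrite mem_pblock cov inE.
Qed.

Lemma splits_part_label P (k : nat) (x y : V) : partition P [set: V] ->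
  splits (part_label P) (k, enum_rank x : nat, enum_rank y : nat) =
  (pblock P x != pblock P y).
Proof.
move=> partP; rewrite /splits /= !ffunE.
have lt_n (z : V) : (enum_rank z < n'.+1)%N by rewrite -cardV.
rewrite !inordK // /vertex !nth_enum_rank -val_eqE /= !inordK //.
by rewrite val_eqE (inj_eq enum_rank_inj) representative_eq.
Qed.

Lemma crossesP P (h : hyperedge V) : partition P [set: V] ->
  reflect (exists x y, [/\ x \in h, y \in h & pblock P x != pblock P y])
          (crosses P h).
Proof.
case/and3P => /eqP cov tI _.
have inP x : pblock P x \in P by rewrite pblock_mem // cov inE.
have xin x : x \in pblock P x by rewrite mem_pblock cov inE.
apply: (iffP card_gt1P) => [[A [B []]]|[x [y [xh yh ne]]]].
  rewrite !inE => /andP[AP /set0Pn[x]] + /andP[BP /set0Pn[y]].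
  rewrite !inE => /andP[xA xh] /andP[yB yh] AB; exists x, y; split=> //.
  by rewrite (def_pblock tI AP xA) (def_pblock tI BP yB).
exists (pblock P x), (pblock P y); split=> //; rewrite inE inP /=; apply/set0Pn.
  by exists x; rewrite inE xin.
by exists y; rewrite inE xin.
Qed.

Lemma crossing_part_label P e : partition P [set: V] -> e \in hedges G ->
  crossing links (part_label P) (index e (enum (hedges G))) =
  [exists h in e, crosses P h].
Proof.
move=> partP eG; set i := index e _.
have iM : (i < size (enum (hedges G)))%N by rewrite index_mem mem_enum.
have ithE : nth [::] [seq hedge_sets e | e <- enum (hedges G)] i = hedge_sets e.
  by rewrite (nth_map set0) // nth_index // mem_enum.
apply/idP/existsP => [/hasP[[[k a] b] lL /andP[/eqP /= ki sp]]|[h /andP[he]]].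
  move: lL => /all_linksP[_ _ [s]]; rewrite subn0 ki ithE => /mapP[h].
  rewrite mem_enum => he -> [/mapP[y]]; rewrite mem_enum => yh bE aE.
  exists h; rewrite he /=; apply/(crossesP _ partP).
  have [x xh aE'] : exists2 x, x \in h & a = enum_rank x.
    rewrite aE /vertex_ranks; case: (enum h) (mem_enum h) => [/(_ y)|x us /(_ x)].
      by rewrite in_nil yh.
    by rewrite mem_head => /esym xh; exists x.
  exists x, y; split=> //; move: sp; rewrite aE' bE.
  by rewrite splits_part_label.
move=> /(crossesP _ partP)[x [y [xh yh xy]]].
have [x0 [us hE]] : exists x0 us, enum h = x0 :: us.
  case: (enum h) (mem_enum h x) => [|x0 us _]; last by exists x0, us.
  by rewrite in_nil xh.
have sub z : z \in h -> (i, enum_rank x0 : nat, enum_rank z : nat) \in links.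
  move=> zh; have := @mem_all_links 0 [seq hedge_sets e | e <- enum (hedges G)] i
    (vertex_ranks h) (enum_rank z).
  have -> : head 0%N (vertex_ranks h) = enum_rank x0 by rewrite /vertex_ranks hE.
  rewrite add0n ithE size_map; apply=> //.
    by apply: map_f; rewrite mem_enum.
  by apply: (map_f (fun v => nat_of_ord (enum_rank v))); rewrite mem_enum.
have split_at z : z \in h -> pblock P x0 != pblock P z ->
    crossing links (part_label P) i.
  move=> zh ne; apply/hasP; exists (i, enum_rank x0 : nat, enum_rank z : nat).
    exact: sub.
  by rewrite eqxx splits_part_label.
(* The centre [x0] of the star cannot lie in the part of [x] and in that of [y]. *)
case: (eqVneq (pblock P x0) (pblock P x)) => [E|]; last exact: split_at.
by apply: (split_at y) => //; rewrite E.
Qed.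

Lemma capacity_part_label (R : realType) (w : hedge V -> R) (wt : nat -> R) P :
  partition P [set: V] ->
  (forall e, e \in hedges G -> w e = wt (index e (enum (hedges G)))) ->
  capacity G w P = link_capacity M links wt (part_label P).
Proof.
move=> partP wE; rewrite /capacity /link_capacity /delta.
rewrite (eq_bigl (fun e => (e \in hedges G) && [exists h in e, crosses P h])); last first.
  by move=> e; rewrite inE.
rewrite -big_enum_cond (big_nth set0) -cardE big_mkord.
rewrite [LHS]big_mkcond [RHS]big_mkcond; apply: eq_bigr => i _.
have iM : (i < size (enum (hedges G)))%N by rewrite -cardE.
have eG : nth set0 (enum (hedges G)) i \in hedges G by rewrite -mem_enum mem_nth.
have idx : index (nth set0 (enum (hedges G)) i) (enum (hedges G)) = i.
  by rewrite index_uniq // enum_uniq.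
by rewrite -(crossing_part_label partP eG) wE // idx.
Qed.

End Labels.
End Encoding.

(** * The sparsification program *)

Section Correctness.
Variables (R : realType) (V : finType) (G : hedgegraph V).
Variables (w : hedge V -> R) (eps : R) (A : nat).
Hypothesis w_ge0 : nonneg_weights G w.
Hypothesis eps_gt0 : 0 < eps.
Local Notation M := #|hedges G|.
Local Notation start := (init_state G w eps).

Lemma run_compile p t tape : well_formed p -> ~~ writesN p 0 ->
  ((cost_poly p).[input_size G] <= t)%N ->
  run t (compile p) (start tape) = ([::], sem p (start tape)).
Proof.
move=> wp np ct; rewrite /run.
have [|k kc kE] := compile_correct (N := input_size G) (s := start tape) wp np.
  by move=> i; exact: encoding_le.
have halt j s : iter j (@step R) ([::], s) = ([::], s) by elim: j => //= j ->.
by rewrite -(subnK (leq_trans kc ct)) iterD kE halt.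
Qed.

Lemma sem_start_coins p tape : ~~ flips p ->
  sem p (start tape) = set_coins tape (sem p (start [::])).
Proof. by move=> pf; rewrite -sem_set_coins. Qed.

Lemma start_loaded p : ~~ [|| writesN p 0, writesN p lk_hedge, writesN p lk_src | writesN p lk_dst] ->
  links_loaded #|V| M (links G) (sem p (sem parse (start [::]))).
Proof.
move=> wp; apply: links_loaded_agree wp (agree_sem _ _) _.
rewrite [M](_ : _ = size [seq hedge_sets e | e <- enum (hedges G)]); last first.
  by rewrite size_map -cardE.
apply: parseP; first by move=> i; rewrite /= encode_hedgegraphE.
by move=> a i /negbTE; rewrite /= => ->.
Qed.

Definition initialized : state R := sem (initialize A) (start [::]).

Lemma initialized_loaded : links_loaded #|V| M (links G) initialized.
Proof. by rewrite /initialized /initialize sem_seq; exact: start_loaded. Qed.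

Lemma initialized_rmem a i : (a < 3)%N ->
  rmem initialized a i = rmem (start [::]) a i.
Proof. by case: a => [|[|[|]]] // _; rewrite /initialized sem_rmem. Qed.

Lemma initialized_threshold : (0 < #|V|)%N -> exists l,
  [/\ rmem initialized threshold 0 = (320 * A%:R) ^+ 2 * (#|V|%:R * l%:R),
    (#|V| <= 2 ^ l)%N & (2 ^ l < 2 * #|V|)%N].
Proof.
move=> V0; rewrite /initialized /initialize sem_seq.
have [n1 _ _] := @start_loaded PSkip isT; rewrite sem_skip in n1.
set s1 := sem parse _ in n1 *.
rewrite 2!sem_seq; set s2 := sem log_n s1.
have [|l [rl nl ln]] := @log_nP R s1; first by rewrite n1.
exists l; rewrite -n1; split=> //; rewrite -/s2 in rl.
rewrite /set_threshold sem_setR /= /update /= real_sizeP.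
have -> : nmem s2 0 0 = nmem s1 0 0 by rewrite /s2 sem_nmem.
have -> : rmem (sem real_size s2) real_log 0 = l%:R by rewrite sem_rmem.
by rewrite expr2.
Qed.

Lemma zero_sparsifier (C : R) w' : 0 <= C -> (#|V| <= 1)%N || (1 <= eps) ->
  (forall e, w' e = 0) -> is_sparsifier G C w eps w'.
Proof.
move=> C0 triv w'0; apply/and3P; split.
- by apply/forall_inP => e _; rewrite w'0.
- have -> : weight_support G w' = set0.
    by apply/setP => e; rewrite !inE w'0 eqxx andbF.
  rewrite cards0 mulr_ge0 // divr_ge0 ?sqr_ge0 //.
  case: (posnP #|V|) => [->|V0]; first by rewrite mul0r.
  by rewrite mulr_ge0 // ln_ge0 // ler1n.
apply/forall_inP => P partP.
have -> : capacity G w' P = 0 by rewrite /capacity big1.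
have c0 : 0 <= capacity G w P.
  apply: sumr_ge0 => e; rewrite inE => /andP[eG _].
  by move/forall_inP: w_ge0; apply.
case/orP: triv => [V1|e1].
  rewrite /capacity big_pred0 ?mulr0 ?lexx // => e; rewrite inE.
  apply/negbTE/negP => /andP[_ /existsP[h /andP[_ /(crossesP _ partP)[x [y [_ _ xy]]]]]].
  by move/card_le1P: V1 => /(_ x) V1; move: xy; have := V1 _ y; rewrite !inE => /(_ isT)/esym/eqP ->; rewrite eqxx.
by apply/andP; split; [rewrite mulr_le0_ge0 // subr_le0|rewrite mulr_ge0 // addr_ge0 // ltW].
Qed.

Lemma invariant_sparsifier n' l cap0 s : #|V| = n'.+1 -> (1 < n'.+1)%N ->
  (2 ^ l < 2 * n'.+1)%N -> (0 < l)%N -> (0 < A)%N -> eps < 1 ->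
  (forall f, 0 <= cap0 f) ->
  (forall P, partition P [set: V] -> exists f, capacity G w P = cap0 f /\
     capacity G (output_weights G s) P =
       link_capacity M (links G) (rmem s weight) f) ->
  @invariant R n' M (links G) A l eps cap0 0 s ->
  is_sparsifier G (4 * (320 * A%:R) ^+ 2) w eps (output_weights G s).
Proof.
move=> cardV n1 llt l0 A0 eps1 cap0_ge0 capE [_ sthr seps s0 [d [d0 de _ dacc]] spos].
have idx e : e \in hedges G -> (index e (enum (hedges G)) < M)%N.
  by move=> eG; rewrite [M]cardE index_mem mem_enum.
apply/and3P; split.
- by apply/forall_inP => e eG; exact: s0 (idx e eG).
- have suppE : (#|weight_support G (output_weights G s)| <= positives M s)%N.
    rewrite -sum1_card /weight_support.
    rewrite (eq_bigl (fun e => (e \in hedges G) && (output_weights G s e != 0))); last first.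
      by move=> e; rewrite inE.
    rewrite -big_enum_cond (big_nth set0) -cardE big_mkord big_mkcond.
    apply: leq_sum => i _; rewrite /output_weights index_uniq ?enum_uniq -?cardE //.
    by rewrite lt0r s0 // andbT; case: (_ != 0).
  have inact : (positives M s)%:R * eps * eps <= thr R n' A l.
    rewrite leNgt; apply/negP => act.
    have m1 : (positives M s <= 1)%N.
      by have := spos; rewrite /active sthr seps act !expn0 muln1; apply.
    have A1 : 1 <= (320 * A%:R) ^+ 2 :> R.
      rewrite exprn_ege1 // mulr_ege1 // ?ler1n //.
    have thr1 : 1 <= thr R n' A l.
      by rewrite mulr_ege1 // mulr_ege1 // ler1n.
    have : (positives M s)%:R * eps * eps <= 1.
      by rewrite -mulrA mulr_ile1 ?mulr_ile1 ?mulr_ge0 ?(ltW eps_gt0) ?(ltW eps1) ?lern1.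
    by rewrite leNgt (le_lt_trans thr1 act).
  apply: (@le_trans _ _ ((positives M s)%:R)); first by rewrite ler_nat.
  (* [2^l < 2 n <= n^2] and [ln 2 >= 1/2] give [l / 2 <= 2 ln n]; hence the factor 4 in the constant
     of the sparsifier. *)
  have lln : l%:R <= 4 * ln (#|V|%:R : R).
    rewrite cardV; set N : R := n'.+1%:R.
    have N0 : 0 < N by rewrite ltr0n.
    have ln2 : 1 / 2 <= ln (2 : R).
      have := @le_ln1Dx R (- (1 / 2)); rewrite (_ : 1 + - (1 / 2) = 2^-1); last by field.
      rewrite lnV ?posrE //; lra.
    have : ln (2 ^+ l : R) <= ln (N ^+ 2).
      rewrite ler_ln ?posrE ?exprn_gt0 // -!natrX ler_nat.
      by apply: leq_trans (ltnW llt) _; rewrite expnS expn1 leq_mul2r n1 orbT.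
    rewrite (lnXn l) // (lnXn 2) // -[ln 2 *+ l]mulr_natr -[ln N *+ 2]mulr_natr.
    have := ler_wpM2r (ler0n R l) ln2; lra.
  rewrite [leRHS]mulrA ler_pdivlMr ?exprn_gt0 //.
  apply: (@le_trans _ _ (thr R n' A l)); first by rewrite [eps ^+ 2]expr2 mulrA.
  rewrite /thr -cardV; set K := (320 * _) ^+ 2; set N := #|V|%:R in lln *.
  rewrite (_ : 4 * K * (N * ln N) = K * (N * (4 * ln N))); last by ring.
  by rewrite ler_wpM2l ?sqr_ge0 // ler_wpM2l.
apply/forall_inP => P partP; have [f [-> ->]] := capE P partP.
have /andP[lo hi] := dacc f.
have c0 := cap0_ge0 f; have := ler_wpM2r c0 de => dc.
apply/andP; split; [apply: le_trans lo|apply: le_trans hi _]; lra.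
Qed.

(* [#|hedges G| <= 2 ^ #|V| + 1] and two levels more than halve the number of
   positive weights. *)
Definition num_levels : nat := (#|V| + #|V| + 2)%N.

Definition copied : state R :=
  set_nat 34 0 num_levels (sem copy_weights initialized).

Lemma sem_sparsify tape : (1 < #|V|)%N -> eps < 1 ->
  sem (sparsify A) (start tape) =
  loop 34 (sem level) num_levels (set_coins tape copied).
Proof.
move=> V1 eps1; rewrite /sparsify sem_seq sem_start_coins // -/initialized.
have [n1 _ _] := initialized_loaded.
have e1 : rmem initialized eps_in 0 = eps by rewrite initialized_rmem.
rewrite sem_if beval_set_coins.
rewrite -[beval _ _]/((2 <= nmem initialized 0 0)%N && ~~ (1%:R <= rmem initialized eps_in 0)).
rewrite n1 V1 e1 -ltNge eps1 /= sem_seq sem_set_coins //.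
rewrite sem_forE /copied; set s2 := sem copy_weights initialized.
have -> : neval (set_coins tape s2) (NAdd (NAdd var_n var_n) (NConst 2)) = num_levels.
  have s2n : nmem s2 0 0 = #|V| by rewrite /s2 sem_nmem.
  by rewrite -[LHS]/(nmem s2 0 0 + nmem s2 0 0 + 2)%N s2n.
by [].
Qed.

Lemma num_levels_enough : (0 < #|V|)%N ->
  (M * 16 ^ num_levels <= 25 ^ num_levels)%N.
Proof.
move=> V0; have -> : num_levels = (2 * #|V|.+1)%N by rewrite /num_levels; lia.
rewrite !expnM; apply: leq_trans (_ : (2 ^ #|V|.+1 * (16 ^ 2) ^ #|V|.+1 <= _)%N).
  rewrite leq_mul2r; apply/orP; right; apply: leq_trans (card_hedges_le G) _.
  by rewrite expnS; have := expn_gt0 2 #|V|; lia.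
by rewrite -expnMn leq_exp2r.
Qed.

Lemma copied_weight e : e \in hedges G ->
  rmem copied weight (index e (enum (hedges G))) = w e.
Proof.
move=> eG; rewrite /copied; have [_ M1 _] := initialized_loaded.
have := @copy_weightsP R initialized (index e (enum (hedges G))).
rewrite M1 [M]cardE index_mem mem_enum => /(_ eG).
rewrite initialized_rmem //= (nth_map set0) ?index_mem ?mem_enum //.
by rewrite nth_index ?mem_enum.
Qed.

Lemma invariant_copied n' l : #|V| = n'.+1 ->
  rmem initialized threshold 0 = thr R n' A l ->
  @invariant R n' M (links G) A l eps
    (link_capacity M (links G) (rmem copied weight)) num_levels copied.
Proof.
move=> cardV tE.
split.
- rewrite -cardV /copied; apply: links_loaded_agree (agree_sem copy_weights initialized) _ => //.
  exact: initialized_loaded.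
- by rewrite -tE /copied /= sem_rmem.
- by rewrite /copied /= sem_rmem //; exact: initialized_rmem.
- move=> i iM; have iM' : (i < size (enum (hedges G)))%N by rewrite -cardE.
  rewrite -(index_uniq set0 iM' (enum_uniq _)) copied_weight.
    by move/forall_inP: w_ge0; apply; rewrite -mem_enum mem_nth.
  by rewrite -mem_enum mem_nth.
- exists 0; split; [by []|exact: ltW| |].
    by rewrite expr0n mul0r mulr_ge0 ?sqr_ge0 // mulr_ge0.
  by move=> f; rewrite subr0 addr0 mul1r lexx.
move=> _; apply: leq_trans (num_levels_enough _); last by rewrite cardV.
by rewrite leq_mul2r positives_le orbT.
Qed.

Lemma run_succeedsE (C : R) t tape :
  ((cost_poly (sparsify A)).[input_size G] <= t)%N ->
  run_succeeds G C (compile (sparsify A)) w eps t tape =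
  is_sparsifier G C w eps (output_weights G (sem (sparsify A) (start tape))).
Proof. by move=> ct; rewrite /run_succeeds run_compile. Qed.

Lemma sparsify_trivial (C : R) tape : 0 <= C -> (#|V| <= 1)%N || (1 <= eps) ->
  is_sparsifier G C w eps (output_weights G (sem (sparsify A) (start tape))).
Proof.
move=> C0 triv; apply: zero_sparsifier => // e.
rewrite /sparsify sem_seq sem_start_coins // -/initialized.
have [n1 _ _] := initialized_loaded.
have e1 : rmem initialized eps_in 0 = eps by rewrite initialized_rmem.
rewrite sem_if beval_set_coins.
rewrite -[beval _ _]/((2 <= nmem initialized 0 0)%N && ~~ (1%:R <= rmem initialized eps_in 0)).
rewrite n1 e1 ltnNge -negb_or triv sem_skip /output_weights.
by rewrite -[rmem _ _ _]/(rmem initialized weight _) initialized_rmem.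
Qed.

Lemma mean_failures_le T : (5 <= A)%N -> (1 < #|V|)%N -> eps < 1 ->
  (num_levels * M <= T)%N ->
  mean T (fun tape => (~~ is_sparsifier G (4 * (320 * A%:R) ^+ 2) w eps
      (output_weights G (sem (sparsify A) (start tape))))%:R)
    <= num_levels%:R * failure R #|V|.-1 A.
Proof.
move=> A5 V1 eps1 MT; have V0 := ltnW V1.
have cardV : #|V| = #|V|.-1.+1 by rewrite prednK.
have [l [tE nl ln]] := initialized_threshold V0.
have l0 : (0 < l)%N.
  by rewrite lt0n; apply/eqP => l0; move: nl; rewrite l0 leqNgt V1.
have tE' : rmem initialized threshold 0 = thr R #|V|.-1 A l by rewrite /thr -cardV.
have inv := invariant_copied cardV tE'.
have cap0_ge0 (f : {ffun 'I_(#|V|.-1.+1) -> 'I_(#|V|.-1.+1)}) :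
    0 <= link_capacity M (links G) (rmem copied weight) f.
  by apply: sumr_ge0 => e _; exact: (inv_ge0 inv).
have [v0 _] : exists v0 : V, v0 \in V by exact/card_gt0P.
pose accepts s := is_sparsifier G (4 * (320 * A%:R) ^+ 2) w eps (output_weights G s).
have accP s : @invariant R #|V|.-1 M (links G) A l eps
    (link_capacity M (links G) (rmem copied weight)) 0 s -> accepts s.
  move=> inv_s; apply: (invariant_sparsifier cardV _ _ l0 _ eps1 cap0_ge0 _ inv_s).
  - by rewrite -cardV.
  - by rewrite -cardV.
  - by apply: leq_trans A5.
  move=> P partP; exists (part_label #|V|.-1 v0 P).
  split; apply: capacity_part_label => // e eG.
  by rewrite copied_weight.
have nle : (#|V|.-1.+1 <= 2 ^ l)%N by rewrite -cardV.
have V1' : (1 < #|V|.-1.+1)%N by rewrite -cardV.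
have L_ltn k : k \in links G -> (k.1.2 < #|V|.-1.+1)%N /\ (k.2 < #|V|.-1.+1)%N.
  by rewrite -cardV; exact: links_ltn.
have L_size : (size (links G) <= M * #|V|.-1.+1)%N by rewrite -cardV; exact: size_links.
have := mean_levels_le V1' (@links_ltM _ G) L_ltn L_size A5 nle eps_gt0 eps1 cap0_ge0 accP (T - num_levels * M) inv.
apply: le_trans; rewrite subnKC //; apply: le_mean => u _.
by rewrite sem_sparsify.
Qed.

End Correctness.

(** Origin of the 13: at most [4 n] levels fail with total probability at most [128 n^6 / n^A], and
    [128 = 2^7 <= n^7]. *)
Lemma failure_le (R : realType) (V : finType) (c : nat) : (1 < #|V|)%N ->
  (num_levels V)%:R * failure R #|V|.-1 (c + 13) <= (#|V|%:R ^+ c)^-1.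
Proof.
move=> V1; rewrite /failure prednK ?(ltnW V1) //.
have bound : (num_levels V * (32 * #|V| ^ 5) <= #|V| ^ 13)%N.
  apply: (@leq_trans (128 * #|V| ^ 6)).
    rewrite [(#|V| ^ 6)%N]expnS.
    apply: (@leq_trans (4 * #|V| * (32 * #|V| ^ 5))); last by lia.
    by rewrite leq_mul2r; apply/orP; right; rewrite /num_levels; lia.
  by rewrite (expnD _ 7 6) leq_mul2r (leq_exp2r 2 _ (isT : (0 < 7)%N)) V1 orbT.
have Np : 0 < #|V|%:R :> R by rewrite ltr0n ltnW.
rewrite mulrA ler_pdivrMr ?exprn_gt0 // exprD mulKf ?expf_neq0 ?lt0r_neq0 //.
by rewrite -!natrX -!natrM ler_nat.
Qed.

Lemma sparsify_success (R : realType) (c t : nat) (V : finType)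
    (G : hedgegraph V) (w : hedge V -> R) (eps : R) :
  nonneg_weights G w -> 0 < eps ->
  ((cost_poly (sparsify (c + 13))).[input_size G] <= t)%N ->
  ((input_size G + input_size G + 2) * input_size G <= t)%N ->
  1 - (#|V|%:R ^+ c)^-1 <=
    success_probability G (4 * (320 * (c + 13)%:R) ^+ 2)
      (compile (sparsify (c + 13))) w eps t.
Proof.
move=> w0 eps0 ct Mt; rewrite /success_probability.
rewrite (mean_card R t (run_succeeds G (4 * (320 * (c + 13)%:R) ^+ 2)
      (compile (sparsify (c + 13))) w eps t)).
have C0 : 0 <= 4 * (320 * (c + 13)%:R) ^+ 2 :> R.
  by rewrite mulr_ge0 ?sqr_ge0.
case: (boolP ((#|V| <= 1)%N || (1 <= eps))) => [triv|].
  apply: (@le_trans _ _ 1); first by rewrite gerBl invr_ge0 exprn_ge0.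
  rewrite -[leLHS](mean_const t); apply: le_mean => u _.
  by rewrite run_succeedsE // sparsify_trivial.
rewrite negb_or -ltnNge -ltNge => /andP[V1 eps1].
(* The tape must hold a full row for every level. *)
have MT : (num_levels V * #|hedges G| <= t)%N.
  apply: leq_trans Mt; rewrite /num_levels /input_size; apply: leq_mul; lia.
have A5 : (5 <= c + 13)%N by lia.
have := le_trans (mean_failures_le w0 eps0 A5 V1 eps1 MT) (failure_le R c V1).
set x := mean t _ => xle; rewrite lerBlDr.
apply: (@le_trans _ _ (mean t (fun u => (run_succeeds G (4 * (320 * (c + 13)%:R) ^+ 2)
      (compile (sparsify (c + 13))) w eps t u)%:R) + x)); last by rewrite lerD2l.
rewrite /x -meanD -[leLHS](mean_const t); apply: le_mean => u _.
by rewrite run_succeedsE //; case: (is_sparsifier _ _ _ _ _); rewrite ?addr0 ?add0r.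
Qed.

Lemma coins_polyE (x : nat) :
  (('X + 'X + 2%N%:P) * 'X : {poly nat}).[x] = ((x + x + 2) * x)%N.
Proof. by rewrite hornerM_nat !hornerD_nat !hornerX hornerC. Qed.

Theorem theorem1p9 (R : realType) :
  (exists2 C : R, 0 < C &
    forall (V : finType) (G : hedgegraph V) (w : {set {set V}} -> R) (eps : R),
      nonneg_weights G w -> 0 < eps ->
      exists w' : {set {set V}} -> R, is_sparsifier G C w eps w')
  /\
  (forall c : nat, exists (C : R) (prog : cmd) (q : {poly nat}),
    0 < C /\
    forall (V : finType) (G : hedgegraph V) (w : {set {set V}} -> R) (eps : R),
      nonneg_weights G w -> 0 < eps ->
      1 - (#|V|%:R ^+ c)^-1
        <= success_probability G C prog w eps q.[input_size G]).
Proof.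
have C_gt0 c : 0 < 4 * (320 * (c + 13)%:R) ^+ 2 :> R.
  by rewrite mulr_gt0 // exprn_gt0 // mulr_gt0 // ltr0n addnS.
split.
  (* Probabilistic method with [c = 1]: for [n >= 2] the success probability is at least
     [1 - 1 / n > 0], so some tape yields a sparsifier. For [n <= 1] this bound is void and the zero
     weighting is used. *)
  exists (4 * (320 * (1 + 13)%:R) ^+ 2) => // V G w eps w0 eps0.
  case: (leqP #|V| 1) => V1.
    exists (fun=> 0); apply: zero_sparsifier => //; last by rewrite V1.
    exact: ltW.
  set N := input_size G.
  pose t := ((cost_poly (sparsify (1 + 13))).[N] + (N + N + 2) * N)%N.
  have := @sparsify_success R 1 t V G w eps w0 eps0 (leq_addr _ _) (leq_addl _ _).
  rewrite /success_probability; set S := [set _ : t.-tuple bool | _].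
  case: (set_0Vmem S) => [->|[tape]].
    rewrite cards0 mul0r subr_le0 expr1 invf_ge1 ?ltr0n ?(ltnW V1) //.
    by rewrite (lern1 R) leqNgt V1.
  rewrite inE /run_succeeds; case: run => k s /andP[_ spars] _.
  by exists (output_weights G s).
move=> c; exists (4 * (320 * (c + 13)%:R) ^+ 2), (compile (sparsify (c + 13))).
(* The second summand guarantees enough coins: at most [2 N + 2] levels of at most [N] coins each,
   with [N] the input size. *)
exists (cost_poly (sparsify (c + 13)) + ('X + 'X + 2%N%:P) * 'X); split=> //.
move=> V G w eps w0 eps0; apply: sparsify_success => //.
  by rewrite hornerD_nat leq_addr.
by rewrite hornerD_nat coins_polyE leq_addl.
Qed.
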